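(* Let $\mathbf{k}$ be an algebraically closed field with $\mathrm{char}(\mathbf{k})\neq 2$, let $E=\bigwedge E_1$ be the exterior algebra of a $5$-dimensional $\mathbf{k}$-vector space $E_1=\langle e_1,\ldots,e_5\rangle$, with its standard grading, and let $\mathcal{H}=\mathcal{H}^{(1,5,7,2)}(E)$ be the standard graded Hilbert scheme parametrizing homogeneous ideals $I\subseteq E$ such that $E/I$ has Hilbert function $(1,5,7,2)$ (i.e. $I_0=I_1=0$, $\dim_{\mathbf{k}}I_2=3$, $\dim_{\mathbf{k}}I_3=8$, $I_4=E_4$, $I_5=E_5$). Then $\mathcal{H}$ is the union of two irreducible components, of dimensions $14$ and $15$, and the lexicographic point of $\mathcal{H}$ lies in the intersection of the two components; in particular, it is a singular point of $\mathcal{H}$.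
   Context: The lexicographic order on monomials of $E$ is taken with $e_1>e_2>\cdots>e_5$. The lexicographic point is the point given by the unique lexicographic ideal of $\mathcal{H}$ (the monomial ideal whose graded components are spanned by the lexicographically largest monomials of each degree), namely $L=(e_1\wedge e_2,e_1\wedge e_3,e_1\wedge e_4,e_2\wedge e_3\wedge e_4,e_2\wedge e_3\wedge e_5)$. *)

(* Defs.v *)
From HB Require Import structures.
From mathcomp Require Import all_boot all_order all_algebra.
From mathcomp Require mpoly.
Set Implicit Arguments. Unset Strict Implicit. Unset Printing Implicit Defensive.
Import GRing.Theory.
Local Open Scope ring_scope.

(* Exterior algebra E = /\ E_1 on E_1 = <e_1,...,e_5> (indices 0..4 here),
   modelled on coordinates: the monomial basis is indexed by the subsets
   S of 'I_5 (e_S = e_{s1} /\ ... /\ e_{sk}, s1 < ... < sk), and an element of E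
   is a row vector of length nE = #|{set 'I_5}| = 32, coordinate S being
   at position enum_rank S.  Subspaces of E are row spaces of matrices
   (mxalgebra). *)

Definition nE := #|{set 'I_5}|.

Definition Evec (k : fieldType) := 'rV[k]_nE.

Definition emon (k : fieldType) (S : {set 'I_5}) : Evec k :=
  delta_mx 0 (enum_rank S).

Definition ecoef (k : fieldType) (x : Evec k) (S : {set 'I_5}) : k :=
  x 0 (enum_rank S).

(* e_S /\ e_U = (-1)^{#inversions} e_{S u U} if S, U disjoint, 0 otherwise *)
Definition wsign (k : fieldType) (S U : {set 'I_5}) : k :=
  if [disjoint S & U] then
    (-1) ^+ #|[set p : 'I_5 * 'I_5 | (p.1 \in S) && (p.2 \in U) && (p.2 < p.1)%N]|
  else 0.

Definition wedge (k : fieldType) (x y : Evec k) : Evec k :=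
  \sum_(S : {set 'I_5}) \sum_(U : {set 'I_5})
     (ecoef x S * ecoef y U * wsign k S U) *: emon k (S :|: U).

(* E_d, as the diagonal projection matrix onto the span of the e_S, |S| = d;
   its row space is E_d, and x *m Edeg d is the degree-d component of x. *)
Definition Edeg (k : fieldType) (d : nat) : 'M[k]_nE :=
  \matrix_(i < nE, j < nE) (if (i == j) && (#|(enum_val (i : 'I_#|{set 'I_5}|) : {set 'I_5})| == d) then 1 else 0).

Definition is_ideal (k : fieldType) (I : 'M[k]_nE) : Prop :=
  forall x y : Evec k, (x <= I)%MS -> (wedge x y <= I)%MS /\ (wedge y x <= I)%MS.

Definition is_homogeneous (k : fieldType) (I : 'M[k]_nE) : Prop :=
  forall (x : Evec k) (d : nat), (x <= I)%MS -> (x *m Edeg k d <= I)%MS.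

Definition hilb (k : fieldType) (I : 'M[k]_nE) (d : nat) : nat :=
  (\rank (Edeg k d) - \rank (I :&: Edeg k d)%MS)%N.

Definition h1572 (d : nat) : nat := nth 0%N [:: 1; 5; 7; 2]%N d.

(* k-points of H = H^{(1,5,7,2)}(E): homogeneous ideals with Hilbert function
   (1,5,7,2); each subspace is represented by its canonical matrix <<I>>. *)
Definition Hpt (k : fieldType) (I : 'M[k]_nE) : Prop :=
  I = (<<I>>)%MS /\ is_ideal I /\ is_homogeneous I /\
  forall d, hilb I d = h1572 d.

Definition Hpoint (k : fieldType) := {I : 'M[k]_nE | Hpt I}.

(* Zariski topology on H.  A point I is determined by (I_2, I_3) (dims 3, 8),
   so H sits inside Gr(3,E_2) x Gr(8,E_3).  Its topology is the quotient
   topology from pairs of basis matrices (A, B) (rows = bases of I_2, I_3):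
   a subset Z is closed iff, on bases, membership in Z is the common vanishing
   of a family F of polynomials in the 3*nE + 8*nE matrix entries. *)
Definition nvars := (3 * nE + 8 * nE)%N.

Definition coords (k : fieldType) (A : 'M[k]_(3, nE)) (B : 'M[k]_(8, nE)) :
  'I_nvars -> k := fun i => (row_mx (mxvec A) (mxvec B)) 0 i.

Definition is_basis_of (k : fieldType) m (A : 'M[k]_(m, nE)) (V : 'M[k]_nE) :=
  row_free A /\ (A == V)%MS.

Definition Hclosed (k : fieldType) (Z : Hpoint k -> Prop) : Prop :=
  exists F : mpoly.mpoly nvars k -> Prop,
    forall (p : Hpoint k) (A : 'M[k]_(3, nE)) (B : 'M[k]_(8, nE)),
      is_basis_of A (proj1_sig p :&: Edeg k 2)%MS ->
      is_basis_of B (proj1_sig p :&: Edeg k 3)%MS ->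
      (Z p <-> forall f, F f -> mpoly.meval (coords A B) f = 0).

Definition subs (k : fieldType) (Z W : Hpoint k -> Prop) := forall p, Z p -> W p.

Definition Hirreducible (k : fieldType) (Z : Hpoint k -> Prop) : Prop :=
  Hclosed Z /\ (exists p, Z p) /\
  forall Z1 Z2, Hclosed Z1 -> Hclosed Z2 -> (forall p, Z p -> Z1 p \/ Z2 p) ->
     subs Z Z1 \/ subs Z Z2.

Definition Hcomponent (k : fieldType) (Z : Hpoint k -> Prop) : Prop :=
  Hirreducible Z /\ forall W, Hirreducible W -> subs Z W -> subs W Z.

Definition chain_in (k : fieldType) (Z : Hpoint k -> Prop) (n : nat) : Prop :=
  exists c : nat -> (Hpoint k -> Prop),
    (forall i, (i <= n)%N -> Hirreducible (c i)) /\
    (forall i, (i < n)%N -> subs (c i) (c i.+1) /\ ~ subs (c i.+1) (c i)) /\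
    subs (c n) Z.

Definition Hdim (k : fieldType) (Z : Hpoint k -> Prop) (n : nat) : Prop :=
  chain_in Z n /\ ~ chain_in Z n.+1.

Definition i5 (j : nat) : 'I_5 := inord j.
Definition lex_gens (k : fieldType) : seq (Evec k) :=
  [:: emon k [set i5 0; i5 1]; emon k [set i5 0; i5 2]; emon k [set i5 0; i5 3];
      emon k [set i5 1; i5 2; i5 3]; emon k [set i5 1; i5 2; i5 4]].

Definition is_lex_ideal (k : fieldType) (I : 'M[k]_nE) : Prop :=
  is_ideal I /\ (forall g, g \in lex_gens k -> (g <= I)%MS) /\
  forall J : 'M[k]_nE, is_ideal J -> (forall g, g \in lex_gens k -> (g <= J)%MS) ->
    (I <= J)%MS.

(* Main.v *)
(** A point of H is a pair V = I_2 (dimension 3) and W = I_3 (dimension 8) with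
    V /\ E_1 inside W.  Under the pairing of E_3 with E_2 into E_5, W is the
    annihilator of a pencil P of bivectors, and the condition becomes V /\ P = 0
    in E_4.

    For a bivector p let pi(p) be its vector of sub-Pfaffians and pi(v, p) the
    polarisation, so that pi(v, p) = 0 means v /\ p = 0.  If some p in P has
    l = pi(p) <> 0, the polarised forms of p pi(p) = 0 show that l kills V, and
    either it kills P as well or V is all of /\^2 of a 3-space, which would force
    pi(p) = 0.  If all of P has rank 2, then P is spanned by a /\ b and a /\ c.
    So H is the union of two families: pairs with P = a /\ <b, c> and
    V in a /\ E_1 + <b /\ c>, of dimension 14, and pairs with V and P in /\^2 of
    a hyperplane, of dimension 4 + 8 + 3 = 15.

    C1 and C2 are the closures of one normalised affine chart of each family.
    Since the zero set of a polynomial on a line is finite or everything, closures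
    of images of affine spaces are irreducible, and moving a point along a
    polynomial curve into the chart shows that it lies in the closure.  A chain
    of irreducible closed sets yields functions that are algebraically
    independent on its top element; a closure of an image of k^N carries at most N
    of them, because polynomials of degree O(m) in N variables form a space of
    dimension O(m^N). *)

Require Import Defs.
From HB Require Import structures.
From mathcomp Require Import all_boot all_order all_algebra.
From mathcomp Require Import mpoly ring zify.
From Stdlib Require Import Classical.
Set Implicit Arguments. Unset Strict Implicit. Unset Printing Implicit Defensive.
Import GRing.Theory.
Local Open Scope ring_scope.

(** * Polynomial functions *)

(** The topology is given only by equations on bases of I_2 and I_3, and dimension only by chains of
    irreducible closed sets, so no coordinate ring or function field is at hand. Each component is
    therefore defined as the closure of a chart, where irreducibility and dimension are visible, and
    the burden moves to showing that degenerate points are limits of chart points. The curves used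
    for this deform the frame carrying P, or the covector l, or P, or V, always keeping V /\ P = 0.

    The counts are 14 = 8 + 6, a line in a 3-space and then Gr(3, 5) for V, and 15 = 4 + 8 + 3 with
    8 = dim Gr(2, 6) for P and 3 = dim Gr(3, 4) for V.

    The characteristic enters because p /\ p = 0 is twice the Pfaffian condition that makes p
    decomposable. Of the two inclusions between the components, one is refuted by dimension and the
    other by a determinant. *)

(* Polynomials are handled as functions, generated by a set [G] of coordinate
   functions: the same closure properties then serve lines, affine spaces and
   pairs of matrices. *)
Inductive polyfun (k : fieldType) (X : Type) (G : (X -> k) -> Prop) :
  (X -> k) -> Prop :=
| pf_gen f : G f -> polyfun G f
| pf_cst c : polyfun G (fun=> c)
| pf_add f g : polyfun G f -> polyfun G g -> polyfun G (fun x => f x + g x)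
| pf_mul f g : polyfun G f -> polyfun G g -> polyfun G (fun x => f x * g x)
| pf_ext f g : f =1 g -> polyfun G f -> polyfun G g.

Definition polymx (k : fieldType) (X : Type) (G : (X -> k) -> Prop) m n
  (a : X -> 'M[k]_(m, n)) := forall i j, polyfun G (fun x => a x i j).

Section PolyFun.
Variables (k : fieldType) (X : Type) (G : (X -> k) -> Prop).

Lemma pf_opp f : polyfun G f -> polyfun G (fun x => - f x).
Proof.
move=> hf; apply: (@pf_ext _ _ _ (fun x => -1 * f x)) => [x|]; first by rewrite mulN1r.
by apply: pf_mul => //; apply: pf_cst.
Qed.

Lemma pf_sum (I : Type) (r : seq I) (P : pred I) (F : I -> X -> k) :
  (forall i, P i -> polyfun G (F i)) -> polyfun G (fun x => \sum_(i <- r | P i) F i x).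
Proof.
move=> hF; elim: r => [|i r IH].
  by apply: (pf_ext _ (pf_cst G 0)) => x; rewrite big_nil.
case Pi: (P i); last by apply: pf_ext IH => x; rewrite big_cons Pi.
apply: (pf_ext _ (pf_add (hF _ Pi) IH)) => x; by rewrite big_cons Pi.
Qed.

Lemma pf_prod (I : Type) (r : seq I) (P : pred I) (F : I -> X -> k) :
  (forall i, P i -> polyfun G (F i)) -> polyfun G (fun x => \prod_(i <- r | P i) F i x).
Proof.
move=> hF; elim: r => [|i r IH].
  by apply: (pf_ext _ (pf_cst G 1)) => x; rewrite big_nil.
case Pi: (P i); last by apply: pf_ext IH => x; rewrite big_cons Pi.
apply: (pf_ext _ (pf_mul (hF _ Pi) IH)) => x; by rewrite big_cons Pi.
Qed.

Lemma pf_exp f n : polyfun G f -> polyfun G (fun x => f x ^+ n).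
Proof.
move=> hf; elim: n => [|n IH].
  by apply: (pf_ext _ (pf_cst G 1)) => x; rewrite expr0.
by apply: (pf_ext _ (pf_mul hf IH)) => x; rewrite exprS.
Qed.

Lemma pf_meval n (v : X -> 'I_n -> k) (F : {mpoly k[n]}) :
  (forall i, polyfun G (fun x => v x i)) -> polyfun G (fun x => F.@[v x]).
Proof.
move=> hv; apply: (@pf_ext _ _ _ (fun x => \sum_(m <- msupp F) F@_m * \prod_i v x i ^+ m i)).
  by move=> x; rewrite mevalE.
apply: pf_sum => m _; apply: pf_mul; first exact: pf_cst.
by apply: pf_prod => i _; apply: pf_exp.
Qed.

Lemma pm_cst m n (A : 'M[k]_(m, n)) : polymx G (fun=> A).
Proof. by move=> i j; apply: pf_cst. Qed.

Lemma pm_mul m n p (a : X -> 'M[k]_(m, n)) (b : X -> 'M[k]_(n, p)) :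
  polymx G a -> polymx G b -> polymx G (fun x => a x *m b x).
Proof.
move=> ha hb i j; apply: (@pf_ext _ _ _ (fun x => \sum_l a x i l * b x l j)).
  by move=> x; rewrite mxE.
by apply: pf_sum => l _; apply: pf_mul.
Qed.

Lemma pm_add m n (a b : X -> 'M[k]_(m, n)) :
  polymx G a -> polymx G b -> polymx G (fun x => a x + b x).
Proof.
move=> ha hb i j; apply: (pf_ext _ (pf_add (ha i j) (hb i j))) => x.
by rewrite mxE.
Qed.

Lemma pm_opp m n (a : X -> 'M[k]_(m, n)) :
  polymx G a -> polymx G (fun x => - a x).
Proof. by move=> ha i j; apply: (pf_ext _ (pf_opp (ha i j))) => x; rewrite mxE. Qed.

Lemma pm_scale m n (f : X -> k) (a : X -> 'M[k]_(m, n)) :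
  polyfun G f -> polymx G a -> polymx G (fun x => f x *: a x).
Proof. by move=> hf ha i j; apply: (pf_ext _ (pf_mul hf (ha i j))) => x; rewrite mxE. Qed.

Lemma pm_tr m n (a : X -> 'M[k]_(m, n)) : polymx G a -> polymx G (fun x => (a x)^T).
Proof. by move=> ha i j; apply: (pf_ext _ (ha j i)) => x; rewrite mxE. Qed.

Lemma pf_det n (a : X -> 'M[k]_n) : polymx G a -> polyfun G (fun x => \det (a x)).
Proof.
move=> ha; apply: pf_sum => s _; apply: pf_mul; first exact: pf_cst.
by apply: pf_prod.
Qed.

Lemma pm_adj n (a : X -> 'M[k]_n) : polymx G a -> polymx G (fun x => \adj (a x)).
Proof.
move=> ha i j; apply: (@pf_ext _ _ _ (fun x => cofactor (a x) j i)).
  by move=> x; rewrite mxE.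
apply: pf_mul; first exact: pf_cst.
apply: pf_det => u v; apply: (pf_ext _ (ha (lift j u) (lift i v))) => x.
by rewrite !mxE.
Qed.

(* With [R] a right inverse of [a x0] and [c = a R], the matrix
   [det c - R adj(c) a] is annihilated by [a] on the left everywhere, and is
   [1 - R a] at [x0]. *)
Lemma polymx_perp m n r (a : X -> 'M[k]_(m, n)) (x0 : X) (K0 : 'M[k]_(r, n)) :
  polymx G a -> row_free (a x0) -> K0 *m (a x0)^T = 0 ->
  exists K : X -> 'M[k]_(r, n),
    [/\ polymx G K, K x0 = K0 & forall x, K x *m (a x)^T = 0].
Proof.
move=> ha free0 K0a.
have [R aR] : exists R, a x0 *m R = 1%:M.
  by exists (pinvmx (a x0)); apply: mulmxVp.
pose c := fun x => a x *m R.
pose pr x := (\det (c x))%:M - R *m \adj (c x) *m a x.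
have hc : polymx G c by apply: pm_mul ha (pm_cst _).
exists (fun x => K0 *m (pr x)^T); split.
- apply: pm_mul; first exact: pm_cst.
  apply: pm_tr; apply: pm_add.
    move=> i j; apply: (@pf_ext _ _ _ (fun x => \det (c x) * (i == j)%:R)).
      by move=> x; rewrite mxE mulr_natr.
    by apply: pf_mul; [apply: pf_det | apply: pf_cst].
  by apply: pm_opp; apply: pm_mul ha; apply: pm_mul (pm_adj hc); apply: pm_cst.
- rewrite /pr /c aR det1 (_ : \adj _ = 1%:M); last first.
    by rewrite -[LHS]mul1mx mul_mx_adj det1.
  rewrite mulmx1 linearB /= tr_scalar_mx trmx_mul mulmxBr mulmx1.
  by rewrite mulmxA K0a mul0mx subr0.
- move=> x; rewrite -mulmxA -trmx_mul mulmxBr !mulmxA -[a x *m R]/(c x) mul_mx_adj.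
by rewrite scalar_mxC subrr trmx0 mulmx0.
Qed.

End PolyFun.

Lemma polyfun_comp (k : fieldType) (X Y : Type) (G : (X -> k) -> Prop)
    (G' : (Y -> k) -> Prop) (h : Y -> X) f :
  (forall g, G g -> polyfun G' (g \o h)) -> polyfun G f -> polyfun G' (f \o h).
Proof.
move=> hG; elim=> {f} [f /hG //|c|f g _ hf _ hg|f g _ hf _ hg|f g e _ hf].
- exact: (pf_cst G' c).
- exact: pf_add hf hg.
- exact: pf_mul hf hg.
- by apply: pf_ext hf => x /=; rewrite e.
Qed.

Definition line_gen (k : fieldType) (f : k -> k) := f = id.
Definition aff_gen (k : fieldType) N (f : 'rV[k]_N -> k) :=
  exists i, f = (fun x => x 0 i).
Definition pair_gen (k : fieldType) (f : 'M[k]_(3, nE) * 'M[k]_(8, nE) -> k) :=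
  exists i, f = (fun ab => coords ab.1 ab.2 i).

Lemma line_poly (k : fieldType) (f : k -> k) :
  polyfun (@line_gen k) f -> exists q : {poly k}, forall s, f s = q.[s].
Proof.
elim=> {f} [f ->|c|f g _ [q hq] _ [r hr]|f g _ [q hq] _ [r hr]|f g e _ [q hq]].
- by exists 'X => s; rewrite hornerX.
- by exists c%:P => s; rewrite hornerC.
- by exists (q + r) => s; rewrite hornerD hq hr.
- by exists (q * r) => s; rewrite hornerM hq hr.
- by exists q => s; rewrite -e.
Qed.

Lemma aff_mpoly (k : fieldType) N (f : 'rV[k]_N -> k) :
  polyfun (@aff_gen k N) f -> exists q : {mpoly k[N]}, forall x, f x = q.@[x 0].
Proof.
elim=> {f} [f [i ->]|c|f g _ [q hq] _ [r hr]|f g _ [q hq] _ [r hr]|f g e _ [q hq]].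
- by exists 'X_i => s; rewrite mevalXU.
- by exists c%:MP => s; rewrite mevalC.
- by exists (q + r) => s; rewrite mevalD hq hr.
- by exists (q * r) => s; rewrite mevalM hq hr.
- by exists q => s; rewrite -e.
Qed.

Lemma pair_mpoly (k : fieldType) f :
  polyfun (@pair_gen k) f ->
  exists q : {mpoly k[nvars]}, forall ab, f ab = q.@[coords ab.1 ab.2].
Proof.
elim=> {f} [f [i ->]|c|f g _ [q hq] _ [r hr]|f g _ [q hq] _ [r hr]|f g e _ [q hq]].
- by exists 'X_i => s; rewrite mevalXU.
- by exists c%:MP => s; rewrite mevalC.
- by exists (q + r) => s; rewrite mevalD hq hr.
- by exists (q * r) => s; rewrite mevalM hq hr.
- by exists q => s; rewrite -e.
Qed.

Lemma coords_l (k : fieldType) (A : 'M[k]_(3, nE)) (B : 'M[k]_(8, nE)) i j :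
  coords A B (lshift _ (mxvec_index i j)) = A i j.
Proof. by rewrite /coords row_mxEl mxvecE. Qed.

Lemma coords_r (k : fieldType) (A : 'M[k]_(3, nE)) (B : 'M[k]_(8, nE)) i j :
  coords A B (rshift _ (mxvec_index i j)) = B i j.
Proof. by rewrite /coords row_mxEr mxvecE. Qed.

Lemma coordsP (k : fieldType) (i : 'I_nvars) :
  (exists a b, forall (A : 'M[k]_(3, nE)) (B : 'M[k]_(8, nE)), coords A B i = A a b) \/
  (exists a b, forall (A : 'M[k]_(3, nE)) (B : 'M[k]_(8, nE)), coords A B i = B a b).
Proof.
rewrite -(splitK i); case: (split i) => j /=; [left | right];
  case/mxvec_indexP: j => a b; exists a, b => A B.
  by rewrite coords_l.
by rewrite coords_r.
Qed.

Lemma pf_coords (k : fieldType) X (G : (X -> k) -> Prop) a b :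
  polymx G a -> polymx G b -> forall i, polyfun G (fun x => coords (a x) (b x) i).
Proof.
move=> ha hb i; case: (coordsP k i) => -[u [v h]].
  by apply: (pf_ext _ (ha u v)) => x; rewrite h.
by apply: (pf_ext _ (hb u v)) => x; rewrite h.
Qed.

Lemma pm_pair_l (k : fieldType) : polymx (@pair_gen k) (fun ab => ab.1).
Proof.
move=> i j; set c := lshift (8 * nE) (mxvec_index i j).
apply: (@pf_ext _ _ _ (fun ab => coords ab.1 ab.2 c)) => [ab|]; first exact: coords_l.
by apply: pf_gen; exists c.
Qed.

Lemma pm_pair_r (k : fieldType) : polymx (@pair_gen k) (fun ab => ab.2).
Proof.
move=> i j; set c := rshift (3 * nE) (mxvec_index i j).
apply: (@pf_ext _ _ _ (fun ab => coords ab.1 ab.2 c)) => [ab|]; first exact: coords_r.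
by apply: pf_gen; exists c.
Qed.

(** * Closed subsets of H, curves and charts *)

(** A nonzero polynomial vanishing everywhere would be nonconstant, so q + 1 would have a root, yet
    its value there is 1. This stands in for the infinitude of k. *)
Lemma closed_field_nonroot (k : closedFieldType) (q : {poly k}) :
  q != 0 -> exists s, q.[s] != 0.
Proof.
move=> q0; apply: NNPP => hN.
have r s : root q s.
  by apply/rootP; apply: NNPP => /eqP hs; apply: hN; exists s.
have sq : (1 < size q)%N.
  by apply: (root_size_gt1 q0 (r 0)).
have : size (q + 1) != 1%N.
  by rewrite size_polyDl ?size_poly1 // neq_ltn sq orbT.
case/closed_rootP=> s /rootP; rewrite hornerD hornerC (rootP (r s)) add0r.
by move/eqP; rewrite oner_eq0.
Qed.

(** Irreducibility of the affine line. The irreducibility and limit arguments below restrict to a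
    line or a curve and end here. *)
Lemma line_mul_eq0 (k : closedFieldType) (f g : k -> k) :
  polyfun (@line_gen k) f -> polyfun (@line_gen k) g ->
  (forall s, f s * g s = 0) -> (forall s, f s = 0) \/ (forall s, g s = 0).
Proof.
move=> /line_poly [q hq] /line_poly [r hr] h.
have : q * r == 0.
  apply/negPn/negP => /closed_field_nonroot [s /eqP []].
  by rewrite hornerM -hq -hr h.
rewrite mulf_eq0 => /orP [] /eqP e; [left | right] => s.
  by rewrite hq e horner0.
by rewrite hr e horner0.
Qed.

Definition bases (k : fieldType) (p : Hpoint k)
  (A : 'M[k]_(3, nE)) (B : 'M[k]_(8, nE)) :=
  is_basis_of A (proj1_sig p :&: Edeg k 2)%MS /\
  is_basis_of B (proj1_sig p :&: Edeg k 3)%MS.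

Definition Hclosure (k : fieldType) (S : Hpoint k -> Prop) (p : Hpoint k) : Prop :=
  forall Z, Hclosed Z -> subs S Z -> Z p.

Lemma sub_Hclosure (k : fieldType) (S : Hpoint k -> Prop) : subs S (Hclosure S).
Proof. by move=> p Sp Z _; apply. Qed.

(** The union of the families defining all closed sets above S defines their intersection; a family
    may be infinite. *)
Lemma Hclosure_closed (k : fieldType) (S : Hpoint k -> Prop) : Hclosed (Hclosure S).
Proof.
pose dfn (Z : Hpoint k -> Prop) (F : {mpoly k[nvars]} -> Prop) :=
  forall (p : Hpoint k) A B, is_basis_of A (proj1_sig p :&: Edeg k 2)%MS ->
    is_basis_of B (proj1_sig p :&: Edeg k 3)%MS ->
    (Z p <-> forall f, F f -> f.@[coords A B] = 0).
exists (fun f => exists Z F, [/\ dfn Z F, subs S Z & F f]) => p A B bA bB; split.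
  move=> cp f [Z [F [dF SZ Ff]]]; have Zp : Z p by apply: cp => //; exists F.
  by have /(_ Zp) := proj1 (dF p A B bA bB); apply.
move=> h Z [F dF] SZ; apply/(dF p A B bA bB) => f Ff; apply: h.
by exists Z, F.
Qed.

Lemma row_free_sub_unit (k : fieldType) m n (A A' : 'M[k]_(m, n)) :
  row_free A -> (A <= A')%MS -> exists2 g, g \in unitmx & A = g *m A'.
Proof.
move=> fA /submxP [g e]; exists g => //.
rewrite -row_free_unit -kermx_eq0; apply/eqP/row_matrixP => i.
have := mulmx_ker g; move/(congr1 (row i)); rewrite row_mul row0 => e0.
have: row i (kermx g) *m A = 0 by rewrite e mulmxA e0 mul0mx.
by move/eqP; rewrite mulmx_free_eq0 // => /eqP ->; rewrite ?row0.
Qed.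

Lemma basis_change (k : fieldType) m (A A' : 'M[k]_(m, nE)) V :
  is_basis_of A V -> is_basis_of A' V -> exists2 g, g \in unitmx & A = g *m A'.
Proof.
by move=> [fA /eqmxP eA] [_ /eqmxP eA']; apply: row_free_sub_unit fA _; rewrite eA eA'.
Qed.

(** An equation of Z pulled back along the curve, times d, vanishes at every s; since d is not zero,
    the pullback is zero, in particular at s0. Where d vanishes, the two matrices need not be bases
    of anything. *)
Lemma curve_closed (k : closedFieldType) (Z : Hpoint k -> Prop)
    (a : k -> 'M[k]_(3, nE)) (b : k -> 'M[k]_(8, nE)) (d : k -> k) s0 s1 p0 :
  Hclosed Z -> polymx (@line_gen k) a -> polymx (@line_gen k) b ->
  polyfun (@line_gen k) d -> d s1 != 0 ->
  (forall s, d s != 0 -> exists p, Z p /\ bases p (a s) (b s)) ->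
  bases p0 (a s0) (b s0) -> Z p0.
Proof.
move=> [F dF] pa pb pd ds1 hs [ba bb].
apply/(dF _ _ _ ba bb) => f Ff.
have hf : polyfun (@line_gen k) (fun s => f.@[coords (a s) (b s)]).
  by apply: pf_meval; apply: pf_coords.
case: (line_mul_eq0 hf pd) => [s|//|/(_ s1) /eqP]; last by rewrite (negPf ds1).
have [-> | /hs [p [Zp [pa1 pb1]]]] := eqVneq (d s) 0; first by rewrite mulr0.
by rewrite (proj1 (dF p _ _ pa1 pb1)) ?mul0r.
Qed.

Definition image_of (k : fieldType) X (a : X -> 'M[k]_(3, nE))
  (b : X -> 'M[k]_(8, nE)) (p : Hpoint k) := exists x, bases p (a x) (b x).

Lemma pm_line (k : fieldType) N (x y : 'rV[k]_N) :
  polymx (@line_gen k) (fun s => x + s *: (y - x)).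
Proof.
apply: pm_add; first exact: pm_cst.
by apply: pm_scale; [apply: pf_gen | apply: pm_cst].
Qed.

Lemma polyfun_aff_line (k : fieldType) N (f : 'rV[k]_N -> k) (h : k -> 'rV[k]_N) :
  polymx (@line_gen k) h -> polyfun (@aff_gen k N) f ->
  polyfun (@line_gen k) (fun s => f (h s)).
Proof.
by move=> hh; apply: (polyfun_comp (h := h)) => g [i ->]; apply: hh.
Qed.

Section Image.
Variables (k : closedFieldType) (N : nat).
Variables (a : 'rV[k]_N -> 'M[k]_(3, nE)) (b : 'rV[k]_N -> 'M[k]_(8, nE)).
Hypothesis pa : polymx (@aff_gen k N) a.
Hypothesis pb : polymx (@aff_gen k N) b.
Hypothesis ab_pt : forall x, exists p, bases p (a x) (b x).

(** If neither closed set contains the image, each has an equation that is nonzero at some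
    parameter. On the line joining the two parameters the product of these equations vanishes
    identically, so one of them does. *)
Lemma image_irreducible : Hirreducible (Hclosure (image_of a b)).
Proof.
split; first exact: Hclosure_closed.
split.
  by have [p hp] := ab_pt 0; exists p; apply: sub_Hclosure; exists 0.
move=> Z1 Z2 c1 c2 h12; apply: NNPP => hN.
have key Z : Hclosed Z -> ~ subs (Hclosure (image_of a b)) Z ->
    exists F (f : {mpoly k[nvars]}) x, [/\ (forall p A B, bases p A B ->
      (Z p <-> forall f, F f -> f.@[coords A B] = 0)), F f & f.@[coords (a x) (b x)] != 0].
  move=> cZ; have [F dF] := cZ => nZ; apply: NNPP => hE; apply: nZ => p;
    apply=> // q [x [ba bb]].
  apply/(dF _ _ _ ba bb) => f Ff; apply: NNPP => fx; apply: hE.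
  exists F, f, x; split=> //; last exact/eqP.
  by move=> ? ? ? [? ?]; apply: dF.
have [|F1 [f1 [x1 [d1 Ff1 n1]]]] := key Z1 c1; first by move=> s1; apply: hN; left.
have [|F2 [f2 [x2 [d2 Ff2 n2]]]] := key Z2 c2; first by move=> s1; apply: hN; right.
pose h s := x1 + s *: (x2 - x1).
have pl f : polyfun (@line_gen k) (fun s => f.@[coords (a (h s)) (b (h s))]).
  apply: pf_meval; apply: pf_coords => i j.
    exact: (polyfun_aff_line (pm_line x1 x2) (pa i j)).
  exact: (polyfun_aff_line (pm_line x1 x2) (pb i j)).
case: (line_mul_eq0 (pl f1) (pl f2)) => [s|/(_ 0)|/(_ 1)].
- have [p hp] := ab_pt (h s).
  have /h12 [Zp|Zp] : Hclosure (image_of a b) p by apply: sub_Hclosure; exists (h s).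
    by rewrite (proj1 (d1 _ _ _ hp) Zp _ Ff1) mul0r.
  by rewrite (proj1 (d2 _ _ _ hp) Zp _ Ff2) mulr0.
- by rewrite /h scale0r addr0 => e; rewrite e eqxx in n1.
- by rewrite /h scale1r addrC subrK => e; rewrite e eqxx in n2.
Qed.

End Image.

(* The chart given by [S] and [T] consists of the points with [A *m S] and [B *m T]
   invertible; [nrm] picks the basis that [S] sends to the identity. *)
Definition nrm (k : fieldType) m (S : 'M[k]_(nE, m)) (A : 'M[k]_(m, nE)) :=
  invmx (A *m S) *m A.

Definition cden (k : fieldType) (S : 'M[k]_(nE, 3)) (T : 'M[k]_(nE, 8))
  (A : 'M[k]_(3, nE)) (B : 'M[k]_(8, nE)) :=
  \det (A *m S) * \det (B *m T).

Definition cval (k : fieldType) (S : 'M[k]_(nE, 3)) (T : 'M[k]_(nE, 8))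
  (G : {mpoly k[nvars]}) (A : 'M[k]_(3, nE)) (B : 'M[k]_(8,
    nE)) := G.@[coords (nrm S A) (nrm T B)].

(** Vacuous off the chart: this is the zero locus of a regular function on the chart together with
    the complement of the chart, which is what makes it closed in H. *)
Definition vanish (k : fieldType) (S : 'M[k]_(nE, 3)) (T : 'M[k]_(nE, 8))
  (G : {mpoly k[nvars]}) (p : Hpoint k) : Prop :=
  forall A B, bases p A B -> cden S T A B != 0 -> cval S T G A B = 0.

Lemma invmx_mul (k : fieldType) m (A B : 'M[k]_m) :
  A \in unitmx -> B \in unitmx -> invmx (A *m B) = invmx B *m invmx A.
Proof.
move=> uA uB; have uAB : A *m B \in unitmx by rewrite unitmx_mul uA.
apply: (can_inj (mulKmx uAB)); rewrite mulmxV // mulmxA -(mulmxA A) mulmxV //.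
by rewrite mulmx1 mulmxV.
Qed.

Lemma nrm_change (k : fieldType) m (S : 'M[k]_(nE, m)) A g :
  g \in unitmx -> A *m S \in unitmx -> nrm S (g *m A) = nrm S A.
Proof.
move=> ug uA; rewrite /nrm -mulmxA invmx_mul // -!mulmxA (mulmxA (invmx g)).
by rewrite mulVmx // mul1mx.
Qed.

Lemma nrm_basis (k : fieldType) m (S : 'M[k]_(nE, m)) A V :
  is_basis_of A V -> A *m S \in unitmx -> is_basis_of (nrm S A) V.
Proof.
move=> [fA eA] uA; split.
  by rewrite /row_free eqmxMfull ?row_full_unit ?unitmx_inv.
by apply/eqmxP; apply: eqmx_trans (eqmxP eA); apply: eqmxMfull;
  rewrite row_full_unit unitmx_inv.
Qed.

Section Chart.
Variables (k : fieldType) (S : 'M[k]_(nE, 3)) (T : 'M[k]_(nE, 8)).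

Lemma cden_unit A B : cden S T A B != 0 -> (A *m S \in unitmx) /\ (B *m T \in unitmx).
Proof. by rewrite /cden mulf_eq0 negb_or !unitmxE !unitfE => /andP. Qed.

Lemma cden_change p A B A' B' : bases p A B -> bases p A' B' ->
  cden S T A B != 0 -> cden S T A' B' != 0.
Proof.
move=> [bA bB] [bA' bB'].
have [g _ ->] := basis_change bA bA'; have [h _ ->] := basis_change bB bB'.
by rewrite /cden -!mulmxA !det_mulmx !mulf_eq0 !negb_or => /andP [/andP [_ ->] /andP [_ ->]].
Qed.

Lemma cval_change p A B A' B' G : bases p A B -> bases p A' B' ->
  cden S T A B != 0 -> cval S T G A B = cval S T G A' B'.
Proof.
move=> hb hb' d; have d' := cden_change hb hb' d.
have [u v] := cden_unit d'.
move: hb hb' => [bA bB] [bA' bB'].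
have [g ug ->] := basis_change bA bA'; have [h uh ->] := basis_change bB bB'.
by rewrite /cval !nrm_change.
Qed.

Lemma vanish1 p G A B : bases p A B -> cval S T G A B = 0 -> vanish S T G p.
Proof. by move=> hb e A' B' hb' d; rewrite -e; exact: (cval_change G hb' hb d). Qed.

(** Cramer's rule: a normalised coordinate becomes polynomial in the bases after multiplication by
    [cden], and sums and products only raise the power required. *)
Lemma cval_regular G : exists F r, forall A B, cden S T A B != 0 ->
  F.@[coords A B] = cden S T A B ^+ r * cval S T G A B.
Proof.
pose D (ab : 'M[k]_(3, nE) * 'M[k]_(8, nE)) := cden S T ab.1 ab.2.
pose ngen (f : 'M[k]_(3, nE) * 'M[k]_(8, nE) -> k) :=
  exists i, f = fun ab => coords (nrm S ab.1) (nrm T ab.2) i.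
have pA := pm_mul (@pm_pair_l k) (pm_cst _ S).
have pB := pm_mul (@pm_pair_r k) (pm_cst _ T).
have pD : polyfun (@pair_gen k) D by apply: pf_mul; apply: pf_det.
suff main u : polyfun ngen u -> exists F r, polyfun (@pair_gen k) F /\
    forall ab, D ab != 0 -> F ab = D ab ^+ r * u ab.
  have [|F [r [/pair_mpoly [f hf] hF]]] := main (fun ab => cval S T G ab.1 ab.2).
    by apply: pf_meval => i; apply: pf_gen; exists i.
  by exists f, r => A B d; have := hF (A, B) d; rewrite hf.
elim=> {u} [u [i ->]|c|u v _ [F [r [pF hF]]] _ [F' [r' [pF' hF']]]
  |u v _ [F [r [pF hF]]] _ [F' [r' [pF' hF']]]|u v e _ [F [r [pF hF]]]].
- have nE1 m (U : 'M[k]_(nE, m)) (A : 'M[k]_(m, nE)) : A *m U \in unitmx ->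
      forall x y, \det (A *m U) * nrm U A x y = (\adj (A *m U) *m A) x y.
    move=> uA x y; rewrite /nrm /invmx uA -scalemxAl !mxE mulrA divff ?mul1r //.
    by move: uA; rewrite unitmxE unitfE.
  case: (coordsP k i) => -[x [y h]].
    exists (fun ab => \det (ab.2 *m T) * (\adj (ab.1 *m S) *m ab.1) x y), 1%N; split.
      apply: pf_mul; first exact: pf_det.
      by apply: pm_mul; [apply: pm_adj | apply: pm_pair_l].
    move=> [A B] /= d; have [uA uB] := cden_unit d.
    by rewrite h expr1 /D /cden /= -nE1 // mulrA; congr (_ * _); rewrite mulrC.
  exists (fun ab => \det (ab.1 *m S) * (\adj (ab.2 *m T) *m ab.2) x y), 1%N; split.
    apply: pf_mul; first exact: pf_det.
    by apply: pm_mul; [apply: pm_adj | apply: pm_pair_r].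
  move=> [A B] /= d; have [uA uB] := cden_unit d.
  by rewrite h expr1 /D /cden /= -nE1 // mulrA.
- exists (fun=> c), 0%N; split; first exact: pf_cst.
  by move=> ab _; rewrite expr0 mul1r.
- exists (fun ab => D ab ^+ r' * F ab + D ab ^+ r * F' ab), (r + r')%N; split.
    by apply: pf_add; apply: pf_mul => //; apply: pf_exp.
  by move=> ab d; rewrite hF // hF' // exprD mulrDr; ring.
- exists (fun ab => F ab * F' ab), (r + r')%N; split; first exact: pf_mul.
  by move=> ab d; rewrite hF // hF' // exprD; ring.
- by exists F, r; split=> // ab d; rewrite -e hF.
Qed.

Lemma vanish_closed G : Hclosed (vanish S T G).
Proof.
have [F [r hF]] := cval_regular G.
have [D hD] : exists D : {mpoly k[nvars]}, forall A B, D.@[coords A B] = cden S T A B.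
  have pA := pm_mul (@pm_pair_l k) (pm_cst _ S).
  have pB := pm_mul (@pm_pair_r k) (pm_cst _ T).
  have /pair_mpoly [D hD] := pf_mul (pf_det pA) (pf_det pB).
  by exists D => A B; have := hD (A, B).
(* The factor D makes the equation hold off the chart, where nothing is known about F. *)
exists (eq (D * F)) => p A B bA bB.
have hb : bases p A B by [].
split=> [v f <-|/(_ _ erefl) e A' B' hb' d'].
  rewrite mevalM hD; have [-> | d] := eqVneq (cden S T A B) 0; first by rewrite mul0r.
  by rewrite hF // (v A B hb d) !mulr0.
have d := cden_change hb' hb d'.
rewrite (cval_change _ hb' hb d'); move: e => /eqP.
by rewrite mevalM hD hF // mulf_eq0 (negPf d) mulf_eq0 expf_eq0 (negPf d) andbF /= => /eqP.
Qed.

End Chart.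

(** * Dimension *)

(* A relation between monomials in the [f i], ordered by powers of [f n], starts
   with some [f n ^ s]; primality of [Q n.+1] cancels it, and modulo [Q n] only the
   lowest term is left. *)
Lemma chain_indep (k : fieldType) M (Q : nat -> {mpoly k[M]} -> Prop)
    (f : nat -> {mpoly k[M]}) n m :
  (forall i u v, Q i u -> Q i v -> Q i (u + v)) ->
  (forall i u v, Q i u -> Q i (u * v)) ->
  ~ Q 0%N 1 ->
  (forall i u v, (i <= n)%N -> Q i (u * v) -> Q i u \/ Q i v) ->
  (forall i, (i < n)%N -> [/\ Q i (f i), ~ Q i.+1 (f i) & forall u, Q i.+1 u -> Q i u]) ->
  exists (T : finType) (e : T -> nat -> nat), [/\ #|T| = (m ^ n)%N,
    forall t i, (i < n)%N -> (e t i < m)%N &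
    forall c : T -> k, Q n (\sum_t c t *: \prod_(i < n) f i ^+ e t i) -> forall t, c t = 0].
Proof.
move=> QD QM Q01 Qp Qf; elim: n Qp Qf => [|n IH] Qp Qf.
  exists unit, (fun _ _ => 0%N); split=> [|//|c]; first by rewrite card_unit.
  rewrite (bigD1 tt) //= [X in _ + X]big1 => [|[] //].
  rewrite big_ord0 addr0 => Qc [].
  apply: NNPP => /eqP ct; apply: Q01.
  have -> : 1 = (c tt *: 1) * ((c tt)^-1 *: 1) :> {mpoly k[M]}.
    by rewrite -scalerAl mul1r scalerA divff // scale1r.
  exact: QM.
have [||T [e [cT eT indT]]] := IH.
- by move=> i u v hi; apply: Qp; apply: leqW.
- by move=> i hi; apply: Qf; apply: leqW.
pose e' (tj : T * 'I_m) i := if i == n then val tj.2 else e tj.1 i.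
have prE (tj : T * 'I_m) : \prod_(i < n.+1) f i ^+ e' tj i =
    (\prod_(i < n) f i ^+ e tj.1 i) * f n ^+ tj.2.
  rewrite big_ord_recr /= {2}/e' eqxx; congr (_ * _); apply: eq_bigr => i _.
  by rewrite /e' ltn_eqF.
exists (T * 'I_m)%type, e'; split.
- by rewrite card_prod cT card_ord -expnSr.
- move=> [t j] i; rewrite ltnS leq_eqVlt /e' /=; case: eqVneq => [_ _|_ /= hi].
    exact: ltn_ord.
  exact: eT.
move=> c Qc; have [Qfn nQfn sub] := Qf n (leqnn _).
suff main s : forall t (j : 'I_m), (j < s)%N -> c (t, j) = 0.
  by move=> [t j]; apply: (main m).
elim: s => [//|s IHs] t j; rewrite ltnS leq_eqVlt => /orP [/eqP js|]; last exact: IHs.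
pose B t := \prod_(i < n) f i ^+ e t i.
pose X := \sum_(j' < m | (s < j')%N) \sum_t' c (t', j') *: B t' * f n ^+ (j' - s.+1).
have E : \sum_t c t *: \prod_(i < n.+1) f i ^+ e' t i =
    f n ^+ s * (\sum_t' c (t', j) *: B t' + f n * X).
  transitivity (\sum_(j' < m) \sum_t' c (t', j') *: B t' * f n ^+ j').
    rewrite exchange_big /= pair_big /=; apply: eq_bigr => -[t' j'] _.
    by rewrite prE /= -scalerAl.
  rewrite (bigID (fun j' : 'I_m => (j' <= s)%N)) /= mulrDr; congr (_ + _).
    rewrite (bigD1 j) /= ?js // [X in _ + X]big1 ?addr0 => [|j' /andP [j's j'j]].
      rewrite mulr_sumr; apply: eq_bigr => t' _; by rewrite mulrC.
    rewrite big1 // => t' _; rewrite IHs ?scale0r ?mul0r //.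
    by rewrite ltn_neqAle j's andbT -js; apply: contraNneq j'j => /val_inj ->.
  rewrite /X !mulr_sumr; apply: eq_big => j'; first by rewrite -ltnNge.
  rewrite -ltnNge => sj'; rewrite !mulr_sumr; apply: eq_bigr => t' _.
  rewrite -{1}(subnKC sj') exprD exprS; ring.
have nfs r : ~ Q n.+1 (f n ^+ r).
  elim: r => [|r IHr].
    move=> h1; apply: nQfn; rewrite -[f n]mul1r; exact: QM.
  by rewrite exprS => /(Qp _ _ _ (leqnn _)) [].
move: Qc; rewrite E => /(Qp _ _ _ (leqnn _)) [/nfs //|/sub Qs].
apply: (indT (fun t' => c (t', j))).
rewrite (_ : \sum_t _ = (\sum_t' c (t', j) *: B t' + f n * X) + f n * X * -1).
  by apply: QD => //; apply: (QM); apply: QM.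
by rewrite mulrN1 addrK.
Qed.

Lemma card_bmnm N D : (#|{: 'X_{1..N < D.+1}}| <= D.+1 ^ N)%N.
Proof.
pose h (m : 'X_{1..N < D.+1}) : {ffun 'I_N -> 'I_D.+1} := [ffun i => inord (m i)].
have hK m i : h m i = m i :> nat.
  rewrite ffunE inordK //; apply: leq_ltn_trans (bmdeg m).
  by rewrite mdegE (bigD1 i) //= leq_addr.
have /leq_card : injective h.
  by move=> m m' e; apply/val_inj/mnmP => i /=; rewrite -!hK e.
by rewrite card_ffun !card_ord.
Qed.

(** There are at most (D + 1)^N monomials of degree at most D, so the coefficient vectors are
    dependent; [msize] is the degree plus one. *)
Lemma mpoly_dependent (k : fieldType) N D (T : finType) (g : T -> {mpoly k[N]}) :
  (forall t, msize (g t) <= D.+1)%N -> (D.+1 ^ N < #|T|)%N ->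
  exists2 c : T -> k, exists t, c t != 0 & \sum_t c t *: g t = 0.
Proof.
move=> hg hT.
pose bm := 'X_{1..N < D.+1}.
pose W : 'M[k]_(#|T|, #|{: bm}|) :=
  \matrix_(i, j) (g (enum_val i))@_(val (enum_val j : bm)).
have : kermx W != 0.
  rewrite kermx_eq0 /row_free neq_ltn; apply/orP; left.
  exact: leq_ltn_trans (leq_trans (rank_leq_col _) (card_bmnm N D)) hT.
case/rowV0Pn => v /sub_kermxP vW v0.
exists (fun t => v 0 (enum_rank t)).
  have [i vi] : exists i, v 0 i != 0.
    apply/existsP; apply: contraNT v0; rewrite negb_exists => /forallP h.
    by apply/eqP/rowP => i; rewrite mxE; apply/eqP; rewrite -[_ == _]negbK; exact: h.
  by exists (enum_val i); rewrite enum_valK.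
apply/mpolyP => m; rewrite mcoeff0 raddf_sum /=.
have [hm|hm] := ltnP (mdeg m) D.+1; last first.
  apply: big1 => t _; rewrite mcoeffZ memN_msupp_eq0 ?mulr0 //.
  by apply: msize_mdeg_ge; apply: leq_trans hm.
have := congr1 (fun M : 'rV_ _ => M 0 (enum_rank (BMultinom hm))) vW.
rewrite !mxE => e; rewrite -[RHS]e (reindex (@enum_val T xpredT)) /=; last first.
  by exists enum_rank => i _; [apply: enum_valK | apply: enum_rankK].
apply: eq_bigr => i _; rewrite mcoeffZ enum_valK !mxE enum_rankK //.
Qed.

Lemma msizeX_le (k : fieldType) N (p : {mpoly k[N]}) K e :
  (msize p <= K)%N -> (msize (p ^+ e) <= e * K + 1)%N.
Proof.
move=> hp; elim: e => [|e IH]; first by rewrite expr0 msize1.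
rewrite exprS; have [-> | p0] := eqVneq p 0; first by rewrite mul0r msize0.
have [-> | q0] := eqVneq (p ^+ e) 0; first by rewrite mulr0 msize0.
rewrite msizeM // mulSn -addnA; apply: leq_trans (leq_pred _) _; exact: leq_add.
Qed.

Lemma msizeM_leD (k : fieldType) N (p q : {mpoly k[N]}) :
  (msize (p * q) <= msize p + msize q)%N.
Proof.
have [-> | p0] := eqVneq p 0; first by rewrite mul0r msize0.
have [-> | q0] := eqVneq q 0; first by rewrite mulr0 msize0.
rewrite msizeM //; exact: leq_pred.
Qed.

Lemma msize_prod_le (k : fieldType) N n K (F : 'I_n -> {mpoly k[N]}) :
  (forall i, msize (F i) <= K)%N -> (msize (\prod_i F i) <= n * K + 1)%N.
Proof.
elim: n F => [|n IH] F hF; first by rewrite big_ord0 msize1.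
rewrite big_ord_recl; apply: leq_trans (msizeM_leD _ _) _.
rewrite mulSn -addnA; apply: leq_add; [exact: hF | exact: (IH (fun i => F (lift ord0 i)))].
Qed.

(** The constant 1 vanishes only vacuously, so these are the points outside the chart. *)
Definition avoids (k : fieldType) (S : 'M[k]_(nE, 3)) (T : 'M[k]_(nE, 8)) :=
  vanish S T 1.

Section VanishIdeal.
Variables (k : fieldType) (S : 'M[k]_(nE, 3)) (T : 'M[k]_(nE, 8)).

Lemma vanishD G1 G2 p : vanish S T G1 p -> vanish S T G2 p -> vanish S T (G1 + G2) p.
Proof. by move=> h1 h2 A B hb d; rewrite /cval mevalD [_.@[_]]h1 // [_.@[_]]h2 // addr0. Qed.

Lemma vanishM G1 G2 p : vanish S T G1 p -> vanish S T (G1 * G2) p.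
Proof. by move=> h1 A B hb d; rewrite /cval mevalM [_.@[_] in X in X * _]h1 // mul0r. Qed.

(** By [cval_change] a function has one value at p whatever the bases, so the ideal of a point is
    prime. Together with irreducibility this gives the primality that [chain_indep] asks for. *)
Lemma vanish_prime G1 G2 p :
  vanish S T (G1 * G2) p -> vanish S T G1 p \/ vanish S T G2 p.
Proof.
move=> h; have [|n1] := classic (vanish S T G1 p); [by left | right => A B hb d].
apply: NNPP => /eqP n2; apply: n1 => A' B' hb' d'.
rewrite -(cval_change G1 hb hb' d); have := h A B hb d.
by rewrite /cval mevalM => /eqP; rewrite mulf_eq0 (negPf n2) orbF => /eqP.
Qed.

End VanishIdeal.

Section DimBound.
Variables (k : closedFieldType) (N : nat).
Variables (a : 'rV[k]_N -> 'M[k]_(3, nE)) (b : 'rV[k]_N -> 'M[k]_(8, nE)).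
Hypothesis pa : polymx (@aff_gen k N) a.
Hypothesis pb : polymx (@aff_gen k N) b.
Hypothesis has_bases : forall p : Hpoint k, exists A B, bases p A B.

(** Counting: m^(N+1) monomials with exponents below m against a space of polynomials of dimension
    O(m^N). The bound m depends on the functions only, not on how the exponents are indexed. *)
Lemma chart_dependent S T (f : nat -> {mpoly k[nvars]}) :
  exists m, forall (F : finType) (e : F -> nat -> nat), #|F| = (m ^ N.+1)%N ->
    (forall t i, (i < N.+1)%N -> (e t i < m)%N) ->
    exists2 c : F -> k, exists t, c t != 0 &
      subs (image_of a b) (vanish S T (\sum_t c t *: \prod_(i < N.+1) f i ^+ e t i)).
Proof.
set n := N.+1.
have pull (G : {mpoly k[nvars]}) : exists g : {mpoly k[N]}, forall x : 'rV[k]_N,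
    g.@[x 0] = G.@[coords (a x) (b x)].
  have /aff_mpoly [g hg] : polyfun (@aff_gen k N) (fun x => G.@[coords (a x) (b x)]).
    by apply: pf_meval; apply: pf_coords.
  by exists g => x; rewrite hg.
have [d hd] : exists d : {mpoly k[N]}, forall x : 'rV[k]_N, d.@[x 0] = cden S T (a x) (b x).
  have pA := pm_mul pa (pm_cst _ S); have pB := pm_mul pb (pm_cst _ T).
  have /aff_mpoly [d hd] := pf_mul (pf_det pA) (pf_det pB).
  by exists d => x; rewrite -hd.
(* One exponent r clears the denominators of all the functions at once. *)
have [r [g hg]] : exists r (g : nat -> {mpoly k[N]}), forall i (x : 'rV[k]_N),
  (i < n)%N -> d.@[x 0] != 0 ->
    (g i).@[x 0] = d.@[x 0] ^+ r * cval S T (f i) (a x) (b x).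
  elim: n => [|n [r [g hg]]]; first by exists 0%N, (fun=> 0).
  have [F [r' hF]] := cval_regular S T (f n); have [g' hg'] := pull F.
  exists (r + r')%N, (fun i => if i == n then d ^+ r * g' else d ^+ r' * g i) => i x.
  rewrite ltnS leq_eqVlt => hi dx; case: eqVneq hi => [-> _|_ /= hi].
    by rewrite mevalM rmorphXn /= hg' hF -?hd // exprD mulrA.
  by rewrite mevalM rmorphXn /= hg // exprD; ring.
have [K hK] : exists K, forall i, (i < n)%N -> (msize (g i) <= K /\ msize (d ^+ r) <= K)%N.
  exists (\max_(i < n) msize (g i) + msize (d ^+ r))%N => i hi; split; last exact: leq_addl.
  by apply: leq_trans (leq_addr _ _); apply: (leq_bigmax (Ordinal hi)).
(* C m bounds the size of every product h t below; taking m > C^N then gives m^(N+1) > (C m)^N. *)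
pose C := (n * (K + K + 2) + 1)%N.
exists (C ^ N).+1 => F e cF eF; set m := (C ^ N).+1 in cF eF *.
(* The second factor homogenises: all h t carry the same power of d, so a relation between them is a
   relation between the functions wherever d is nonzero. *)
pose h t := \prod_(i < n) (g i ^+ e t i * (d ^+ r) ^+ (m - e t i)).
have hh t (x : 'rV[k]_N) : d.@[x 0] != 0 -> (h t).@[x 0] =
    d.@[x 0] ^+ (r * m * n) * cval S T (\prod_(i < n) f i ^+ e t i) (a x) (b x).
  move=> dx; rewrite /h /cval !rmorph_prod /= exprM.
  have -> : (d.@[x 0] ^+ (r * m)) ^+ n = \prod_(i < n) d.@[x 0] ^+ (r * m).
    by rewrite prodr_const card_ord.
  rewrite -big_split /=; apply: eq_bigr => i _.
  rewrite !rmorphM !rmorphXn /= hg // exprMn -!exprM [RHS]mulrC mulrAC.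
  rewrite -exprD -mulnDr subnKC; last exact: ltnW (eF _ _ _).
  by rewrite mulrC.
have [||c c0 Ec] := @mpoly_dependent k N (C * m).-1 F h.
- move=> t; rewrite prednK; last by rewrite muln_gt0 /C addn1.
  apply: leq_trans (@msize_prod_le _ _ _ (m * (K + K + 2)) _ _) _.
    move=> i; apply: leq_trans (msizeM_leD _ _) _.
    have [K1 K2] := hK _ (ltn_ord i).
    apply: leq_trans (leq_add (msizeX_le (e t i) K1) (msizeX_le (m - e t i) K2)) _.
    have em := ltnW (eF t i (ltn_ord i)).
    have h1 : (e t i * K <= m * K)%N by rewrite leq_mul2r em orbT.
    have h2 : ((m - e t i) * K <= m * K)%N by rewrite leq_mul2r leq_subr orbT.
    have h3 : (0 < m)%N by [].
    rewrite addnACA !mulnDr; apply: leq_add; first exact: leq_add.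
    by rewrite leq_pmull.
  rewrite /C; nia.
- rewrite prednK; last by rewrite muln_gt0 /C addn1.
  by rewrite cF expnS expnMn ltn_mul2r expn_gt0 /= /m ltnSn.
exists c => // p [x hb] A B hb' d0; have dx := cden_change hb' hb d0.
rewrite (cval_change _ hb' hb d0).
have := congr1 (meval (x 0)) Ec; rewrite meval0 raddf_sum /=.
under eq_bigr => t _ do rewrite mevalZ hh ?hd // mulrCA.
rewrite -mulr_sumr => /eqP; rewrite mulf_eq0 expf_eq0 (negPf dx) andbF /= => /eqP <-.
rewrite /cval raddf_sum /=; apply: eq_bigr => t _; by rewrite mevalZ.
Qed.

Lemma no_long_chain (Z : Hpoint k -> Prop) :
  subs Z (Hclosure (image_of a b)) -> ~ chain_in Z N.+1.
Proof.
move=> ZI [c [irr [step top]]]; set n := N.+1 in irr step top.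
have [cl0 [[p0 cp0] _]] := irr 0%N isT.
have [A0 [B0 hb0]] := has_bases p0.
(* A chart containing a point of the smallest member, so that every member of the chain meets it. *)
pose S := pinvmx A0; pose T := pinvmx B0.
have d0 : cden S T A0 B0 != 0.
  by case: (hb0) => [[fA _] [fB _]]; rewrite /cden /S /T !mulmxVp // !det1 mulr1 oner_eq0.
pose Q i G := subs (c i) (vanish S T G).
have mono i p : (i <= n)%N -> c 0%N p -> c i p.
  elim: i => [//|i IH] hi cp; apply: (proj1 (step i hi)); apply: IH => //; exact: ltnW.
have exf i : (i < n)%N -> exists f, Q i f /\ ~ Q i.+1 f.
  move=> hi; have [F dF] := proj1 (irr i (ltnW hi)).
  have [ss ns] := step i hi.
  (* The irreducible set [c i.+1] lies neither in [c i] nor in the complement of the chart, hence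
     not in their union. *)
  have [p [cp ncp nav]] : exists p, [/\ c i.+1 p, ~ c i p & ~ avoids S T p].
    apply: NNPP => hN.
    have [|||//|sa] := (proj2 (proj2 (irr i.+1 hi))) (c i) (avoids S T).
    - exact: (proj1 (irr i (ltnW hi))).
    - exact: vanish_closed.
    - move=> p cp; apply: NNPP => h2; apply: hN; exists p; split=> // hp; apply: h2;
      by [left | right].
    have := sa p0 (mono _ _ hi cp0) A0 B0 hb0 d0; rewrite /cval meval1 => /eqP.
    by rewrite oner_eq0.
  have [A [B [hb d _]]] : exists A B, [/\ bases p A B, cden S T A B != 0 & True].
    apply: NNPP => hN; apply: nav => A B hb d; case: hN; by exists A, B.
  have nb q A' B' : bases q A' B' -> cden S T A' B' != 0 -> bases q (nrm S A') (nrm T B').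
    by move=> [u v] /cden_unit [u' v']; split; apply: nrm_basis.
  have [f Ff fx] : exists2 f, F f & cval S T f A B != 0.
    apply: NNPP => hN; apply: ncp; have [u v] := nb _ _ _ hb d.
    apply/(dF _ _ _ u v) => f Ff; apply: NNPP => /eqP h; apply: hN; by exists f.
  exists f; split.
    move=> q cq A' B' hb' d'; have [u v] := nb _ _ _ hb' d'.
    exact: (proj1 (dF _ _ _ u v) cq).
  by move=> /(_ p cp A B hb d) e; rewrite e eqxx in fx.
have [f hf] : exists f, forall i, (i < n)%N -> Q i (f i) /\ ~ Q i.+1 (f i).
  clear -exf; elim: n exf => [|n IH] exf; first by exists (fun=> 0).
  have [i hi|f hf] := IH; first by apply: exf; apply: leqW.
  have [g hg] := exf n (leqnn _).
  exists (fun i => if i == n then g else f i) => i; rewrite ltnS leq_eqVlt.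
  by case: eqVneq => [-> //|_ /= /hf].
have [m hm] := chart_dependent S T f.
have [||||| F [e [cF eF indF]]] := @chain_indep k nvars Q f n m.
- by move=> i u v hu hv p cp; apply: vanishD; [apply: hu | apply: hv].
- by move=> i u v hu p cp; apply: vanishM; apply: hu.
- move=> h1; have := h1 p0 cp0 A0 B0 hb0 d0; rewrite /cval meval1 => /eqP.
  by rewrite oner_eq0.
- move=> i u v hi huv; apply: (proj2 (proj2 (irr i hi))); try exact: vanish_closed.
  by move=> p /huv; apply: vanish_prime.
- move=> i hi; have [h1 h2] := hf i hi; split=> // u hu p cp; apply: hu.
  exact: (proj1 (step i hi)).
have [u [t ct] hc] := hm F e cF eF.
move: ct; rewrite (indF u) ?eqxx // => p cp.
have /ZI := top p cp; apply=> //; exact: vanish_closed.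
Qed.

End DimBound.

(** * Coordinates on the exterior algebra *)

(* Subsets of ['I_5] are encoded by bit lists, so that signs and unions of basis
   monomials can be computed. *)
Definition bs (b : seq bool) : {set 'I_5} := [set i : 'I_5 | nth false b i].
Definition bits (S : {set 'I_5}) : seq bool := [seq (i \in S) | i <- enum 'I_5].
Definition bor (b c : seq bool) := [seq (nth false b i || nth false c i) | i <- iota 0 5].
Definition bdisj (b c : seq bool) := all (fun i => ~~ (nth false b i && nth false c i)) (iota
  0 5).
Definition binv (b c : seq bool) : nat :=
  sumn [seq sumn [seq nat_of_bool [&& nth false b i, nth false c j & (j < i)%N] | j <- iota 0 5]
    | i <- iota 0 5].

Lemma bsK S : bs (bits S) = S.
Proof.
apply/setP => i; rewrite inE (nth_map ord0) ?size_enum_ord //.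
by rewrite nth_ord_enum.
Qed.

Lemma bsU b c : bs b :|: bs c = bs (bor b c).
Proof.
by apply/setP => i; rewrite !inE (nth_map 0%N) ?size_iota // nth_iota.
Qed.

Lemma bs_disj b c : [disjoint bs b & bs c] = bdisj b c.
Proof.
apply/pred0P/allP => h i.
  rewrite mem_iota => hi; have := h (Ordinal (hi : (i < 5)%N)).
  by rewrite /= !inE /= => ->.
by rewrite /= !inE; apply/negbTE/h; rewrite mem_iota /=.
Qed.

Lemma card_bs b : #|bs b| = sumn [seq nat_of_bool (nth false b i) | i <- iota 0 5].
Proof.
rewrite -sum1_card big_mkcond sumnE big_map -[iota 0 5]/(index_iota 0 5) big_mkord.
by apply: eq_bigr => i _; rewrite inE; case: (nth _ _ _).
Qed.

Lemma wsign_bs (k : fieldType) b c :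
  wsign k (bs b) (bs c) = if bdisj b c then (-1) ^+ binv b c else 0.
Proof.
rewrite /wsign bs_disj; case: (bdisj b c) => //; congr (_ ^+ _).
pose F (i j : 'I_5) : nat := [&& nth false b i, nth false c j & (j < i)%N].
transitivity (\sum_(p : 'I_5 * 'I_5) F p.1 p.2)%N.
  rewrite -sum1_card big_mkcond; apply: eq_bigr => -[i j] _ /=.
  by rewrite !inE /= -andbA /F; case: ifP.
rewrite -(pair_bigA _ F) /binv sumnE big_map -[iota 0 5]/(index_iota 0 5) big_mkord.
apply: eq_bigr => i _.
by rewrite sumnE big_map big_mkord.
Qed.

Section Wedge.
Variable k : fieldType.
Implicit Types (x y : Evec k) (S U : {set 'I_5}).

Lemma ecoef_emon S U : ecoef (emon k S) U = (S == U)%:R.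
Proof. by rewrite /ecoef /emon mxE eqxx /= eq_sym (inj_eq enum_rank_inj). Qed.

Lemma evec_sum x : x = \sum_S ecoef x S *: emon k S.
Proof.
apply/rowP => i; rewrite summxE (bigD1 (enum_val i)) //= big1 => [|S Si].
  by rewrite addr0 /ecoef /emon !mxE enum_valK eqxx eqxx mulr1.
rewrite /emon !mxE eqxx /= -(inj_eq enum_val_inj) enum_rankK eq_sym (negPf Si).
by rewrite mulr0.
Qed.

Definition rwedge U : 'M[k]_nE :=
  \matrix_(i, j) (wsign k (enum_val (i : 'I_#|{set 'I_5}|)) U *:
     emon k (enum_val (i : 'I_#|{set 'I_5}|) :|: U)) 0 j.
Definition lwedge U : 'M[k]_nE :=
  \matrix_(i, j) (wsign k U (enum_val (i : 'I_#|{set 'I_5}|)) *: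
     emon k (U :|: enum_val (i : 'I_#|{set 'I_5}|))) 0 j.

Lemma emon_row_mul n S (M : 'M[k]_(nE, n)) : emon k S *m M = row (enum_rank S) M.
Proof. by rewrite /emon -rowE. Qed.

Lemma emon_rwedge S U : emon k S *m rwedge U = wsign k S U *: emon k (S :|: U).
Proof. by rewrite emon_row_mul; apply/rowP => j; rewrite !mxE enum_rankK. Qed.

Lemma emon_lwedge S U : emon k S *m lwedge U = wsign k U S *: emon k (U :|: S).
Proof. by rewrite emon_row_mul; apply/rowP => j; rewrite !mxE enum_rankK. Qed.

Lemma wedge_r x y : wedge x y = \sum_U ecoef y U *: (x *m rwedge U).
Proof.
rewrite /wedge exchange_big /=; apply: eq_bigr => U _.
rewrite {2}(evec_sum x) mulmx_suml scaler_sumr; apply: eq_bigr => S _.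
by rewrite -scalemxAl emon_rwedge !scalerA; congr (_ *: _); ring.
Qed.

Lemma wedge_l x y : wedge y x = \sum_U ecoef y U *: (x *m lwedge U).
Proof.
rewrite /wedge; apply: eq_bigr => U _.
rewrite {2}(evec_sum x) mulmx_suml scaler_sumr; apply: eq_bigr => S _.
by rewrite -scalemxAl emon_lwedge !scalerA; congr (_ *: _); ring.
Qed.

Lemma wedge_emon x U : wedge x (emon k U) = x *m rwedge U.
Proof.
rewrite wedge_r (bigD1 U) //= big1 => [|W WU].
  by rewrite ecoef_emon eqxx scale1r addr0.
by rewrite ecoef_emon eq_sym (negPf WU) scale0r.
Qed.

Lemma wedge_emons S U : wedge (emon k S) (emon k U) = wsign k S U *: emon k (S :|: U).
Proof. by rewrite wedge_emon emon_rwedge. Qed.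

Lemma emon_Edeg S d : emon k S *m Edeg k d = (#|S| == d)%:R *: emon k S.
Proof.
rewrite emon_row_mul; apply/rowP => j; rewrite !mxE enum_rankK eqxx /= eq_sym.
by case: eqP => _; case: eqP => _ //=; rewrite ?mulr0 ?mulr1 ?mul0r.
Qed.

Lemma Edeg_idem d e : Edeg k d *m Edeg k e = if d == e then Edeg k d else 0.
Proof.
apply/row_matrixP => i; rewrite row_mul.
have rE : row i (Edeg k d) = emon k (enum_val (i : 'I_#|{set 'I_5}|)) *m Edeg k d.
  by rewrite emon_row_mul enum_valK.
rewrite rE emon_Edeg -scalemxAl emon_Edeg scalerA.
case: (d =P e) => [<-|de].
  by rewrite rE emon_Edeg; case: eqP; rewrite ?mulr1 ?mul0r.
rewrite row0; case: eqP => [->|]; last by rewrite mul0r scale0r.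
by rewrite (introF eqP de) mulr0 scale0r.
Qed.

Lemma sub_EdegP m (A : 'M[k]_(m, nE)) d : (A <= Edeg k d)%MS = (A *m Edeg k d == A).
Proof.
apply/idP/eqP => [/submxP [D ->]|<-]; last exact: submxMl.
by rewrite -mulmxA Edeg_idem eqxx.
Qed.

Lemma emon_sub S : (emon k S <= Edeg k #|S|)%MS.
Proof. by rewrite sub_EdegP emon_Edeg eqxx scale1r. Qed.

Lemma rank_Edeg d : \rank (Edeg k d) = 'C(5, d).
Proof.
have := card_draws 'I_5 d; rewrite card_ord => <-.
set L := [set S : {set 'I_5} | #|S| == d].
pose M : 'M[k]_(#|L|, nE) := \matrix_(i, j) emon k (enum_val i) 0 j.
have fM : row_free M.
  apply/row_freeP; exists M^T; apply/matrixP => i j; rewrite !mxE.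
  rewrite (bigD1 (enum_rank (enum_val i))) //= big1 => [|c hc].
    by rewrite !mxE !eqxx /= addr0 mul1r (inj_eq enum_rank_inj) (inj_eq enum_val_inj).
  by rewrite !mxE (negPf hc) !andbF mul0r.
have -> : \rank (Edeg k d) = \rank M.
  apply/eqmx_rank; apply/andP; split.
    apply/row_subP => i; set S := enum_val (i : 'I_#|{set 'I_5}|).
    have -> : row i (Edeg k d) = emon k S *m Edeg k d by rewrite emon_row_mul enum_valK.
    rewrite emon_Edeg; case: eqP => hS; last by rewrite scale0r sub0mx.
    have SL : S \in L by rewrite inE hS.
    rewrite scale1r; have -> : emon k S = row (enum_rank_in SL S) M.
      by apply/rowP => j; rewrite [RHS]mxE [RHS]mxE enum_rankK_in.
    exact: row_sub.
  apply/row_subP => i; have -> : row i M = emon k (enum_val i).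
    by apply/rowP => j; rewrite [LHS]mxE [LHS]mxE.
  have := enum_valP i; rewrite inE => /eqP <-; exact: emon_sub.
by move: fM; rewrite /row_free => /eqP ->.
Qed.

(** For disjoint S and U each pair (s, u) is an inversion in exactly one of the two orders, so the
    inversion counts add up to |S| |U|, which is even. *)
Lemma wsign_sym S U : (#|U| %% 2 = 0)%N \/ (#|S| %% 2 = 0)%N -> wsign k S U = wsign k U S.
Proof.
move=> par; rewrite /wsign disjoint_sym; case: ifP => // dUS.
set X := [set p | _]; set Y := [set p | _].
suff E : (#|X| + #|Y| = #|S| * #|U|)%N.
  have : ~~ odd (#|S| * #|U|) by rewrite oddM; case: par => /eqP; rewrite modn2;
    case: odd => //; rewrite ?andbF.
  rewrite -E oddD -(signr_odd _ #|X|) -(signr_odd _ #|Y|).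
  by case: odd; case: odd.
pose sw (p : 'I_5 * 'I_5) := (p.2, p.1).
have swI : injective sw by move=> [a b] [c d] [-> ->].
rewrite -(card_imset (mem Y) swI) -cardsX -cardsUI.
rewrite (_ : X :&: _ = set0) ?cards0 ?addn0; last first.
  apply/setP => -[a b]; rewrite !inE /=; apply/negbTE/negP => /andP [/andP [_ ba]].
  case/imsetP => -[c d]; rewrite !inE /= => /andP [_ dc] [ea eb].
  by move: ba; rewrite ea eb ltnNge (ltnW dc).
apply: eq_card => -[a b]; rewrite !inE /=.
apply/orP/andP => [[/andP [/andP []] //|]|[aS bU]].
  by case/imsetP => -[c d]; rewrite !inE /= => /andP [/andP [cU dS] _] [-> ->].
have ab : a != b :> nat.
  apply: contraTneq bU => /val_inj <-; have := disjointFl dUS aS; by move->.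
rewrite neq_ltn in ab; case/orP: ab => h; [right | by left; rewrite aS bU].
apply/imsetP; exists (b, a) => //; by rewrite !inE /= bU aS.
Qed.

End Wedge.

(* The ten pairs [i < j] are numbered 01, 02, 03, 04, 12, 13, 14, 23, 24, 34. *)
Definition pfst (c : nat) : nat := nth 0%N [:: 0; 0; 0; 0; 1; 1; 1; 2; 2; 3]%N c.
Definition psnd (c : nat) : nat := nth 0%N [:: 1; 2; 3; 4; 2; 3; 4; 3; 4; 4]%N c.
Definition pidx (i j : nat) : nat :=
  nth 0%N (nth [::] [:: [:: 0; 0; 1; 2; 3]; [:: 0; 0; 4; 5; 6]; [:: 0; 0; 0; 7; 8];
    [:: 0; 0; 0; 0; 9]; [::]]%N i) j.

Definition pbit (c : nat) : seq bool := [seq (i == pfst c) || (i == psnd c) | i <- iota 0 5].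
Definition bneg (b : seq bool) : seq bool := [seq ~~ nth false b i | i <- iota 0 5].
Definition sbit (m : nat) : seq bool := [seq i == m | i <- iota 0 5].

(* coefficient of row [d] of [E3mx] in e_(pair c) /\ e_m *)
Definition capz (m c d : nat) : int :=
  if bdisj (pbit c) (sbit m) && (bor (pbit c) (sbit m) == bneg (pbit d)) then
    (-1) ^+ (binv (pbit c) (sbit m) + binv (bneg (pbit d)) (pbit d))
  else 0.

(** The nonzero structure constants, as a list that can be evaluated once so that [ring] meets only
    the terms that occur. *)
Definition capsp (m : nat) : seq (nat * nat * int) :=
  [seq t <- [seq (c, d, capz m c d) | c <- iota 0 10, d <- iota 0 10] | t.2 != 0].

Section Tables.
Variable k : fieldType.

Definition ent (x : 'rV[k]_10) (c : nat) : k := x 0 (inord c).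

Definition E2mx : 'M[k]_(10, nE) := \matrix_(c, j) emon k (bs (pbit c)) 0 j.
Definition sg3 (c : nat) : k := (-1) ^+ binv (bneg (pbit c)) (pbit c).
(* signed so that E3mx is dual to E2mx for the pairing of E_3 with E_2 into E_5 *)
Definition E3mx : 'M[k]_(10, nE) :=
  \matrix_(c, j) (sg3 c *: emon k (bs (bneg (pbit c)))) 0 j.
Definition capm (m : nat) : 'M[k]_10 := \matrix_(c, d) (capz m c d)%:~R.

Lemma row_E2mx c : row c E2mx = emon k (bs (pbit c)).
Proof. by apply/rowP => j; rewrite [LHS]mxE [LHS]mxE. Qed.

Lemma row_E3mx c : row c E3mx = sg3 c *: emon k (bs (bneg (pbit c))).
Proof. by apply/rowP => j; rewrite [LHS]mxE [LHS]mxE. Qed.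

Lemma sg3_sqr c : sg3 c * sg3 c = 1.
Proof. by rewrite /sg3 -expr2 sqrr_sign. Qed.

Lemma all10P (P : nat -> bool) : all P (iota 0 10) -> forall c : 'I_10, P c.
Proof. by move=> /allP h c; apply: h; rewrite mem_iota /= add0n. Qed.

Lemma all5P (P : nat -> bool) : all P (iota 0 5) -> forall c : 'I_5, P c.
Proof. by move=> /allP h c; apply: h; rewrite mem_iota /= add0n. Qed.

Lemma bs_inj b c : size b = 5%N -> size c = 5%N -> bs b = bs c -> b = c.
Proof.
move=> sb sc /setP e; apply: (@eq_from_nth _ false) => [|i]; first by rewrite sb sc.
by rewrite sb => hi; have := e (Ordinal hi); rewrite !inE.
Qed.

Lemma pbit_inj (c d : 'I_10) : (bs (pbit c) == bs (pbit d)) = (c == d).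
Proof.
apply/eqP/eqP => [/bs_inj e|->//]; apply/val_inj/eqP => /=.
have /all10P /(_ c) /all10P /(_ d) /implyP : all (fun c => all (fun d =>
  (pbit c == pbit d) ==> (c == d)) (iota 0 10)) (iota 0 10) by vm_compute.
by apply; apply/eqP; apply: e; rewrite size_map size_iota.
Qed.

Lemma pbitN_inj (c d : 'I_10) : (bs (bneg (pbit c)) == bs (bneg (pbit d))) = (c == d).
Proof.
apply/eqP/eqP => [/bs_inj e|->//]; apply/val_inj/eqP => /=.
have /all10P /(_ c) /all10P /(_ d) /implyP : all (fun c => all (fun d =>
  (bneg (pbit c) == bneg (pbit d)) ==> (c == d)) (iota 0 10)) (iota 0 10) by vm_compute.
by apply; apply/eqP; apply: e; rewrite size_map size_iota.
Qed.

Lemma emon_dot S U : emon k S *m (emon k U)^T = ((S == U)%:R)%:M.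
Proof.
apply/matrixP => i j; rewrite !ord1 emon_row_mul !mxE eqxx /=.
by rewrite (inj_eq enum_rank_inj).
Qed.

Lemma mulmx_trE m n p (A : 'M[k]_(m, n)) (B : 'M[k]_(p, n)) i j :
  (A *m B^T) i j = (row i A *m (row j B)^T) 0 0.
Proof. by rewrite !mxE; apply: eq_bigr => l _; rewrite !mxE. Qed.

Lemma E2mxK : E2mx *m E2mx^T = 1%:M.
Proof.
by apply/matrixP => c d; rewrite mulmx_trE !row_E2mx emon_dot !mxE mulr1n pbit_inj.
Qed.

Lemma E3mxK : E3mx *m E3mx^T = 1%:M.
Proof.
apply/matrixP => c d; rewrite mulmx_trE !row_E3mx linearZ /= -scalemxAl -scalemxAr emon_dot.
rewrite !mxE mulr1n pbitN_inj; case: eqP => [->|_]; last by rewrite !mulr0.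
by rewrite mulr1 sg3_sqr.
Qed.

Lemma card_pbit (c : 'I_10) : #|bs (pbit c)| = 2%N.
Proof.
pose P n := sumn [seq nat_of_bool (nth false (pbit n) i) | i <- iota 0 5] == 2%N.
rewrite card_bs; apply/eqP; apply: (all10P (P := P)); by vm_compute.
Qed.

Lemma card_pbitN (c : 'I_10) : #|bs (bneg (pbit c))| = 3%N.
Proof.
pose P n := sumn [seq nat_of_bool (nth false (bneg (pbit n)) i) | i <- iota 0 5] == 3%N.
rewrite card_bs; apply/eqP; apply: (all10P (P := P)); by vm_compute.
Qed.

Lemma E2mx_deg d : E2mx *m Edeg k d = (d == 2)%:R *: E2mx.
Proof.
apply/row_matrixP => c; rewrite row_mul linearZ /= row_E2mx emon_Edeg card_pbit.
by rewrite eq_sym.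
Qed.

Lemma E3mx_deg d : E3mx *m Edeg k d = (d == 3)%:R *: E3mx.
Proof.
apply/row_matrixP => c; rewrite row_mul linearZ /= row_E3mx -scalemxAl emon_Edeg card_pbitN.
by rewrite eq_sym scalerA mulrC -scalerA.
Qed.

Lemma E2mx_free : row_free E2mx.
Proof. by apply/row_freeP; exists E2mx^T; apply: E2mxK. Qed.

Lemma E3mx_free : row_free E3mx.
Proof. by apply/row_freeP; exists E3mx^T; apply: E3mxK. Qed.

Lemma E2mx_eq : (E2mx :=: Edeg k 2)%MS.
Proof.
have s : (E2mx <= Edeg k 2)%MS by rewrite sub_EdegP E2mx_deg scale1r.
by apply/eqmxP; rewrite -(mxrank_leqif_eq s) rank_Edeg (eqP E2mx_free).
Qed.

Lemma E3mx_eq : (E3mx :=: Edeg k 3)%MS.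
Proof.
have s : (E3mx <= Edeg k 3)%MS by rewrite sub_EdegP E3mx_deg scale1r.
by apply/eqmxP; rewrite -(mxrank_leqif_eq s) rank_Edeg (eqP E3mx_free).
Qed.

Lemma E2mx_cap (m : 'I_5) : E2mx *m rwedge k (bs (sbit m)) = capm m *m E3mx.
Proof.
apply/row_matrixP => c; rewrite row_mul row_E2mx emon_rwedge wsign_bs bsU.
have -> : row c (capm m *m E3mx) = \sum_(d < 10) (capz m c d)%:~R *: row d E3mx.
  by rewrite row_mul mulmx_sum_row; apply: eq_bigr => d _; rewrite !mxE.
case bd: (bdisj (pbit c) (sbit m)); last first.
  by rewrite scale0r big1 // => d _; rewrite /capz bd /= scale0r.
(* When e_m is not a factor of the pair, the union is the complement of exactly one pair d;
   existence is checked on all 50 cases. *)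
have /all10P /(_ c) /all5P /(_ m) : all (fun c => all (fun m => bdisj (pbit c) (sbit m) ==>
   has (fun d => bor (pbit c) (sbit m) == bneg (pbit d)) (iota 0 10)) (iota 0 5)) (iota 0 10).
  by vm_compute.
rewrite bd implyTb => /hasP [d]; rewrite mem_iota add0n => hd /eqP hb.
rewrite (bigD1 (Ordinal hd)) //= big1 ?addr0 => [|d' d'd].
  rewrite row_E3mx /= /capz bd hb eqxx /= scalerA rmorphXn /= rmorphN1 exprD.
  by rewrite -mulrA [_ * sg3 _]sg3_sqr mulr1.
rewrite /capz bd hb /= [_ == _]negbTE ?scale0r //.
apply: contraNneq d'd => e; rewrite eq_sym -(pbitN_inj (Ordinal hd) d') /= e; exact: eqxx.
Qed.

Definition alt (x : 'rV[k]_10) : 'M[k]_5 :=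
  \matrix_(i, j) (if (i < j)%N then ent x (pidx i j)
                  else if (j < i)%N then - ent x (pidx j i) else 0).

Definition unalt (m : 'M[k]_5) : 'rV[k]_10 := \row_c m (inord (pfst c)) (inord (psnd c)).

Definition isalt (m : 'M[k]_5) := (forall i j, m j i = - m i j) /\ forall i, m i i = 0.

Lemma alt_isalt x : isalt (alt x).
Proof.
split=> [i j|i]; last by rewrite mxE ltnn.
by rewrite !mxE; case: ltngtP => _; rewrite ?opprK ?oppr0.
Qed.

Lemma pidxP : all (fun c => [&& pidx (pfst c) (psnd c) == c, pfst c < psnd c & psnd c < 5]%N)
  (iota 0 10).
Proof. by vm_compute. Qed.

Lemma pidxP2 : all (fun i => all (fun j => (i < j)%N ==> [&& pidx i j < 10,
  pfst (pidx i j) == i &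
   psnd (pidx i j) == j]%N) (iota 0 5)) (iota 0 5).
Proof. by vm_compute. Qed.

Lemma altK x : unalt (alt x) = x.
Proof.
apply/rowP => c; rewrite !mxE; have /and3P [/eqP h1 h2 h3] := all10P pidxP c.
by rewrite (inordK (ltn_trans h2 h3)) (inordK h3) h2 /ent h1 inord_val.
Qed.

Lemma unaltK m : isalt m -> alt (unalt m) = m.
Proof.
move=> [m1 m2]; apply/matrixP => i j; rewrite mxE.
have h (i' j' : 'I_5) : (i' < j')%N -> ent (unalt m) (pidx i' j') = m i' j'.
  move=> lt; have /implyP /(_ lt) /and3P [h1 /eqP h2 /eqP h3] := all5P (all5P pidxP2 i') j'.
  by rewrite /ent mxE inordK // h2 h3 !inord_val.
case: ltngtP => ij; [exact: h | by rewrite h // m1 opprK|].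
by rewrite (val_inj ij) m2.
Qed.

(* v /\ p evaluated on four coordinates: the polarised Pfaffian *)
Definition Qf (v p : 'M[k]_5) i j l m :=
  v i j * p l m - v i l * p j m + v i m * p j l + v j l * p i m - v j m * p i l + v l m * p i j.

(** This is v /\ p = 0. All quadruples are allowed, not just increasing ones, so that the condition
    can be expanded by multilinearity in [wz_Qr]. *)
Definition wz (v p : 'M[k]_5) := forall i j l m, Qf v p i j l m = 0.

Lemma Qf_sw12 v p i j l m : isalt v -> isalt p -> Qf v p j i l m = - Qf v p i j l m.
Proof. by move=> [v1 _] [p1 _]; rewrite /Qf (v1 i j) (p1 i j); ring. Qed.

Lemma Qf_sw34 v p i j l m : isalt v -> isalt p -> Qf v p i j m l = - Qf v p i j l m.
Proof. by move=> [v1 _] [p1 _]; rewrite /Qf (v1 l m) (p1 l m); ring. Qed.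

Lemma Qf_eq v p i l m : isalt v -> isalt p -> Qf v p i i l m = 0.
Proof. by move=> [_ v1] [_ p1]; rewrite /Qf v1 p1; ring. Qed.

(** [alt] with natural numbers as indices: at numerals it reduces by computation, which leaves
    identities fit for [ring]. *)
Definition an (f : nat -> k) (i j : nat) : k :=
  if (i < j)%N then f (pidx i j) else if (j < i)%N then - f (pidx j i) else 0.

Definition Qn (f g : nat -> k) i j l m :=
  an f i j * an g l m - an f i l * an g j m + an f i m * an g j l
  + an f j l * an g i m - an f j m * an g i l + an f l m * an g i j.

Lemma Qf_alt x y (i j l m : 'I_5) : Qf (alt x) (alt y) i j l m = Qn (ent x) (ent y) i j l m.
Proof. by rewrite /Qf !mxE. Qed.

(** The form is alternating: each quadruple gives zero or, up to sign, one of the five increasing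
    ones. *)
Lemma Qn_sorted (f g : nat -> k) (i j l m : 'I_5) :
  Qn f g 1 2 3 4 = 0 -> Qn f g 0 2 3 4 = 0 -> Qn f g 0 1 3 4 = 0 ->
  Qn f g 0 1 2 4 = 0 -> Qn f g 0 1 2 3 = 0 ->
  (i < j)%N -> (l < m)%N -> Qn f g i j l m = 0.
Proof.
rewrite /Qn /an /= => h0 h1 h2 h3 h4.
have N a b : a = 0 -> b = - a -> b = 0 :> k by move=> -> ->; rewrite oppr0.
case: i => [[|[|[|[|[|//]]]]] ?]; case: j => [[|[|[|[|[|//]]]]] ?] //=;
case: l => [[|[|[|[|[|//]]]]] ?]; case: m => [[|[|[|[|[|//]]]]] ?] //= _ _;
first [ring | apply: etrans h0; ring | apply: etrans h1; ring | apply: etrans h2; ring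
 | apply: etrans h3; ring | apply: etrans h4; ring
 | apply: N h0 _; ring | apply: N h1 _; ring | apply: N h2 _; ring
 | apply: N h3 _; ring | apply: N h4 _; ring].
Qed.

Lemma cap_sparse x y m : (x *m capm m *m y^T) 0 0 =
  \sum_(t <- capsp m) (t.2)%:~R * ent x t.1.1 * ent y t.1.2.
Proof.
pose F (t : nat * nat * int) := (t.2)%:~R * ent x t.1.1 * ent y t.1.2.
transitivity (\sum_(c < 10) \sum_(d < 10) F (val c, val d, capz m c d)).
  rewrite mxE exchange_big /=; apply: eq_bigr => d _; rewrite [X in X * _]mxE mulr_suml.
  apply: eq_bigr => c _; rewrite !mxE /F /ent /= !inord_val; ring.
rewrite /capsp big_filter [RHS]big_mkcond [RHS]big_allpairs_dep.
rewrite -[iota 0 10]/(index_iota 0 10) big_mkord; apply: eq_bigr => c _.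
rewrite big_mkord; apply: eq_bigr => d _ /=; case: eqVneq => [e|//].
by rewrite /F /= e !mul0r.
Qed.

(** Entry m is, up to sign, the coefficient of x /\ e_m /\ y in E_5. This is the polarisation pi(x,
    y), and [qv x x] is twice the vector of sub-Pfaffians. *)
Definition qv (x y : 'rV[k]_10) : 'cV[k]_5 := \col_(m < 5) (x *m capm m *m y^T) 0 0.

Lemma qvE x y (i : 'I_5) : qv x y i 0 = nth 0 [::
  Qn (ent x) (ent y) 1 2 3 4; - Qn (ent x) (ent y) 0 2 3 4; Qn (ent x) (ent y) 0 1 3 4;
  - Qn (ent x) (ent y) 0 1 2 4; Qn (ent x) (ent y) 0 1 2 3] i.
Proof.
rewrite mxE cap_sparse; case: i => [[|[|[|[|[|//]]]]] ?] /=; rewrite /Qn /an /=.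
- have -> : capsp 0 = ltac:(let t := eval vm_compute in (capsp 0) in exact t) by vm_compute.
  by rewrite !big_cons big_nil /=; ring.
- have -> : capsp 1 = ltac:(let t := eval vm_compute in (capsp 1) in exact t) by vm_compute.
  by rewrite !big_cons big_nil /=; ring.
- have -> : capsp 2 = ltac:(let t := eval vm_compute in (capsp 2) in exact t) by vm_compute.
  by rewrite !big_cons big_nil /=; ring.
- have -> : capsp 3 = ltac:(let t := eval vm_compute in (capsp 3) in exact t) by vm_compute.
  by rewrite !big_cons big_nil /=; ring.
- have -> : capsp 4 = ltac:(let t := eval vm_compute in (capsp 4) in exact t) by vm_compute.
  by rewrite !big_cons big_nil /=; ring.
Qed.

(** Translates the ideal condition, that y annihilates x /\ E_1, into x /\ y = 0 in E_4. *)
Lemma cap_wz x y : (forall m : 'I_5, x *m capm m *m y^T = 0) <-> wz (alt x) (alt y).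
Proof.
have E (m : 'I_5) : x *m capm m *m y^T = 0 <-> qv x y m 0 = 0.
  rewrite mxE; split=> [->|h]; first by rewrite mxE.
  by apply/matrixP => i j; rewrite !ord1 h mxE.
pose o (n : nat) (hn : (n < 5)%N) := Ordinal hn.
split=> [h|h m]; last first.
  apply/E; rewrite qvE.
  have h0 := h (@o 1 isT) (@o 2 isT) (@o 3 isT) (@o 4 isT).
  have h1 := h (@o 0 isT) (@o 2 isT) (@o 3 isT) (@o 4 isT).
  have h2 := h (@o 0 isT) (@o 1 isT) (@o 3 isT) (@o 4 isT).
  have h3 := h (@o 0 isT) (@o 1 isT) (@o 2 isT) (@o 4 isT).
  have h4 := h (@o 0 isT) (@o 1 isT) (@o 2 isT) (@o 3 isT).
  rewrite !Qf_alt /= in h0 h1 h2 h3 h4.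
  by case: m => [[|[|[|[|[|//]]]]] ?] /=; rewrite ?(h0, h1, h2, h3, h4) ?oppr0.
have S (i j l m : 'I_5) : (i < j)%N -> (l < m)%N -> Qf (alt x) (alt y) i j l m = 0.
  have q n (hn : (n < 5)%N) := proj1 (E _) (h (Ordinal hn)).
  have /= := q 0%N isT; have /= := q 1%N isT; have /= := q 2%N isT.
  have /= := q 3%N isT; have /= := q 4%N isT; rewrite !qvE /= => q4 /eqP q3 q2 /eqP q1 q0.
  rewrite !oppr_eq0 in q1 q3; rewrite Qf_alt.
  by apply: Qn_sorted => //; apply/eqP.
have ax := alt_isalt x; have ay := alt_isalt y.
have S' (i j l m : 'I_5) : (l < m)%N -> Qf (alt x) (alt y) i j l m = 0.
  move=> lm; case: (ltngtP i j) => [ij|ij|/val_inj ->]; first exact: S.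
    by rewrite Qf_sw12 // S ?oppr0.
  exact: Qf_eq.
move=> i j l m; case: (ltngtP l m) => [lm|lm|/val_inj ->]; first exact: S'.
  by rewrite Qf_sw34 // S' ?oppr0.
have [_ ax0] := ax; have [_ ay0] := ay; have [ax1 _] := ax; have [ay1 _] := ay.
by rewrite /Qf ax0 ay0; ring.
Qed.

End Tables.

(** * Points of H as pairs (V, P) *)

Section Points.
Variable k : fieldType.
Implicit Types (S U : {set 'I_5}) (p : Hpoint k) (A : 'M[k]_(3, 10)) (B : 'M[k]_(8,
  10)) (P : 'M[k]_(2, 10)).

Definition ptmx A B : 'M[k]_nE :=
  (A *m E2mx k + B *m E3mx k + (Edeg k 4 + Edeg k 5))%MS.

Lemma sub_ptmxP m (X : 'M[k]_(m, nE)) A B : (X <= ptmx A B)%MS ->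
  exists u v w z, X = u *m (A *m E2mx k) + v *m (B *m E3mx k) + (w *m Edeg k 4 + z *m Edeg k 5).
Proof.
case/sub_addsmxP => -[x y] /= ->.
have /sub_addsmxP [[u v] /= ->] : (x *m (A *m E2mx k + B *m E3mx k)%MS <= A *m E2mx k + B *m
  E3mx k)%MS.
  exact: submxMl.
have /sub_addsmxP [[w z] /= ->] : (y *m (Edeg k 4 + Edeg k 5)%MS <= Edeg k 4 + Edeg k 5)%MS.
  exact: submxMl.
by exists u, v, w, z.
Qed.

Lemma ptmx_A A B : (A *m E2mx k <= ptmx A B)%MS.
Proof. exact: submx_trans (addsmxSl _ _) (addsmxSl _ _). Qed.

Lemma ptmx_B A B : (B *m E3mx k <= ptmx A B)%MS.
Proof. exact: submx_trans (addsmxSr _ _) (addsmxSl _ _). Qed.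

Lemma ptmx_4 A B : (Edeg k 4 <= ptmx A B)%MS.
Proof. exact: submx_trans (addsmxSl _ _) (addsmxSr _ _). Qed.

Lemma ptmx_5 A B : (Edeg k 5 <= ptmx A B)%MS.
Proof. exact: submx_trans (addsmxSr _ _) (addsmxSr _ _). Qed.

Lemma ptmx_emon A B S : (3 < #|S|)%N -> (emon k S <= ptmx A B)%MS.
Proof.
move=> hS; have h := emon_sub k S.
have : (#|S| <= 5)%N by have := subset_leq_card (subsetT S); rewrite cardsT card_ord.
rewrite leq_eqVlt ltnS => /orP [/eqP e|h4].
  by rewrite e in h; apply: submx_trans h (ptmx_5 _ _).
have e : #|S| = 4%N by apply/eqP; rewrite eqn_leq h4.
by rewrite e in h; apply: submx_trans h (ptmx_4 _ _).
Qed.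

Lemma mul_big_sub m (M : 'M[k]_nE) (Y : 'M[k]_(m, nE)) (d : nat) :
  (forall S : {set 'I_5}, #|S| = d -> (emon k S *m M <= Y)%MS) -> (Edeg k d *m M <= Y)%MS.
Proof.
move=> h; apply/row_subP => i; rewrite row_mul.
have -> : row i (Edeg k d) = emon k (enum_val (i : 'I_#|{set 'I_5}|)) *m Edeg k d.
  by rewrite emon_row_mul enum_valK.
rewrite emon_Edeg; case: eqP => hS; last by rewrite scale0r mul0mx sub0mx.
by rewrite scale1r; apply: h.
Qed.

Lemma ptmx_mul A B (M : 'M[k]_nE) :
  (A *m E2mx k *m M <= ptmx A B)%MS -> (B *m E3mx k *m M <= ptmx A B)%MS ->
  (forall S : {set 'I_5}, (3 < #|S|)%N -> (emon k S *m M <= ptmx A B)%MS) ->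
  (ptmx A B *m M <= ptmx A B)%MS.
Proof.
move=> hA hB hS; rewrite {1}/ptmx addsmxMr addsmx_sub !(addsmxMr, addsmx_sub) hA hB /=.
by apply/andP; split; apply: mul_big_sub => // S cS; apply: hS; rewrite cS.
Qed.

Lemma set1_bs (U : {set 'I_5}) : #|U| = 1%N -> exists m : 'I_5, U = bs (sbit m).
Proof.
move/eqP/cards1P => [m ->]; exists m; apply/setP => i.
by rewrite !inE (nth_map 0%N) ?size_iota // nth_iota // add0n.
Qed.

Lemma lwedge_row d (X : 'M[k]_(d, nE)) (U : {set 'I_5}) c : X *m Edeg k c = X ->
  (forall S : {set 'I_5}, #|S| = c -> (#|U| %% 2 = 0)%N \/ (#|S| %% 2 = 0)%N) ->
  X *m lwedge k U = X *m rwedge k U.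
Proof.
move=> <- h; rewrite -!mulmxA; congr (_ *m _); apply/row_matrixP => i; rewrite !row_mul.
have -> : row i (Edeg k c) = emon k (enum_val (i : 'I_#|{set 'I_5}|)) *m Edeg k c.
  by rewrite emon_row_mul enum_valK.
rewrite emon_Edeg; case: eqP => hS; last by rewrite scale0r !mul0mx.
by rewrite scale1r emon_lwedge emon_rwedge setUC wsign_sym //; case: (h _ hS); [right | left].
Qed.

Lemma rwedge0 : rwedge k set0 = 1%:M.
Proof.
apply/row_matrixP => i; rewrite -[i in RHS]enum_valK rowE.
have e S : emon k S *m rwedge k set0 = emon k S.
  rewrite emon_rwedge setU0 (_ : set0 = bs [::]); last by apply/setP => j; rewrite !inE nth_nil.
  rewrite -(bsK S) wsign_bs (_ : bdisj _ _); last by apply/allP => j _; rewrite nth_nil andbF.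
  rewrite (_ : binv _ _ = 0%N) ?scale1r // /binv.
  by rewrite /= !andbF.
by rewrite -[i in LHS]enum_valK -emon_row_mul e mulmx1.
Qed.

(** Right multiplication by e_U is the identity for U empty, falls under the hypothesis on I_2 when
    |U| = 1, and otherwise lands in degree at least 4. Left multiplication agrees with it on I_2,
    whose degree is even, and on I_3 any nonempty U again leads to degree at least 4. *)
Lemma ptmx_ideal A B : (forall m : 'I_5, (A *m capm k m <= B)%MS) -> is_ideal (ptmx A B).
Proof.
move=> hAB.
have card_wedge S U : (3 < #|S| + #|U|)%N -> (wsign k S U *: emon k (S :|: U) <= ptmx A B)%MS.
  move=> h; have [dSU|nd] := boolP [disjoint S & U]; last first.
    by rewrite /wsign (negPf nd) scale0r sub0mx.
  by apply/scalemx_sub/ptmx_emon; move: dSU; rewrite -leq_card_setU => /eqP ->.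
have card_rw d (X : 'M_(d, nE)) c U : X *m Edeg k c = X -> (3 < c + #|U|)%N ->
    (X *m rwedge k U <= ptmx A B)%MS.
  move=> <- h; rewrite -mulmxA; apply: mulmx_sub; apply: mul_big_sub => // S hS.
  by rewrite emon_rwedge; apply: card_wedge; rewrite hS.
have A2 : A *m E2mx k *m Edeg k 2 = A *m E2mx k by rewrite -mulmxA E2mx_deg scale1r.
have B3 : B *m E3mx k *m Edeg k 3 = B *m E3mx k by rewrite -mulmxA E3mx_deg scale1r.
have AR U : (A *m E2mx k *m rwedge k U <= ptmx A B)%MS.
  case: (ltngtP #|U| 1) => [|h|/set1_bs [m ->]].
  - by rewrite ltnS leqn0 cards_eq0 => /eqP ->; rewrite rwedge0 mulmx1 ptmx_A.
  - exact: card_rw A2 _.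
  - rewrite -mulmxA E2mx_cap mulmxA; apply: submx_trans (ptmx_B A B).
    exact: submxMr.
have BR U : (B *m E3mx k *m rwedge k U <= ptmx A B)%MS.
  case: (posnP #|U|) => [/eqP|h]; last exact: card_rw B3 _.
  by rewrite cards_eq0 => /eqP ->; rewrite rwedge0 mulmx1 ptmx_B.
have R U : (ptmx A B *m rwedge k U <= ptmx A B)%MS.
  apply: ptmx_mul => // S hS; rewrite emon_rwedge; apply: card_wedge.
  exact: leq_trans (leq_addr _ _).
have L U : (ptmx A B *m lwedge k U <= ptmx A B)%MS.
  apply: ptmx_mul => [||S hS].
  - by rewrite (lwedge_row A2) // => S ->; right.
  - have [/set1_bs [m em]|n1] := eqVneq #|U| 1%N; last first.
      have [/eqP|U0] := posnP #|U|.
        rewrite cards_eq0 => /eqP U0; rewrite (lwedge_row B3) // => S _; left.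
        by rewrite U0 cards0.
      rewrite -B3 -mulmxA -mulmxA; apply: mulmx_sub; apply: mulmx_sub;
        apply: mul_big_sub => // S hS.
      by rewrite emon_lwedge; apply: card_wedge; rewrite hS addnC.
    rewrite -B3 -mulmxA -mulmxA; apply: mulmx_sub; apply: mulmx_sub;
      apply: mul_big_sub => // S hS.
    rewrite emon_lwedge; apply: card_wedge; rewrite hS em (_ : #|_| = 1%N) //.
    rewrite card_bs; apply/eqP; move: m {em}; case=> [[|[|[|[|[|//]]]]] ?]; by vm_compute.
  - by rewrite emon_lwedge; apply: card_wedge; apply: leq_trans (leq_addl _ _).
move=> x y hx; split; [rewrite wedge_r | rewrite wedge_l]; apply: summx_sub => U _;
  by apply: scalemx_sub; apply: submx_trans (submxMr _ hx) _.
Qed.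

Lemma ptmx_homogeneous A B : is_homogeneous (ptmx A B).
Proof.
move=> x d hx; apply: submx_trans (submxMr _ hx) _; apply: ptmx_mul => [||S hS].
- rewrite -mulmxA E2mx_deg -scalemxAr; apply: scalemx_sub; exact: ptmx_A.
- rewrite -mulmxA E3mx_deg -scalemxAr; apply: scalemx_sub; exact: ptmx_B.
- by rewrite emon_Edeg; apply: scalemx_sub; apply: ptmx_emon.
Qed.

Lemma ptmx_cap A B d : (ptmx A B :&: Edeg k d :=:
  if d == 2%N then <<A *m E2mx k>> else if d == 3%N then <<B *m E3mx k>>
  else if (d == 4%N) || (d == 5%N) then Edeg k d else 0)%MS.
Proof.
apply/eqmxP/andP; split.
  set X := (_ :&: _)%MS; have /sub_ptmxP [u [v [w [z e]]]] : (X <= ptmx A B)%MS by exact: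
    capmxSl.
  have /eqP : X *m Edeg k d == X by rewrite -sub_EdegP; exact: capmxSr.
  rewrite {1}e !mulmxDl -!mulmxA E2mx_deg E3mx_deg !Edeg_idem => <-.
  have [->|n2] := eqVneq d 2%N.
    rewrite /= scale1r scale0r !mulmx0 !addr0 genmxE; exact: submxMl.
  have [->|n3] := eqVneq d 3%N.
    rewrite /= scale1r scale0r !mulmx0 !addr0 add0r genmxE; exact: submxMl.
  rewrite !scale0r !mulmx0 !add0r.
  have [->|n4] := eqVneq d 4%N; first by rewrite /= mulmx0 addr0 submxMl.
  have [->|n5] := eqVneq d 5%N; first by rewrite /= mulmx0 add0r submxMl.
  by rewrite /= !mulmx0 addr0 sub0mx.
rewrite sub_capmx; have [->|n2] := eqVneq d 2%N.
  by rewrite !genmxE ptmx_A sub_EdegP -mulmxA E2mx_deg scale1r eqxx.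
have [->|n3] := eqVneq d 3%N.
  by rewrite !genmxE ptmx_B sub_EdegP -mulmxA E3mx_deg scale1r eqxx.
have [->|n4] := eqVneq d 4%N; first by rewrite ptmx_4 submx_refl.
have [->|n5] := eqVneq d 5%N; first by rewrite ptmx_5 submx_refl.
by rewrite !sub0mx.
Qed.

Lemma ptmx_Hpt A B : row_free A -> row_free B ->
  (forall m : 'I_5, (A *m capm k m <= B)%MS) -> Hpt (<<ptmx A B>>)%MS.
Proof.
move=> fA fB hAB; split; first by rewrite genmx_id.
have id := ptmx_ideal hAB; have hom := @ptmx_homogeneous A B.
split; first by move=> x y; rewrite !genmxE; apply: id.
split; first by move=> x d; rewrite !genmxE; apply: hom.
move=> d; rewrite /hilb.
have -> : \rank (<<ptmx A B>> :&: Edeg k d)%MS = \rank (ptmx A B :&: Edeg k d)%MS.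
  by apply: eqmx_rank; apply/eqmxP; apply: cap_eqmx => //; exact: genmxE.
rewrite ptmx_cap rank_Edeg.
have rA : \rank (A *m E2mx k) = 3%N.
  by rewrite mxrankMfree ?E2mx_free //; apply/eqP.
have rB : \rank (B *m E3mx k) = 8%N.
  by rewrite mxrankMfree ?E3mx_free //; apply/eqP.
case: d => [|[|[|[|[|[|d]]]]]] //=; rewrite ?genmxE ?rA ?rB ?rank_Edeg ?mxrank0 //.
Qed.

Definition pt_of A B fA fB hAB : Hpoint k := exist _ _ (@ptmx_Hpt A B fA fB hAB).

Lemma pt_of_bases A B fA fB hAB : bases (@pt_of A B fA fB hAB) (A *m E2mx k) (B *m E3mx k).
Proof.
have h d : (proj1_sig (@pt_of A B fA fB hAB) :&: Edeg k d :=: ptmx A B :&: Edeg k d)%MS.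
  by apply: cap_eqmx => //; exact: genmxE.
split; split.
- by rewrite /row_free mxrankMfree ?E2mx_free.
- apply/eqmxP; apply: eqmx_sym;
  apply: eqmx_trans (h 2%N) (eqmx_trans (ptmx_cap A B 2) (genmxE _)).
- by rewrite /row_free mxrankMfree ?E3mx_free.
- apply/eqmxP; apply: eqmx_sym;
  apply: eqmx_trans (h 3%N) (eqmx_trans (ptmx_cap A B 3) (genmxE _)).
Qed.

(* [I_2] is spanned by the bivectors [A], and [I_3] is the annihilator of [P]. *)
Definition rep p A P := exists B, [/\ row_free P, row_free B, B *m P^T = 0
  & bases p (A *m E2mx k) (B *m E3mx k)].

Lemma perp_basis m n r (P : 'M[k]_(m, n)) : row_free P -> (m + r)%N = n ->
  exists2 B : 'M[k]_(r, n), row_free B & B *m P^T = 0.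
Proof.
move=> fP e; have rk : \rank (kermx P^T) = r.
  by rewrite mxrank_ker mxrank_tr (eqP fP) -e addKn.
exists (castmx (rk, erefl) (row_base (kermx P^T))).
  by rewrite /row_free eqmx_cast; apply/eqP; rewrite (eqP (row_base_free _)).
apply/sub_kermxP; rewrite eqmx_cast; by rewrite eq_row_base.
Qed.

(** By dimension the rows of B span the whole annihilator of P. *)
Lemma perp_perp m n r r' (P : 'M[k]_(m, n)) (B : 'M[k]_(r, n)) (X : 'M[k]_(r', n)) :
  row_free P -> row_free B -> (m + r)%N = n -> B *m P^T = 0 -> X *m P^T = 0 -> (X <= B)%MS.
Proof.
move=> fP fB e /sub_kermxP sB /sub_kermxP sX; apply: submx_trans sX _.
rewrite -(mxrank_leqif_sup sB) mxrank_ker mxrank_tr (eqP fP) (eqP fB) -e.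
by rewrite addKn.
Qed.

Lemma perp_symm m n r (P : 'M[k]_(m, n)) (B : 'M[k]_(r, n)) : B *m P^T = 0 -> P *m B^T = 0.
Proof. by move/(congr1 trmx); rewrite trmx_mul trmxK trmx0. Qed.

Definition wzm m n (A : 'M[k]_(m, 10)) (P : 'M[k]_(n, 10)) :=
  forall i j, wz (alt (row i A)) (alt (row j P)).

Lemma wzm_cap m n (A : 'M[k]_(m, 10)) (P : 'M[k]_(n, 10)) :
  wzm A P <-> forall l : 'I_5, A *m capm k l *m P^T = 0.
Proof.
have E i j (l : 'I_5) : row i A *m capm k l *m (row j P)^T = 0 <->
    (A *m capm k l *m P^T) i j = 0.
  rewrite -row_mul mulmx_trE; split=> [-> |h]; first by rewrite mxE.
  by apply/matrixP => u v; rewrite !ord1 h mxE.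
split=> h => [l|i j].
  by apply/matrixP => i j; rewrite [RHS]mxE; apply/E; apply: (proj2 (cap_wz _ _)).
by apply/cap_wz => l; apply/E; rewrite h mxE.
Qed.

Lemma rep_exists A P : row_free A -> row_free P -> wzm A P -> exists p, rep p A P.
Proof.
move=> fA fP /wzm_cap h; have [B fB BP] := perp_basis fP (erefl : 2 + 8 = 10)%N.
have hAB (m : 'I_5) : (A *m capm k m <= B)%MS.
  exact: perp_perp fP fB erefl BP (h m).
exists (pt_of fA fB hAB), B; split=> //; exact: pt_of_bases.
Qed.

Lemma rep_bases p A P B : rep p A P -> row_free B -> B *m P^T = 0 ->
  bases p (A *m E2mx k) (B *m E3mx k).
Proof.
move=> [B' [fP fB' BP' [b2 [fB2 eB2]]]] fB BP; split=> //; split.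
  by rewrite /row_free mxrankMfree ?E3mx_free.
apply/eqmxP; apply: eqmx_trans (eqmxP eB2); apply: eqmxMr; apply/eqmxP/andP; split.
  exact: perp_perp fP fB' erefl BP' BP.
exact: perp_perp fP fB erefl BP BP'.
Qed.

Lemma mxrank_basis (n r : nat) (V : 'M[k]_n) : \rank V = r ->
  exists2 A : 'M[k]_(r, n), row_free A & (A :=: V)%MS.
Proof.
move=> e; exists (castmx (e, erefl) (row_base V)).
  by rewrite /row_free eqmx_cast; apply/eqP; rewrite (eqP (row_base_free _)).
by apply: eqmx_trans (eqmx_cast _ _) (eq_row_base _).
Qed.

Lemma E2_coord m (A : 'M[k]_(m, nE)) : (A <= Edeg k 2)%MS -> A = A *m (E2mx k)^T *m E2mx k.
Proof. by rewrite -E2mx_eq => /submxP [D ->]; rewrite -(mulmxA D) E2mxK mulmx1. Qed.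

Lemma E3_coord m (A : 'M[k]_(m, nE)) : (A <= Edeg k 3)%MS -> A = A *m (E3mx k)^T *m E3mx k.
Proof. by rewrite -E3mx_eq => /submxP [D ->]; rewrite -(mulmxA D) E3mxK mulmx1. Qed.

(** The ranks 3 and 8 of I_2 and I_3 are 10 - 7 and 10 - 2, and P is taken as the annihilator of
    I_3. From here on points are handled through (A, P). *)
Lemma has_rep p : exists A P, [/\ row_free A, wzm A P & rep p A P].
Proof.
case: p => I [eI [idI [homI hI]]].
have rk d r : 'C(5, d) = (h1572 d + r)%N -> \rank (I :&: Edeg k d)%MS = r.
  move=> e; have := hI d; rewrite /hilb rank_Edeg e => h.
  have := mxrankS (capmxSr I (Edeg k d)); rewrite rank_Edeg e; lia.
have [A2 fA2 eA2] := mxrank_basis (rk 2%N 3%N erefl).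
have [B3 fB3 eB3] := mxrank_basis (rk 3%N 8%N erefl).
have sA2 : (A2 <= Edeg k 2)%MS by rewrite eA2 capmxSr.
have sB3 : (B3 <= Edeg k 3)%MS by rewrite eB3 capmxSr.
set A := A2 *m (E2mx k)^T; have eA := E2_coord sA2; rewrite -/A in eA.
set B := B3 *m (E3mx k)^T; have eB := E3_coord sB3; rewrite -/B in eB.
have fA : row_free A.
  by move: fA2; rewrite {1}eA /row_free mxrankMfree ?E2mx_free.
have fB : row_free B.
  by move: fB3; rewrite {1}eB /row_free mxrankMfree ?E3mx_free.
have [P fP PB] := perp_basis fB (erefl : 8 + 2 = 10)%N.
have BP := perp_symm PB.
exists A, P; split=> //; last first.
  by exists B; split=> //; rewrite -eA -eB; split; split=> //; apply/eqmxP.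
apply/wzm_cap => m; suff /submxP [D ->] : (A *m capm k m <= B)%MS by rewrite -mulmxA BP mulmx0.
have : (A *m capm k m *m E3mx k <= B *m E3mx k)%MS.
  rewrite -mulmxA -E2mx_cap mulmxA -eA -eB eB3 sub_capmx; apply/andP; split.
    apply/row_subP => i; rewrite row_mul -wedge_emon; apply: (proj1 (idI _ _ _)).
    apply: submx_trans (row_sub i _) _; rewrite eA2; exact: capmxSl.
  rewrite eA -mulmxA E2mx_cap mulmxA; apply: submx_trans (submxMl _ _) _.
  by rewrite E3mx_eq.
by rewrite submxMfree ?E3mx_free.
Qed.

Lemma has_bases p : exists (M : 'M[k]_(3, nE)) (N : 'M[k]_(8, nE)), bases p M N.
Proof. by have [A [P [_ _ [B [_ _ _ hb]]]]] := has_rep p;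
  exists (A *m E2mx k), (B *m E3mx k). Qed.

Lemma rep_change p A P A' P' : rep p A P -> (A' :=: A)%MS -> (P' :=: P)%MS -> rep p A' P'.
Proof.
move=> [B [fP fB BP [[f2 e2] b3]]] eA eP; exists B; split=> //.
- by move: fP; rewrite /row_free eP.
- have /submxP [D ->] : (P' <= P)%MS by rewrite eP.
  by rewrite trmx_mul mulmxA BP mul0mx.
split=> //; split; first by move: f2; rewrite /row_free !mxrankMfree ?E2mx_free // eA.
by apply/eqmxP; apply: eqmx_trans (eqmxP e2); exact: eqmxMr.
Qed.

End Points.

(** [curve_closed] needs a polynomial basis of I_3 along the curve, while only P is given.
    [polymx_perp] supplies one that extends the basis at s0; it may degenerate elsewhere, which e
    detects. *)
Lemma curve_rep (k : closedFieldType) (Z : Hpoint k -> Prop)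
    (a : k -> 'M[k]_(3, 10)) (P : k -> 'M[k]_(2, 10)) (d : k -> k) s0 s1 p0 :
  Hclosed Z -> polymx (@line_gen k) a -> polymx (@line_gen k) P ->
  polyfun (@line_gen k) d -> d s1 != 0 ->
  (forall s, d s != 0 -> exists p, Z p /\ rep p (a s) (P s)) ->
  rep p0 (a s0) (P s0) -> Z p0.
Proof.
move=> cZ pa pP pd ds1 hs [B0 [fP fB BP hb]].
have [K [pK K0 KP]] := polymx_perp pP fP BP.
pose e s := \det (K s *m pinvmx B0).
have pe : polyfun (@line_gen k) e by apply: pf_det; apply: pm_mul => //; apply: pm_cst.
have e0 : e s0 != 0 by rewrite /e K0 mulmxVp // det1 oner_eq0.
(* Nothing is known of d at s0 or of e at s1, so a parameter good for both is found on the line. *)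
have [s2 ds2] : exists s, d s * e s != 0.
  apply: NNPP => hN; case: (line_mul_eq0 pd pe) => [s||].
  - by apply/eqP; apply: NNPP => /negP h; apply: hN; exists s.
  - by move=> h; rewrite h eqxx in ds1.
  - by move=> h; rewrite h eqxx in e0.
apply: (@curve_closed k Z (fun s => a s *m E2mx k) (fun s => K s *m E3mx k)
   (fun s => d s * e s) s0 s2 p0) => //.
- by apply: pm_mul => //; apply: pm_cst.
- by apply: pm_mul => //; apply: pm_cst.
- exact: pf_mul.
- move=> s; rewrite mulf_eq0 negb_or => /andP [/hs [p [Zp rp]] es].
  exists p; split=> //; apply: rep_bases rp _ (KP s).
  have u : K s *m pinvmx B0 \in unitmx by rewrite unitmxE unitfE.
  apply/row_freeP; exists (pinvmx B0 *m invmx (K s *m pinvmx B0)).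
  by rewrite mulmxA mulmxV.
- by rewrite K0.
Qed.

(** * Normalised affine charts and their dimension *)

Definition trunc (k : fieldType) N j (x : 'rV[k]_N) : 'rV[k]_N :=
  \row_i (if (i < j)%N then x 0 i else 0).

Lemma trunc_comp (k : fieldType) N j m n (a : 'rV[k]_N -> 'M[k]_(m, n)) :
  polymx (@aff_gen k N) a -> polymx (@aff_gen k N) (fun x => a (trunc j x)).
Proof.
move=> pa u v; apply: (polyfun_comp (h := @trunc k N j)) (pa u v) => g [i ->].
case: (ltnP i j) => h.
  apply: (@pf_ext _ _ _ (fun x : 'rV[k]_N => x 0 i)) => [x|]; first by rewrite /= mxE h.
  by apply: pf_gen; exists i.
apply: (pf_ext _ (pf_cst _ 0)) => x; by rewrite /= mxE ltnNge h.
Qed.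

Section NormalChart.
Variables (k : closedFieldType) (N : nat).
Variables (a : 'rV[k]_N -> 'M[k]_(3, 10)) (P : 'rV[k]_N -> 'M[k]_(2, 10)).
Variables (Sa : 'M[k]_(10, 3)) (Sp : 'M[k]_(10, 2)) (J : 'M[k]_(8, 10)).
Hypothesis pa : polymx (@aff_gen k N) a.
Hypothesis pP : polymx (@aff_gen k N) P.
Hypothesis aSa : forall x, a x *m Sa = 1%:M.
Hypothesis PSp : forall x, P x *m Sp = 1%:M.
Hypothesis JJ : J *m J^T = 1%:M.
Hypothesis JSp : J *m Sp = 0.
Hypothesis SpJ : Sp *m Sp^T + J^T *m J = 1%:M.
Hypothesis aP : forall x, wzm (a x) (P x).

(** In block form, for P = (1 | P'), this is (-P'^T | 1): the basis of the annihilator of P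
    normalised on the columns that J selects. *)
Let b x := J - J *m (P x)^T *m Sp^T.
Let AE x := a x *m E2mx k.
Let BE x := b x *m E3mx k.

Definition chart_set : Hpoint k -> Prop := Hclosure (image_of AE BE).

Let fa x : row_free (a x). Proof. by apply/row_freeP; exists Sa. Qed.
Let fP x : row_free (P x). Proof. by apply/row_freeP; exists Sp. Qed.

Let bJ x : b x *m J^T = 1%:M.
Proof.
rewrite mulmxBl JJ -!mulmxA (_ : Sp^T *m J^T = 0) ?mulmx0 ?subr0 //.
by rewrite -trmx_mul JSp trmx0.
Qed.

Let fb x : row_free (b x). Proof. by apply/row_freeP; exists J^T. Qed.

Let bP x : b x *m (P x)^T = 0.
Proof. by rewrite mulmxBl -!mulmxA -trmx_mul PSp trmx1 mulmx1 subrr. Qed.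

(** P is recovered polynomially from b, so its entries are polynomial functions of a basis of I_3;
    [chart_dim] reads parameters this way. *)
Let Pb x : P x = Sp^T - (b x *m Sp)^T *m J.
Proof.
rewrite mulmxBl JSp sub0r -!mulmxA.
have -> : Sp^T *m Sp = 1%:M.
  have := congr1 (fun M => P 0 *m M *m Sp) SpJ.
  rewrite mulmxDr mulmxDl !mulmxA PSp mul1mx mulmx1 PSp => /(canRL (addrK _)) ->.
  by rewrite -!mulmxA JSp !mulmx0 subr0.
rewrite mulmx1 linearN /= mulNmx opprK trmx_mul trmxK -mulmxA.
by rewrite -{1}[P x]mulmx1 -SpJ mulmxDr !mulmxA PSp mul1mx.
Qed.

Let pb : polymx (@aff_gen k N) b.
Proof.
apply: pm_add; first exact: pm_cst.
apply: pm_opp; apply: pm_mul; last exact: pm_cst.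
by apply: pm_mul; [apply: pm_cst | apply: pm_tr].
Qed.

Let pAE : polymx (@aff_gen k N) AE.
Proof. by apply: pm_mul => //; apply: pm_cst. Qed.
Let pBE : polymx (@aff_gen k N) BE.
Proof. by apply: pm_mul => //; apply: pm_cst. Qed.

Let pts x : exists p, bases p (AE x) (BE x).
Proof.
have [p rp] := rep_exists (fa x) (fP x) (aP x).
by exists p; apply: rep_bases rp (fb x) (bP x).
Qed.

Lemma chart_irreducible : Hirreducible chart_set.
Proof. exact: image_irreducible. Qed.

Lemma chart_in p x : rep p (a x) (P x) -> chart_set p.
Proof.
by move=> rp; apply: sub_Hclosure; exists x; apply: rep_bases rp (fb x) (bP x).
Qed.

Lemma chart_no_chain : ~ chain_in chart_set N.+1.
Proof. by apply: (no_long_chain pAE pBE (@has_bases k)) => p. Qed.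

(** An identity satisfied on the image by the bases that another selector Sa' normalises passes to
    the closure. T is built from a basis of I_3 at p, so that p is in the chart of S and T. *)
Lemma chart_vanish (Sa' : 'M[k]_(10, 3)) (g : 'M[k]_(3, 10) -> k) :
  polyfun (fun f => exists i j, f = fun A : 'M[k]_(3, 10) => A i j) g ->
  (forall x u, u *m a x *m Sa' = 1%:M -> g (u *m a x) = 0) ->
  forall p A Q, chart_set p -> rep p A Q -> A *m Sa' = 1%:M -> g A = 0.
Proof.
move=> pg hg p A Q Cp [B [fQ fB BQ hb]] ASa.
pose S := (E2mx k)^T *m Sa'; pose T := pinvmx (B *m E3mx k).
have [G hG] : exists G : {mpoly k[nvars]}, forall A' B',
    G.@[coords A' B'] = g (A' *m (E2mx k)^T).
  pose h (ab : 'M[k]_(3, nE) * 'M[k]_(8, nE)) := ab.1 *m (E2mx k)^T.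
  have ph : polymx (@pair_gen k) h by apply: pm_mul (@pm_pair_l k) _; apply: pm_cst.
  have /pair_mpoly [G hG] : polyfun (@pair_gen k) (g \o h).
    by apply: polyfun_comp pg => f [i [j ->]]; apply: ph.
  by exists G => A' B'; rewrite -(hG (A', B')).
have E (M : 'M[k]_(3, 10)) : M *m E2mx k *m S = M *m Sa'.
  by rewrite /S mulmxA -(mulmxA M) E2mxK mulmx1.
have : vanish S T G p.
  apply: Cp; first exact: vanish_closed.
  move=> q [x hx]; move=> A' B' hb' d; rewrite (cval_change G hb' hx d).
  have [u _] := cden_unit (cden_change hb' hx d).
  rewrite /AE E in u.
  rewrite /cval hG /nrm /AE E -(mulmxA _ (a x *m _)) -(mulmxA (a x)) E2mxK mulmx1; apply: hg.
  by rewrite -mulmxA mulVmx.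
move=> /(_ _ _ hb); rewrite /cden E ASa det1 mul1r.
have fBE : row_free (B *m E3mx k) by rewrite /row_free mxrankMfree ?E3mx_free.
rewrite mulmxVp // det1 oner_eq0 => /(_ isT).
rewrite /cval hG /nrm E ASa -mulmxA -mulmxA E2mxK mulmx1.
by rewrite (_ : invmx _ = 1%:M) ?mul1mx // -[RHS](mulmxV (unitmx1 _ _)) mul1mx.
Qed.

(** Triangular recovery of the parameters: once the coordinates after i are zero, x_i can be read,
    up to a nonzero constant, from one entry of [a x] or [P x]. *)
Hypothesis coord : forall i : 'I_N, exists e u c, e != 0 /\
  ((forall x : 'rV[k]_N, (forall j : 'I_N, (i < j)%N -> x 0 j = 0) -> a x u c = e * x 0 i) \/
   (exists u', forall x : 'rV[k]_N, (forall j : 'I_N,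
     (i < j)%N -> x 0 j = 0) -> P x u' c = e * x 0 i)).

(** The closures of the images of the coordinate subspaces k^0, ..., k^N, cut out by [trunc], form
    the chain. The function given by [coord] for x_j vanishes on the image of k^j but not on that of
    k^(j+1). *)
Lemma chart_dim : Hdim chart_set N.
Proof.
split; last exact: chart_no_chain.
exists (fun j => Hclosure (image_of (fun x => AE (trunc j x)) (fun x => BE (trunc j x)))).
have mono (j j' : nat) : (j <= j')%N ->
   subs (Hclosure (image_of (fun x => AE (trunc j x)) (fun x => BE (trunc j x))))
     (Hclosure (image_of (fun x => AE (trunc j' x)) (fun x => BE (trunc j' x)))).
  move=> jj' p hp; apply: hp; first exact: Hclosure_closed.
  move=> q [x hx]; apply: sub_Hclosure; exists (trunc j x).
  suff -> : trunc j' (trunc j x) = trunc j x by [].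
  apply/rowP => i; rewrite !mxE; case: (ltnP i j) => h; last by case: ifP.
  by rewrite (leq_trans h jj').
split.
  move=> i _; apply: image_irreducible; [exact: trunc_comp | exact: trunc_comp|].
  by move=> x; apply: pts.
split; last first.
  move=> p hp; apply: hp; first exact: Hclosure_closed.
  by move=> q [x hx]; apply: sub_Hclosure; exists (trunc N x).
move=> j hj; split; first exact: mono.
pose i := Ordinal hj; have [e [u [c [e0 hc]]]] := coord i.
pose S := (E2mx k)^T *m Sa; pose T := (E3mx k)^T *m J^T.
have AS x : AE x *m S = 1%:M by rewrite /AE /S mulmxA -(mulmxA (a x)) E2mxK mulmx1.
have BT x : BE x *m T = 1%:M by rewrite /BE /T mulmxA -(mulmxA (b x)) E3mxK mulmx1.
have inv1 n : invmx 1%:M = 1%:M :> 'M[k]_n.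
  by rewrite -[LHS]mulmx1 mulVmx ?unitmx1.
have [G hG] : exists G : {mpoly k[nvars]}, forall x : 'rV[k]_N,
    (forall j' : 'I_N, (i < j')%N -> x 0 j' = 0) -> G.@[coords (AE x) (BE x)] = e * x 0 i.
  case: hc => [hc|[u' hc]].
    pose h (ab : 'M[k]_(3, nE) * 'M[k]_(8, nE)) := ab.1 *m (E2mx k)^T.
    have ph : polymx (@pair_gen k) h by apply: pm_mul (@pm_pair_l k) _; apply: pm_cst.
    have /pair_mpoly [G hG] := ph u c.
    exists G => x hx; rewrite -(hG (AE x, BE x)) /h /AE /= -mulmxA E2mxK mulmx1; exact: hc.
  pose h (ab : 'M[k]_(3, nE) * 'M[k]_(8, nE)) := Sp^T - (ab.2 *m (E3mx k)^T *m Sp)^T *m J.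
  have ph : polymx (@pair_gen k) h.
    apply: pm_add; first exact: pm_cst.
    apply: pm_opp; apply: pm_mul; last exact: pm_cst.
    apply: pm_tr; apply: pm_mul; last exact: pm_cst.
    by apply: pm_mul (@pm_pair_r k) _; apply: pm_cst.
  have /pair_mpoly [G hG] := ph u' c.
  exists G => x hx; rewrite -(hG (AE x, BE x)) /h /BE /= -(mulmxA (b x)) E3mxK mulmx1 -Pb.
  exact: hc.
have val_x x : cval S T G (AE x) (BE x) = G.@[coords (AE x) (BE x)].
  by rewrite /cval /nrm AS BT !inv1 !mul1mx.
have den_x x : cden S T (AE x) (BE x) != 0 by rewrite /cden AS BT !det1 mulr1 oner_eq0.
move=> hs; pose x := delta_mx 0 i : 'rV[k]_N.
have xt : trunc j.+1 x = x.
  apply/rowP => l; rewrite !mxE; case: ltnP => // h.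
  by rewrite /= -val_eqE /= gtn_eqF.
have [p hp] := pts x.
have : vanish S T G p.
  have := hs p; apply.
  - by apply: sub_Hclosure; exists x; rewrite xt.
  - exact: vanish_closed.
  - move=> q [y hy]; apply: vanish1 hy _; rewrite val_x hG ?mxE ?ltnn ?mulr0 //.
    by move=> j' /= jj'; rewrite mxE ltnNge (ltnW jj').
move=> /(_ _ _ hp (den_x x)); rewrite val_x hG.
  by rewrite mxE !eqxx mulr1 => /eqP; rewrite (negPf e0).
by move=> j' /= jj'; rewrite mxE eqxx /=; case: eqVneq jj' => [->|//]; rewrite /= ltnn.
Qed.

End NormalChart.

(** * Bivectors under linear changes of coordinates *)

Section Bivectors.
Variable k : fieldType.
Implicit Types (g h v : 'M[k]_5).

Lemma ent_lin c a (x y : 'rV[k]_10) : ent (a *: x + y) c = a * ent x c + ent y c.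
Proof. by rewrite /ent !mxE. Qed.

Lemma alt_is_linear : linear (@alt k).
Proof.
move=> a x y; apply/matrixP => i j; rewrite !mxE !ent_lin.
by case: ifP => _ //; case: ifP => _; ring.
Qed.
HB.instance Definition _ := GRing.isLinear.Build k 'rV[k]_10 'M[k]_5 _ (@alt k) alt_is_linear.

Lemma unalt_is_linear : linear (@unalt k).
Proof. by move=> a x y; apply/rowP => i; rewrite !mxE. Qed.
HB.instance Definition _ := GRing.isLinear.Build k 'M[k]_5 'rV[k]_10 _ (@unalt k)
  unalt_is_linear.

(* [alt (cong g x) = g^T *m alt x *m g], i.e. a /\ b goes to (a g) /\ (b g) *)
Definition cong (g : 'M[k]_5) (x : 'rV[k]_10) : 'rV[k]_10 := unalt (g^T *m alt x *m g).
Lemma cong_is_linear g : linear (cong g).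
Proof. by move=> a x y; rewrite /cong linearP /= mulmxDr mulmxDl -scalemxAr -scalemxAl
  linearP. Qed.
HB.instance Definition _ g := GRing.isLinear.Build k 'rV[k]_10 'rV[k]_10 _ (cong g)
  (cong_is_linear g).

Definition L2 g : 'M[k]_10 := lin1_mx (cong g).

Definition bil (v : 'M[k]_5) (x y : 'rV[k]_5) : k := (x *m v *m y^T) 0 0.

Lemma isalt_tr v : isalt v -> v^T = - v.
Proof. by move=> [h _]; apply/matrixP => i j; rewrite !mxE h. Qed.

Lemma bil_anti v x y : isalt v -> bil v y x = - bil v x y.
Proof.
move=> /isalt_tr hv; rewrite /bil; transitivity ((y *m v *m x^T)^T 0 0).
  by rewrite [RHS]mxE.
by rewrite !trmx_mul trmxK hv mulNmx mulmxN mulmxA mxE.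
Qed.

Lemma bil_self v x : isalt v -> bil v x x = 0.
Proof.
move=> av; have e := unaltK av; rewrite -e /bil !mxE !big_ord_recl big_ord0 !mxE.
rewrite !big_ord_recl !big_ord0 !mxE /=; ring.
Qed.

Lemma bil_sum v x y : bil v x y = \sum_a x 0 a * bil v (delta_mx 0 a) y.
Proof.
rewrite /bil {1}(row_sum_delta x) !mulmx_suml summxE; apply: eq_bigr => a _.
by rewrite -!scalemxAl mxE.
Qed.

Lemma cong_entry g v i j : (g^T *m v *m g) i j = bil v (row i g^T) (row j g^T).
Proof. by rewrite /bil -row_mul -mulmx_trE trmxK. Qed.

Lemma isalt_cong g v : isalt v -> isalt (g^T *m v *m g).
Proof.
move=> av; split=> [i j|i]; rewrite !cong_entry; first exact: bil_anti.
exact: bil_self.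
Qed.

Lemma altL2 x g : alt (x *m L2 g) = g^T *m alt x *m g.
Proof. by rewrite mul_rV_lin1 /= unaltK //; apply/isalt_cong/alt_isalt. Qed.

Lemma alt_inj : injective (@alt k).
Proof. exact: can_inj (@altK k). Qed.

Lemma L2M g h : L2 (g *m h) = L2 g *m L2 h.
Proof.
apply/row_matrixP => i; rewrite !rowE; apply: alt_inj.
by rewrite mulmxA !altL2 trmx_mul !mulmxA.
Qed.

Lemma L21 : L2 1%:M = 1%:M.
Proof.
apply/row_matrixP => i; rewrite !rowE; apply: alt_inj.
by rewrite altL2 trmx1 mul1mx !mulmx1.
Qed.

Lemma L2K g : g \in unitmx -> L2 g *m L2 (invmx g) = 1%:M.
Proof. by move=> ug; rewrite -L2M mulmxV // L21. Qed.

Lemma L2_unit g : g \in unitmx -> L2 g \in unitmx.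
Proof. by move/L2K/mulmx1_unit => []. Qed.

Definition Qr v p x1 x2 x3 x4 :=
  bil v x1 x2 * bil p x3 x4 - bil v x1 x3 * bil p x2 x4 + bil v x1 x4 * bil p x2 x3
  + bil v x2 x3 * bil p x1 x4 - bil v x2 x4 * bil p x1 x3 + bil v x3 x4 * bil p x1 x2.

Lemma Qr_sum v p x1 x2 x3 x4 :
  Qr v p x1 x2 x3 x4 = \sum_a x1 0 a * Qr v p (delta_mx 0 a) x2 x3 x4.
Proof.
rewrite /Qr ![bil _ x1 _]bil_sum !mulr_suml !mulr_sumr -!sumrN -!big_split /=.
by apply: eq_bigr => a _; ring.
Qed.

Lemma Qr_delta v p i j l m : Qr v p (delta_mx 0 i) (delta_mx 0 j) (delta_mx 0 l) (delta_mx 0 m)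
  = Qf v p i j l m.
Proof.
have e w a b : bil w (delta_mx 0 a) (delta_mx 0 b) = w a b.
  by rewrite /bil trmx_delta -rowE -colE !mxE.
by rewrite /Qr !e.
Qed.

(** Multilinear expansion on basis vectors, one argument at a time; the transpositions bring each
    argument to the first place, where [Qr_sum] applies. *)
Lemma wz_Qr v p x1 x2 x3 x4 : isalt v -> isalt p -> wz v p -> Qr v p x1 x2 x3 x4 = 0.
Proof.
move=> av ap h.
have s12 y1 y2 y3 y4 : Qr v p y2 y1 y3 y4 = - Qr v p y1 y2 y3 y4.
  by rewrite /Qr (bil_anti y1 y2 av) (bil_anti y1 y2 ap); ring.
have s13 y1 y2 y3 y4 : Qr v p y3 y2 y1 y4 = - Qr v p y1 y2 y3 y4.
  rewrite /Qr (bil_anti y1 y2 av) (bil_anti y1 y2 ap) (bil_anti y1 y3 av) (bil_anti y1 y3 ap).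
  by rewrite (bil_anti y2 y3 av) (bil_anti y2 y3 ap); ring.
have s14 y1 y2 y3 y4 : Qr v p y4 y2 y3 y1 = - Qr v p y1 y2 y3 y4.
  rewrite /Qr (bil_anti y1 y2 av) (bil_anti y1 y2 ap) (bil_anti y1 y3 av) (bil_anti y1 y3 ap).
  rewrite (bil_anti y1 y4 av) (bil_anti y1 y4 ap) (bil_anti y2 y4 av) (bil_anti y2 y4 ap).
  by rewrite (bil_anti y3 y4 av) (bil_anti y3 y4 ap); ring.
rewrite Qr_sum big1 // => a _; rewrite -[Qr _ _ _ _ _ _]opprK -s12.
rewrite Qr_sum big1 ?oppr0 ?mulr0 // => b _; rewrite s12 -[Qr _ _ _ _ _ _]opprK -s13.
rewrite Qr_sum big1 ?oppr0 ?mulr0 // => c _; rewrite s13 -[Qr _ _ _ _ _ _]opprK -s14.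
rewrite Qr_sum big1 ?oppr0 ?mulr0 // => d _; rewrite s14.
by rewrite Qr_delta h !(oppr0, mulr0).
Qed.

Lemma wz_cong x y g : wz (alt x) (alt y) -> wz (alt (x *m L2 g)) (alt (y *m L2 g)).
Proof.
move=> h i j l m; rewrite !altL2 /Qf !cong_entry.
exact: (wz_Qr _ _ _ _ (alt_isalt x) (alt_isalt y) h).
Qed.

Lemma wzm_cong m n (A : 'M[k]_(m, 10)) (P : 'M[k]_(n, 10)) g :
  wzm A P -> wzm (A *m L2 g) (P *m L2 g).
Proof. by move=> h i j; rewrite !row_mul; apply: wz_cong. Qed.

Lemma wzm_mul m n m' n' (A : 'M[k]_(m, 10)) (P : 'M[k]_(n, 10))
    (D : 'M[k]_(m', m)) (D' : 'M[k]_(n', n)) : wzm A P -> wzm (D *m A) (D' *m P).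
Proof.
move=> /wzm_cap h; apply/wzm_cap => l.
by rewrite trmx_mul -!mulmxA (mulmxA A) (mulmxA _ P^T) h mul0mx mulmx0.
Qed.

Lemma qv_wz (x y : 'rV[k]_10) : qv x y = 0 <-> wz (alt x) (alt y).
Proof.
split=> h.
  apply/cap_wz => m; apply/matrixP => i j; rewrite !ord1.
  by have := congr1 (fun M : 'cV_5 => M m 0) h; rewrite !mxE.
by apply/colP => m; rewrite mxE (proj2 (cap_wz x y) h) !mxE.
Qed.

Lemma alt_mul_col x (l : 'cV[k]_5) i : (alt x *m l) i 0 = \sum_(j < 5) an (ent x) i j * l j 0.
Proof. by rewrite mxE; apply: eq_bigr => j _; rewrite mxE. Qed.

(** Proved apart from its polarisation, which at x = y = z gives only three times this. *)
Lemma qv_cubic (x : 'rV[k]_10) : alt x *m qv x x = 0.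
Proof.
apply/colP => i; rewrite alt_mul_col [RHS]mxE.
rewrite !big_ord_recl big_ord0 !qvE /=; case: i => [[|[|[|[|[|//]]]]] ?] /=;
  rewrite /Qn /an /=; ring.
Qed.

(* the full polarisation of [qv_cubic] *)
Lemma qv_trilinear (x y z : 'rV[k]_10) : alt x *m qv y z + alt y *m qv x z + alt z *m qv x y =
  0.
Proof.
apply/colP => i; rewrite [LHS]mxE [X in X + _]mxE !alt_mul_col [RHS]mxE.
rewrite !big_ord_recl !big_ord0 !qvE /=; case: i => [[|[|[|[|[|//]]]]] ?] /=;
  rewrite /Qn /an /=; ring.
Qed.

End Bivectors.

Section Classification.
Variable k : fieldType.
Implicit Types (g h v : 'M[k]_5).

(** * Classification of the pairs (V, P) *)

Definition ext2 (a b : 'rV[k]_5) : 'M[k]_5 := a^T *m b - b^T *m a.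
Definition dl c : 'rV[k]_10 := delta_mx 0 (inord c).
Definition er (i : nat) : 'rV[k]_5 := delta_mx 0 (inord i).
(* the pencil spanned by e_0 /\ e_1 and e_0 /\ e_2 *)
Definition P0 : 'M[k]_(2, 10) := \matrix_(i, j) (i == j :> nat)%:R.

Lemma ext2E a b i j : ext2 a b i j = a 0 i * b 0 j - b 0 i * a 0 j.
Proof. by rewrite !mxE !big_ord1 !mxE. Qed.

Lemma ext2_cong a b g : g^T *m ext2 a b *m g = ext2 (a *m g) (b *m g).
Proof. by rewrite /ext2 !trmx_mul mulmxBr mulmxBl !mulmxA. Qed.

Lemma entD (x y : 'rV[k]_10) c : ent (x + y) c = ent x c + ent y c.
Proof. by rewrite /ent mxE. Qed.

Lemma entZ a (x : 'rV[k]_10) c : ent (a *: x) c = a * ent x c.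
Proof. by rewrite /ent mxE. Qed.

Lemma ent_dl c d : (c < 10)%N -> (d < 10)%N -> ent (dl c) d = (d == c)%:R.
Proof.
move=> hc hd; rewrite /ent /dl mxE eqxx /=; congr (nat_of_bool _)%:R.
by apply/eqP/eqP => [/(congr1 val)|->//]; rewrite /= !inordK.
Qed.

Lemma ext2_isalt a b : isalt (ext2 a b).
Proof. by split=> [i j|i]; rewrite !ext2E; ring. Qed.

Lemma alt_dl (c : 'I_10) : alt (dl c) = ext2 (er (pfst c)) (er (psnd c)).
Proof.
rewrite -[RHS]unaltK; last exact: ext2_isalt.
congr alt; apply/rowP => d; rewrite [RHS]mxE ext2E !mxE !eqxx /=.
have lt5 (e : 'I_10) : (pfst e < 5)%N /\ (psnd e < 5)%N.
  by have /and3P [_ h2 h3] := all10P pidxP e; rewrite (ltn_trans h2 h3).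
have [[c1 c2] [d1 d2]] := (lt5 c, lt5 d).
rewrite -!val_eqE /= !inordK //.
have /all10P /(_ c) /all10P /(_ d) : all (fun c => all (fun d =>
    (((pfst d == pfst c) && (psnd d == psnd c)) == (d == c)) &&
    ~~ ((pfst d == psnd c) && (psnd d == pfst c))) (iota 0 10)) (iota 0 10) by vm_compute.
case/andP => /eqP <-; case: (pfst d == pfst c); case: (psnd d == psnd c);
  case: (pfst d == psnd c); case: (psnd d == pfst c);
  by rewrite //= ?(mulr1, mulr0, mul0r, subr0, subrr).
Qed.

Lemma complete_basis m n r (X : 'M[k]_(m, n)) : row_free X -> (m + r)%N = n ->
  exists Y : 'M[k]_(r, n), row_full (col_mx X Y).
Proof.
move=> fX e; have rk : \rank (X^C)%MS = r by rewrite mxrank_compl (eqP fX) -e addKn.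
have [Y _ eY] := mxrank_basis rk; exists Y.
rewrite -sub1mx -addsmxE (adds_eqmx (eqmx_refl X) eY).
by rewrite sub1mx; apply: addsmx_compl_full.
Qed.

Lemma free2 (a b : 'rV[k]_5) i j : a 0 i = 0 -> a 0 j = 1 -> b 0 i != 0 -> b 0 j = 0 ->
  row_free (col_mx a b).
Proof.
move=> ai aj bi bj; rewrite -kermx_eq0; apply/eqP/row_matrixP => u; rewrite row0.
have : row u (kermx (col_mx a b)) *m col_mx a b = 0 by rewrite -row_mul mulmx_ker row0.
move: (row u _) => w; rewrite -[w]hsubmxK mul_row_col => e.
have ei := congr1 (fun M : 'rV_5 => M 0 i) e; have ej := congr1 (fun M : 'rV_5 => M 0 j) e.
rewrite !mxE !big_ord1 ai aj bj !mulr0 ?add0r ?addr0 mulr1 in ei ej.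
move/eqP: ei; rewrite mulf_eq0 (negPf bi) orbF => /eqP w1.
by apply/rowP => c; rewrite -[c]splitK; case: (split c) => d;
  rewrite ord1 /= ?row_mxEl ?row_mxEr ?ej ?w1 mxE.
Qed.

Lemma alt_ent (x : 'rV[k]_10) i j : alt x i j = an (ent x) i j.
Proof. by rewrite mxE. Qed.

Lemma ent_inj (x y : 'rV[k]_10) : (forall c, (c < 10)%N -> ent x c = ent y c) -> x = y.
Proof. by move=> h; apply/rowP => c; have := h c (ltn_ord c); rewrite /ent inord_val. Qed.

Lemma wz_Qn (x y : 'rV[k]_10) i j l m : wz (alt x) (alt y) ->
  (i < 5)%N -> (j < 5)%N -> (l < 5)%N -> (m < 5)%N -> Qn (ent x) (ent y) i j l m = 0.
Proof.
move=> h hi hj hl hm; have := h (Ordinal hi) (Ordinal hj) (Ordinal hl) (Ordinal hm).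
by rewrite Qf_alt.
Qed.

(** A zero product with e_0 /\ e_1 kills the coordinates of y on the disjoint pairs 23, 24, 34. The
    next two lemmas do the same for 02 and 12. *)
Lemma wz_dl0 (y : 'rV[k]_10) : wz (alt (dl 0)) (alt y) ->
  [/\ ent y 7 = 0, ent y 8 = 0 & ent y 9 = 0].
Proof.
move=> h; have e c : (c < 10)%N -> ent (dl 0) c = (c == 0)%:R by apply: ent_dl.
by split; [rewrite -(@wz_Qn _ _ 0 1 2 3 h) // | rewrite -(@wz_Qn _ _ 0 1 2 4 h) //
  | rewrite -(@wz_Qn _ _ 0 1 3 4 h) //]; rewrite /Qn /an /= !e //=; ring.
Qed.

Lemma wz_dl1 (y : 'rV[k]_10) : wz (alt (dl 1)) (alt y) ->
  [/\ ent y 5 = 0, ent y 6 = 0 & ent y 9 = 0].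
Proof.
move=> h; have e c : (c < 10)%N -> ent (dl 1) c = (c == 1)%:R by apply: ent_dl.
by split; [rewrite -(@wz_Qn _ _ 0 2 1 3 h) // | rewrite -(@wz_Qn _ _ 0 2 1 4 h) //
  | rewrite -(@wz_Qn _ _ 0 2 3 4 h) //]; rewrite /Qn /an /= !e //=; ring.
Qed.

Lemma wz_dl4 (y : 'rV[k]_10) : wz (alt (dl 4)) (alt y) ->
  [/\ ent y 2 = 0, ent y 3 = 0 & ent y 9 = 0].
Proof.
move=> h; have e c : (c < 10)%N -> ent (dl 4) c = (c == 4)%:R by apply: ent_dl.
by split; [rewrite -(@wz_Qn _ _ 1 2 0 3 h) // | rewrite -(@wz_Qn _ _ 1 2 0 4 h) //
  | rewrite -(@wz_Qn _ _ 1 2 3 4 h) //]; rewrite /Qn /an /= !e //=; ring.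
Qed.

Lemma type2_of_rank4 (A : 'M[k]_(3, 10)) (y y' : 'rV[k]_10) : row_free A ->
  (forall i, wz (alt (row i A)) (alt y)) -> (forall i, wz (alt (row i A)) (alt y')) ->
  qv y y != 0 ->
  exists l : 'cV[k]_5, [/\ l != 0, forall i, alt (row i A) *m l = 0,
    alt y *m l = 0 & alt y' *m l = 0].
Proof.
move=> fA wy wy' l0; set l := qv y y in l0 *; set l' := qv y y'.
have Al i : alt (row i A) *m l = 0.
  have := qv_trilinear (row i A) y y.
  by rewrite (proj2 (qv_wz _ _) (wy i)) !mulmx0 !addr0.
have Al' i : alt (row i A) *m l' = 0.
  have := qv_trilinear (row i A) y y'.
  by rewrite (proj2 (qv_wz _ _) (wy i)) (proj2 (qv_wz _ _) (wy' i)) !mulmx0 !addr0.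
have yl : alt y *m l = 0 by exact: qv_cubic.
have y'l : alt y' *m l = - (alt y *m l') - alt y *m l'.
  have symq : qv y' y = l'.
    apply/colP => i; rewrite !qvE /Qn.
    by case: i => [[|[|[|[|[|//]]]]] ?] /=; ring.
  have := qv_trilinear y' y y; rewrite symq -/l -addrA => /eqP; rewrite addr_eq0 => /eqP ->.
  by rewrite opprD.
exists l; split=> //.
(* If l' is a multiple of l, then y kills it and l kills y' too. Otherwise V is killed by two
   independent vectors. *)
have [/sub_rVP [c ec]|nll] := boolP (l'^T <= l^T)%MS.
  by rewrite y'l (_ : l' = c *: l) -?scalemxAr ?yl ?scaler0 ?oppr0 ?addr0 // -[l']trmxK ec
    linearZ /= trmxK.
exfalso.
have fl : row_free (col_mx l^T l'^T).
  rewrite /row_free eqn_leq rank_leq_row /= -addsmxE.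
  have h1 : \rank l^T = 1%N by rewrite rank_rV -(inj_eq trmx_inj) trmxK trmx0 l0.
  have : (\rank l^T < \rank (l^T + l'^T)%MS)%N.
    by apply: rank_ltmx; rewrite ltmxE addsmxSl /= addsmx_sub submx_refl.
  by rewrite h1.
have [Y fY] := complete_basis fl (erefl : 2 + 3 = 5)%N.
(* With l and l' as columns 3 and 4, a bivector killed by both has after [L2 g] no coordinate
   involving the indices 3 and 4. *)
pose g : 'M[k]_5 := (col_mx Y (col_mx l^T l'^T))^T.
have ug : g \in unitmx.
  have fY' : row_full (col_mx Y (col_mx l^T l'^T)).
    by rewrite -sub1mx -addsmxE addsmxC addsmxE sub1mx.
  by rewrite unitmx_tr -row_full_unit.
have gl : col (inord 3) g = l.
  rewrite -[RHS]trmxK -tr_row; congr trmx.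
  have -> : inord 3 = rshift 3 (lshift 1 ord0) :> 'I_(3 + (1 + 1)) by apply/val_inj;
    rewrite /= inordK.
  apply: etrans (rowKd _ _ _) _; apply: etrans (rowKu _ _ _) _; exact: row_id.
have gl' : col (inord 4) g = l'.
  rewrite -[RHS]trmxK -tr_row; congr trmx.
  have -> : inord 4 = rshift 3 (rshift 1 ord0) :> 'I_(3 + (1 + 1)) by apply/val_inj;
    rewrite /= inordK.
  apply: etrans (rowKd _ _ _) _; apply: etrans (rowKd _ _ _) _; exact: row_id.
have colz x : alt x *m l = 0 -> alt x *m l' = 0 -> forall c, (c < 10)%N ->
    (2 < psnd c)%N -> ent (x *m L2 g) c = 0.
  move=> xl xl' c hc h2; have /and3P [/eqP h1 h3 h4] := all10P pidxP (Ordinal hc).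
  have -> : ent (x *m L2 g) c = alt (x *m L2 g) (inord (pfst c)) (inord (psnd c)).
    by rewrite alt_ent !inordK ?(ltn_trans h3) // /an h3 h1.
  rewrite altL2.
  have -> : (g^T *m alt x *m g) (inord (pfst c)) (inord (psnd c)) =
      (g^T *m (alt x *m col (inord (psnd c)) g)) (inord (pfst c)) 0.
    by rewrite colE !mulmxA -colE [RHS]mxE.
  have /orP [/eqP ->|/eqP ->] : (psnd c == 3) || (psnd c == 4).
    by move: h2 h4 => /=; case: (psnd c) => [|[|[|[|[|]]]]].
  - by rewrite gl xl mulmx0 mxE.
  - by rewrite gl' xl' mulmx0 mxE.
pose A' := A *m L2 g.
(* T spans /\^2 of <e_0, e_1, e_2>. It contains the transformed V, and both have dimension 3. *)
pose T : 'M[k]_(3, 10) := \matrix_(i, j) (dl (nth 0%N [:: 0; 1; 4]%N i)) 0 j.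
have A'T : (A' <= T)%MS.
  apply/row_subP => i; rewrite row_mul.
  set x := row i A *m L2 g.
  have -> : x = ent x 0 *: row (inord 0) T + ent x 1 *: row (inord 1) T + ent x 4 *: row
    (inord 2) T.
    apply: ent_inj => c hc; have z := colz (row i A) (Al i) (Al' i) c hc; rewrite -/x in z.
    have er3 j : (j < 3)%N -> row (inord j) T = dl (nth 0%N [:: 0; 1; 4]%N j).
      by move=> hj; apply/rowP => u; rewrite [LHS]mxE [LHS]mxE inordK.
    rewrite !er3 //= !entD !entZ !ent_dl //.
    by case: c hc z => [|[|[|[|[|[|[|[|[|[|//]]]]]]]]]] hc z /=; rewrite ?(z isT) //; ring.
  by rewrite !addmx_sub // scalemx_sub // row_sub.
have TA' : (T <= A')%MS.
  rewrite -(mxrank_leqif_sup A'T); apply/eqP; apply/anti_leq; rewrite mxrankS //=.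
  apply: leq_trans (rank_leq_row _) _; rewrite /A' mxrankMfree ?row_free_unit ?L2_unit //.
  by rewrite (eqP fA).
have wT c : (c < 3)%N -> wz (alt (dl (nth 0%N [:: 0; 1; 4]%N c))) (alt (y *m L2 g)).
  move=> hc; have -> : dl (nth 0%N [:: 0; 1; 4]%N c) = row (inord c) T.
    by apply/rowP => u; rewrite [RHS]mxE [RHS]mxE inordK.
  have /submxP [D ->] : (row (inord c) T <= A')%MS by exact: submx_trans (row_sub _ _) TA'.
  have /(@wzm_mul _ _ _ _ _ _ _ D (1%:M : 'M_1)) : wzm A' (y *m L2 g).
    apply: wzm_cong => i j; rewrite (ord1 j) row_id; exact: wy.
  by move/(_ 0 0); rewrite mul1mx !row_id.
(* Its products with 01, 02 and 12 being zero, y lies in the same /\^2 of a 3-space, so it has rank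
   at most 2, against l being nonzero. *)
have [e7 e8 e9] := wz_dl0 (wT 0%N isT).
have [e5 e6 _] := wz_dl1 (wT 1%N isT).
have [e2 e3 _] := wz_dl4 (wT 2%N isT).
have : qv (y *m L2 g) (y *m L2 g) = 0.
  apply/colP => i; rewrite qvE [RHS]mxE /Qn /an.
  by case: i => [[|[|[|[|[|//]]]]] ?] /=; rewrite ?(e2, e3, e5, e6, e7, e8, e9); ring.
move/qv_wz/(wz_cong (invmx g)); rewrite -!mulmxA L2K // mulmx1 => /qv_wz e.
by rewrite /l e eqxx in l0.
Qed.

End Classification.

Section Classification2.
Variable k : fieldType.
Hypothesis two : (2 : k) != 0.
Implicit Types (g h v : 'M[k]_5) (x y : 'rV[k]_10).

Lemma col2_sub m n (u v : 'rV[k]_n) (C : 'M[k]_(m, n)) :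
  (u <= C)%MS -> (v <= C)%MS -> (col_mx u v <= C)%MS.
Proof. by rewrite col_mx_sub => -> ->. Qed.

(** The Pluecker relations at i, j, l, m, multiplied by 2 v_ij; both factors have to be
    cancelled. *)
Lemma pluecker v i j : wz v v -> v i j != 0 ->
  v = ext2 ((v i j)^-1 *: row i v) (row j v).
Proof.
move=> wv vij; apply/matrixP => l m; rewrite ext2E !mxE.
apply: (mulfI vij); apply: (mulfI two).
have := wv i j l m; rewrite /Qf => e.
by apply/eqP; rewrite -subr_eq0; apply/eqP; rewrite -[RHS]e; field.
Qed.

Lemma pluecker_free v i j : isalt v -> v i j != 0 ->
  row_free (col_mx ((v i j)^-1 *: row i v) (row j v)).
Proof.
move=> [v1 v2] vij; apply: (@free2 _ _ _ i j); rewrite !mxE ?v2 ?mulr0 ?mulVf //.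
by rewrite v1 oppr_eq0.
Qed.

(** A decomposable a /\ b is the image of e_0 /\ e_1 under any invertible matrix whose first rows
    are a and b. *)
Lemma rank2_ext2 y : y != 0 -> wz (alt y) (alt y) ->
  exists2 g, g \in unitmx & y = dl k 0 *m L2 g.
Proof.
move=> y0 wy; have [i [j yij]] : exists i j, alt y i j != 0.
  apply: NNPP => hN; case/eqP: y0; apply: alt_inj; apply/matrixP => i j.
  rewrite linear0 [RHS]mxE; apply: NNPP => /eqP h; apply: hN; by exists i, j.
set v := alt y in wy yij.
pose a := (v i j)^-1 *: row i v; pose b := row j v.
have vE : v = ext2 a b by exact: pluecker.
have fab : row_free (col_mx a b) by apply: pluecker_free => //; exact: alt_isalt.
have [Y fY] := complete_basis fab (erefl : 2 + 3 = 5)%N.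
exists (col_mx (col_mx a b) Y); first by rewrite -row_full_unit.
apply: alt_inj; rewrite -/v altL2 -[0%N]/(val (ord0 : 'I_10)) alt_dl ext2_cong vE /er /=.
congr ext2; rewrite -rowE.
  have -> : inord 0 = lshift 3 (lshift 1 ord0) :> 'I_(1 + 1 + 3) by apply/val_inj;
    rewrite /= inordK.
  by symmetry; apply: etrans (rowKu _ _ _) _; apply: etrans (rowKu _ _ _) _; exact: row_id.
have -> : inord 1 = lshift 3 (rshift 1 ord0) :> 'I_(1 + 1 + 3) by apply/val_inj;
  rewrite /= inordK.
by symmetry; apply: etrans (rowKu _ _ _) _; apply: etrans (rowKd _ _ _) _; exact: row_id.
Qed.

Lemma row_P0 (i : 'I_2) : row i (P0 k) = dl k i.
Proof.
apply/rowP => j; rewrite !mxE eqxx /= -val_eqE /= inordK ?(leq_trans (ltn_ord i)) //.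
by rewrite eq_sym.
Qed.

Lemma P0_L2 h : P0 k *m L2 h = col_mx (dl k 0 *m L2 h) (dl k 1 *m L2 h).
Proof.
apply/row_matrixP => i; rewrite row_mul row_P0; case: i => [[|[|//]]] hi /=.
  have -> : Ordinal hi = lshift 1 ord0 :> 'I_(1 + 1) by apply/val_inj.
  by symmetry; apply: etrans (rowKu _ _ _) _; exact: row_id.
have -> : Ordinal hi = rshift 1 ord0 :> 'I_(1 + 1) by apply/val_inj.
by symmetry; apply: etrans (rowKd _ _ _) _; exact: row_id.
Qed.

(** Two decomposable bivectors with zero product share a factor: the y_0j and y_1j, for j = 2, 3, 4,
    form a 2 by 3 matrix whose minors are Pluecker relations of y, so it has rank at most one. *)
Lemma rank2_pencil y : wz (alt (dl k 0)) (alt y) -> wz (alt y) (alt y) ->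
  ~~ (y <= dl k 0)%MS ->
  exists2 h, h \in unitmx & (P0 k *m L2 h :=: col_mx (dl k 0) y)%MS.
Proof.
move=> w0 wy ny; have [e7 e8 e9] := wz_dl0 w0.
have two' a b c : Qn (ent y) (ent y) 0 1 a b = 2 * c -> (a < 5)%N -> (b < 5)%N -> c = 0.
  move=> e ha hb; apply: (mulfI two); rewrite -e mulr0; exact: wz_Qn.
have e23 : ent y 1 * ent y 5 = ent y 2 * ent y 4.
  apply/eqP; rewrite -subr_eq0 -oppr_eq0; apply/eqP/(two' 2 3)%N => //.
  by rewrite /Qn /an /= e7; ring.
have e24 : ent y 1 * ent y 6 = ent y 3 * ent y 4.
  apply/eqP; rewrite -subr_eq0 -oppr_eq0; apply/eqP/(two' 2 4)%N => //.
  by rewrite /Qn /an /= e8; ring.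
have e34 : ent y 2 * ent y 6 = ent y 3 * ent y 5.
  apply/eqP; rewrite -subr_eq0 -oppr_eq0; apply/eqP/(two' 3 4)%N => //.
  by rewrite /Qn /an /= e9; ring.
(* y = y_01 e_0/\e_1 + (al e_0 + be e_1) /\ w with w in the span of e_2, e_3, e_4 *)
have [al [be [w2 [w3 [w4 [hab hw [y1 y2 y3] [y4 y5 y6]]]]]]] : exists al be w2 w3 w4,
   [/\ (al = 1) \/ (al = 0 /\ be = 1), [|| w2 != 0, w3 != 0 | w4 != 0],
     [/\ ent y 1 = al * w2, ent y 2 = al * w3 & ent y 3 = al * w4] &
     [/\ ent y 4 = be * w2, ent y 5 = be * w3 & ent y 6 = be * w4]].
  have [n1|] := boolP [|| ent y 1 != 0, ent y 2 != 0 | ent y 3 != 0]; last first.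
    rewrite !negb_or !negbK => /and3P [/eqP z1 /eqP z2 /eqP z3].
    exists 0, 1, (ent y 4), (ent y 5), (ent y 6); split;
      [by right| |by rewrite !mul0r|by rewrite !mul1r].
    apply: contraNT ny; rewrite !negb_or !negbK => /and3P [/eqP z4 /eqP z5 /eqP z6].
    apply/sub_rVP; exists (ent y 0); apply: ent_inj => c hc; rewrite entZ ent_dl //.
    by case: c hc => [|[|[|[|[|[|[|[|[|[|//]]]]]]]]]] hc /=;
      rewrite ?(z1, z2, z3, z4, z5, z6, e7, e8, e9) ?mulr1 ?mulr0.
  have [be hbe] : exists be, [/\ ent y 4 = be * ent y 1,
    ent y 5 = be * ent y 2 & ent y 6 = be * ent y 3].
    case/or3P: n1 => n1; [exists (ent y 4 / ent y 1) | exists (ent y 5 / ent y 2) | exists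
      (ent y 6 / ent y 3)].
    - split; apply: (mulfI n1); rewrite ?e23 ?e24; field; exact: n1.
    - split; apply: (mulfI n1); rewrite -?e23 ?e34; field; exact: n1.
    - split; apply: (mulfI n1); rewrite -?e24 -?e34; field; exact: n1.
  exists 1, be, (ent y 1), (ent y 2), (ent y 3); split=> //; [by left | by rewrite !mul1r].
pose tup (s : seq k) : 'rV[k]_5 := \row_i nth 0 s i.
pose a := tup [:: al; be; 0; 0; 0].
(* Chosen so that a /\ b = e_0 /\ e_1 in both normalisations of (al, be). *)
pose b := if al == 0 then tup [:: -1; 0; 0; 0; 0] else tup [:: 0; 1; 0; 0; 0].
pose w := tup [:: 0; 0; w2; w3; w4].
have tupE s i : (i < 5)%N -> tup s 0 (inord i) = nth 0 s i.
  by move=> hi; rewrite mxE inordK.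
have bE : ext2 a b = alt (dl k 0).
  rewrite -[0%N]/(val (ord0 : 'I_10)) alt_dl; apply/matrixP => i j;
    rewrite !ext2E !mxE /= -!val_eqE /= !inordK //.
  case: hab => [al1|[al1 be1]]; rewrite /a /b al1 ?be1 ?oner_eq0 ?eqxx !mxE.
    by case: i => [[|[|[|[|[|//]]]]] ?]; case: j => [[|[|[|[|[|//]]]]] ?] /=; ring.
  by case: i => [[|[|[|[|[|//]]]]] ?]; case: j => [[|[|[|[|[|//]]]]] ?] /=; ring.
have wE : ext2 a w = alt (y - ent y 0 *: dl k 0).
  rewrite -[LHS]unaltK; last exact: ext2_isalt.
  congr alt; apply: ent_inj => c hc;
    rewrite entD -scaleNr entZ ent_dl // /ent mxE ext2E inordK //.
  case: c hc => [|[|[|[|[|[|[|[|[|[|//]]]]]]]]]] hc /=; rewrite /= !tupE //= -/(ent y _);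
   rewrite ?(y1, y2, y3, y4, y5, y6, e7, e8, e9) /=; ring.
have fabw : row_free (col_mx (col_mx a b) w).
  rewrite -kermx_eq0; apply/eqP/row_matrixP => u; rewrite row0.
  have : row u (kermx (col_mx (col_mx a b) w)) *m (col_mx (col_mx a b) w) =
    0 by rewrite -row_mul mulmx_ker row0.
  move: (row u _) => z; rewrite -[z]hsubmxK -[lsubmx z]hsubmxK !mul_row_col => e.
  set z1 := lsubmx (lsubmx z) in e *; set z2 := rsubmx (lsubmx z) in e *;
    set z3 := rsubmx z in e *.
  have ei i : (i < 5)%N -> z1 0 0 * a 0 (inord i) + z2 0 0 * b 0 (inord i) + z3 0 0 * w 0
    (inord i) = 0.
    move=> hi; have := congr1 (fun M : 'rV_5 => M 0 (inord i)) e.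
    by rewrite [LHS]mxE [X in X + _]mxE ![(_ *m _) _ _]mxE !big_ord1 => ->; rewrite mxE.
  have [z1z z2z] : z1 0 0 = 0 /\ z2 0 0 = 0.
    have := ei 1%N isT; have := ei 0%N isT; rewrite /a /b /w.
    case: hab => [al1|[al1 be1]]; rewrite al1 ?be1 ?oner_eq0 ?eqxx !tupE //= !(mulr0, mulr1,
      addr0).
      by move=> ->; rewrite mul0r add0r.
    by rewrite mulrN1 add0r => /eqP; rewrite oppr_eq0 => /eqP -> ->.
  have z3z : z3 0 0 = 0.
    have := ei 4%N isT; have := ei 3%N isT; have := ei 2%N isT.
    rewrite z1z z2z !mul0r !add0r /w !tupE //= => f2 f3 f4.
    by case/or3P: hw => n; apply: (mulIf n); rewrite mul0r.
  have mx0 (Z : 'M[k]_1) : Z 0 0 = 0 -> Z = 0.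
    by move=> h0; apply/matrixP => p q; rewrite !ord1 h0 mxE.
  by rewrite (mx0 z1) // (mx0 z2) // (mx0 z3) // !row_mx0.
have [Y fY] := complete_basis fabw (erefl : 3 + 2 = 5)%N.
pose h : 'M[k]_5 := col_mx (col_mx (col_mx a b) w) Y.
have uh : h \in unitmx by rewrite -row_full_unit.
have h0 : er k 0 *m h = a.
  rewrite /er -rowE.
  have -> : inord 0 = lshift 2 (lshift 1 (lshift 1 ord0)) :> 'I_(1 + 1 + 1 + 2) by
    apply/val_inj; rewrite /= inordK.
  apply: etrans (rowKu _ _ _) _; apply: etrans (rowKu _ _ _) _; apply: etrans (rowKu _ _ _) _;
    exact: row_id.
have h1 : er k 1 *m h = b.
  rewrite /er -rowE.
  have -> : inord 1 = lshift 2 (lshift 1 (rshift 1 ord0)) :> 'I_(1 + 1 + 1 + 2) by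
    apply/val_inj; rewrite /= inordK.
  apply: etrans (rowKu _ _ _) _; apply: etrans (rowKu _ _ _) _; apply: etrans (rowKd _ _ _) _;
    exact: row_id.
have h2 : er k 2 *m h = w.
  rewrite /er -rowE.
  have -> : inord 2 = lshift 2 (rshift (1 + 1) ord0) :> 'I_(1 + 1 + 1 + 2) by apply/val_inj;
    rewrite /= inordK.
  apply: etrans (rowKu _ _ _) _; apply: etrans (rowKd _ _ _) _; exact: row_id.
exists h => //; rewrite P0_L2.
have a0 : alt (dl k 0) = ext2 (er k 0) (er k 1) := @alt_dl k ord0.
have a1 : alt (dl k 1) = ext2 (er k 0) (er k 2) := @alt_dl k (Ordinal (isT : (1 < 10)%N)).
have -> : dl k 0 *m L2 h = dl k 0.
  by apply: alt_inj; rewrite altL2 a0 ext2_cong h0 h1 bE a0.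
have -> : dl k 1 *m L2 h = y - ent y 0 *: dl k 0.
  by apply: alt_inj; rewrite altL2 a1 ext2_cong h0 h2 wE.
have S0 (u v : 'rV[k]_10) : (u <= col_mx u v)%MS by rewrite -addsmxE addsmxSl.
have S1 (u v : 'rV[k]_10) : (v <= col_mx u v)%MS by rewrite -addsmxE addsmxSr.
apply/eqmxP/andP; split; apply: col2_sub; rewrite ?S0 //.
  by rewrite addmx_sub // eqmx_opp scalemx_sub.
rewrite -{1}[y](subrK (ent y 0 *: dl k 0)) addmx_sub // scalemx_sub //.
Qed.

(** Testing y0, y1 and y0 + y1 suffices: if the quadratic map [qv] vanishes at all three, then twice
    y0 /\ y1 is zero and the whole pencil has rank 2. *)
Lemma classification (A : 'M[k]_(3, 10)) (P : 'M[k]_(2, 10)) :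
  row_free A -> row_free P -> wzm A P ->
  (exists l : 'cV[k]_5, [/\ l != 0, forall i, alt (row i A) *m l = 0 & forall j,
    alt (row j P) *m l = 0]) \/
  (exists2 g, g \in unitmx & (P0 k *m L2 g :=: P)%MS).
Proof.
move=> fA fP w; pose y0 := row 0 P; pose y1 := row 1 P.
have wA u i : (u <= P)%MS -> wz (alt (row i A)) (alt u).
  move=> /submxP [D ->]; have := @wzm_mul _ _ _ _ _ _ _ 1%:M D w; rewrite mul1mx => h.
  by have := h i 0; rewrite row_id.
have r4 u u' : (u <= P)%MS -> (u' <= P)%MS -> qv u u != 0 ->
    (forall j : 'I_2, exists c d, row j P = c *: u + d *: u') ->
    exists l : 'cV[k]_5, [/\ l != 0, forall i, alt (row i A) *m l = 0 & forall j,
      alt (row j P) *m l = 0].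
  move=> su su' q sp.
  have [l [l0 h1 h2 h3]] := type2_of_rank4 fA (fun i => wA u i su) (fun i => wA u' i su') q.
  exists l; split=> // j; have [c [d ->]] := sp j.
  by rewrite linearD !linearZ /= mulmxDl -!scalemxAl h2 h3 !scaler0 addr0.
have I2 (Q : 'I_2 -> Prop) : Q 0 -> Q 1 -> forall j, Q j.
  move=> q0 q1 [[|[|//]] hj]; [have -> : Ordinal hj = 0 by apply/val_inj | have ->
    : Ordinal hj = 1 by apply/val_inj]; by [].
have s0 : (y0 <= P)%MS by exact: row_sub.
have s1 : (y1 <= P)%MS by exact: row_sub.
have [q0|q0] := eqVneq (qv y0 y0) 0; last first.
  left; apply: (r4 y0 y1) => //; apply: I2; [exists 1, 0 | exists 0, 1];
    by rewrite scale1r scale0r ?addr0 ?add0r.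
have [q1|q1] := eqVneq (qv y1 y1) 0; last first.
  left; apply: (r4 y1 y0) => //; apply: I2; [exists 0, 1 | exists 1, 0];
    by rewrite scale1r scale0r ?addr0 ?add0r.
have [q2|q2] := eqVneq (qv (y0 + y1) (y0 + y1)) 0; last first.
  left; apply: (r4 (y0 + y1) y0) => //; first exact: addmx_sub.
  apply: I2; [exists 0, 1 | exists 1, (-1)].
    by rewrite scale1r scale0r add0r.
  by rewrite scale1r scaleN1r addrAC subrr add0r.
right.
have w0 := proj1 (qv_wz _ _) q0; have w1 := proj1 (qv_wz _ _) q1.
have w01 : wz (alt y0) (alt y1).
  move=> i j l m; have := proj1 (qv_wz _ _) q2 i j l m; have := w0 i j l m; have := w1 i j l m.
  rewrite linearD /= /Qf; move: (alt y0) (alt y1) => v v' e1 e0; rewrite !mxE => e.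
  apply: (mulfI two); rewrite mulr0 -[RHS]e -[LHS]addr0 -{1}e0 -[LHS]addr0 -{1}e1; ring.
have free01 (c d : k) : c *: y0 + d *: y1 = 0 -> c = 0 /\ d = 0.
  move=> e; have /eqP : (\row_j [:: c; d]`_j : 'rV[k]_2) *m P == 0.
    rewrite mulmx_sum_row big_ord_recl big_ord1 !mxE /=.
    by rewrite (_ : lift ord0 ord0 = 1) ?e //; apply/val_inj.
  move/eqP; rewrite mulmx_free_eq0 // => /eqP /rowP h; have := h 0; have := h 1.
  by rewrite !mxE.
have y0n : y0 != 0.
  apply/eqP => z; have [|/eqP] := free01 1 0; first by rewrite z scaler0 scale0r addr0.
  by rewrite oner_eq0.
have [g ug e0] := rank2_ext2 y0n w0.
pose y := y1 *m L2 (invmx g).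
have ug' : invmx g \in unitmx by rewrite unitmx_inv.
have Lg : L2 (invmx g) *m L2 g = 1%:M by rewrite -L2M mulVmx // L21.
have y1E : y1 = y *m L2 g by rewrite /y -mulmxA Lg mulmx1.
have e0' : y0 *m L2 (invmx g) = dl k 0 by rewrite e0 -mulmxA L2K // mulmx1.
have [|||h uh eh] := @rank2_pencil y.
- by rewrite -e0'; apply: wz_cong.
- exact: wz_cong.
- apply/negP => /sub_rVP [c ec]; have [] := free01 c (-1).
    by rewrite scaleN1r y1E ec -scalemxAl -e0 subrr.
  by move=> _ /eqP; rewrite oppr_eq0 oner_eq0.
exists (h *m g); first by rewrite unitmx_mul uh.
rewrite L2M mulmxA; apply: eqmx_trans (eqmxMr _ eh) _.
rewrite mul_col_mx -e0 -y1E; apply/eqmxP/andP; split.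
  by apply: col2_sub; [exact: s0 | exact: s1].
have S0 : (y0 <= col_mx y0 y1)%MS by rewrite -addsmxE addsmxSl.
have S1 : (y1 <= col_mx y0 y1)%MS by rewrite -addsmxE addsmxSr.
by apply/row_subP; apply: (I2 (fun i => (row i P <= col_mx y0 y1)%MS)).
Qed.

End Classification2.

Lemma line_mul_neq0 (k : closedFieldType) (f g : k -> k) s1 s2 :
  polyfun (@line_gen k) f -> polyfun (@line_gen k) g -> f s1 != 0 -> g s2 != 0 ->
  exists s, f s * g s != 0.
Proof.
move=> pf pg f1 g2; apply: NNPP => hN; case: (line_mul_eq0 pf pg) => [s|h|h].
- by apply/eqP; apply: NNPP => /negP h; apply: hN; exists s.
- by rewrite h eqxx in f1.
- by rewrite h eqxx in g2.
Qed.

(** * Explicit matrices, and moving V with P fixed *)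

Section Selectors.
Variable k : fieldType.

Definition rows10 m (f : nat -> seq k) : 'M[k]_(m, 10) := \matrix_(i, j) nth 0 (f i) j.
Definition selr m (s : seq nat) : 'M[k]_(m, 10) := \matrix_(i, j) (nth 0%N s i == j :> nat)%:R.

Lemma mul_sel m n (A : 'M[k]_(m, 10)) s (i : 'I_m) (j : 'I_n) : (nth 0%N s j < 10)%N ->
  (A *m (selr n s)^T) i j = A i (inord (nth 0%N s j)).
Proof.
move=> hs; rewrite mxE (bigD1 (inord (nth 0%N s j))) //= !mxE inordK // eqxx mulr1.
rewrite big1 ?addr0 // => c /negP hc; rewrite !mxE; case: eqP => [e|_]; last by rewrite mulr0.
by case: hc; apply/eqP/val_inj; rewrite /= inordK.
Qed.

Lemma rowsE m f (i : 'I_m) c : (c < 10)%N -> rows10 m f i (inord c) = nth 0 (f i) c.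
Proof. by move=> hc; rewrite mxE inordK. Qed.

Lemma ent_rows m f (i : 'I_m) c : (c < 10)%N -> ent (row i (rows10 m f)) c = nth 0 (f i) c.
Proof. by move=> hc; rewrite /ent mxE rowsE. Qed.

Lemma sel_orth m n s s' : all (fun c => c < 10)%N s' -> size s' = n ->
  selr m s *m (selr n s')^T = \matrix_(i, j) (nth 0%N s i == nth 0%N s' j)%:R.
Proof.
move=> /allP hs sz; apply/matrixP => i j; have hj : (nth 0%N s' j < 10)%N.
  by apply: hs; apply: mem_nth; rewrite sz.
by rewrite mul_sel // !mxE inordK.
Qed.

Lemma wz_rows m n (f h : nat -> seq k) :
  (forall i j, (i < m)%N -> (j < n)%N -> forall x y, (forall c,
    (c < 10)%N -> ent x c = nth 0 (f i) c) ->
     (forall c, (c < 10)%N -> ent y c = nth 0 (h j) c) -> qv x y = 0) ->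
  wzm (rows10 m f) (rows10 n h).
Proof.
move=> H i j; apply/qv_wz; apply: (H i j) => // c hc; exact: ent_rows.
Qed.

End Selectors.

Lemma polymx_rows (k : fieldType) X (G : (X -> k) -> Prop) m (f : X -> nat -> seq k) :
  (forall i j, (i < m)%N -> (j < 10)%N -> polyfun G (fun x => nth 0 (f x i) j)) ->
  polymx G (fun x => rows10 m (f x)).
Proof. by move=> h i j; apply: (pf_ext _ (h i j _ _)) => // x; rewrite mxE. Qed.

Lemma polyL2 (k : fieldType) X (G : (X -> k) -> Prop) (g : X -> 'M[k]_5) :
  polymx G g -> polymx G (fun x => L2 (g x)).
Proof.
move=> pg i j; pose h x := (g x)^T *m alt (delta_mx 0 i) *m g x.
have ph : polymx G h.
  by apply: pm_mul => //; apply: pm_mul; [apply: pm_tr | apply: pm_cst].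
by apply: (pf_ext _ (ph (inord (pfst j)) (inord (psnd j)))) => x; rewrite !mxE.
Qed.

Section Fill.
Variables (k : closedFieldType) (Z : Hpoint k -> Prop) (n : nat).
Variables (P : 'M[k]_(2, 10)) (Ann : 'M[k]_(n, 10)) (Sa : 'M[k]_(10, 3)) (M1 : 'M[k]_(3, n)).
Hypothesis cZ : Hclosed Z.
Hypothesis fP : row_free P.
Hypothesis wAnn : wzm Ann P.
Hypothesis M1Sa : M1 *m Ann *m Sa = 1%:M.
Hypothesis ZY : forall Y p, Y *m Ann *m Sa = 1%:M -> rep p (Y *m Ann) P -> Z p.

(** V is deformed along the segment from M to M1. Wherever the minor read by Sa is nonzero, V has a
    basis normalised by Sa and [ZY] applies; at s = 1 this minor is 1. *)
Lemma fill_rep p (M : 'M[k]_(3, n)) : rep p (M *m Ann) P -> Z p.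
Proof.
move=> rp; pose M_ s := M + s *: (M1 - M).
have pM : polymx (@line_gen k) M_.
  apply: pm_add; first exact: pm_cst.
  by apply: pm_scale; [apply: pf_gen | apply: pm_cst].
have pA : polymx (@line_gen k) (fun s => M_ s *m Ann) by apply: pm_mul => //; apply: pm_cst.
apply: (@curve_rep k Z (fun s => M_ s *m Ann) (fun=> P) (fun s => \det (M_ s *m Ann *m Sa)) 0
  1) => //.
- exact: pm_cst.
- by apply: pf_det; apply: pm_mul => //; apply: pm_cst.
- by rewrite /M_ scale1r addrC subrK M1Sa det1 oner_eq0.
- move=> s ds; have us : M_ s *m Ann *m Sa \in unitmx by rewrite unitmxE unitfE.
  have fA : row_free (M_ s *m Ann).
    by apply/row_freeP; exists (Sa *m invmx (M_ s *m Ann *m Sa)); rewrite mulmxA mulmxV.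
  have w : wzm (M_ s *m Ann) P by rewrite -[P]mul1mx; apply: wzm_mul.
  have [q rq] := rep_exists fA fP w; exists q; split=> //.
  have [V uV VE] : exists2 V, V \in unitmx & V *m (M_ s *m Ann *m Sa) = 1%:M.
    by exists (invmx (M_ s *m Ann *m Sa)); rewrite ?unitmx_inv ?mulVmx.
  apply: (ZY (Y := V *m M_ s)); first by rewrite -!mulmxA (mulmxA (M_ s)).
  by rewrite -mulmxA; apply: rep_change rq _ _ => //; apply: eqmxMfull; rewrite row_full_unit.
- by rewrite /M_ scale0r addr0.
Qed.

End Fill.

Definition co (k : fieldType) n (x : 'rV[k]_n.+1) (i : nat) : k := x 0 (inord i).

Section Chart1Defs.
Variable k : fieldType.

(** * The component of dimension 14 *)

(* [q] lists the coordinates of a = (1, a1, a2, a3, a4), b = (0, 1, 0, b3, b4) and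
   c = (0, 0, 1, c3, c4); the two rows are a /\ b and a /\ c. *)
Definition P1row (q : nat -> k) (i : nat) : seq k :=
  let: (a1, a2, a3, a4) := (q 0, q 1, q 2, q 3)%N in
  let: (b3, b4, c3, c4) := (q 4, q 5, q 6, q 7)%N in
  if i is 0 then [:: 1; 0; b3; b4; - a2; a1 * b3 - a3; a1 * b4 - a4; a2 * b3; a2 * b4;
    a3 * b4 - b3 * a4]
  else [:: 0; 1; c3; c4; a1; a1 * c3; a1 * c4; a2 * c3 - a3; a2 * c4 - a4; a3 * c4 - a4 * c3].

(* a /\ (0, m0, m1, m2, m3) + la (b /\ c), with [la] chosen so that coordinate 12
   equals [m4] *)
Definition ann1 (q : nat -> k) (m0 m1 m2 m3 m4 : k) : seq k :=
  let: (a1, a2, a3, a4) := (q 0, q 1, q 2, q 3)%N in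
  let: (b3, b4, c3, c4) := (q 4, q 5, q 6, q 7)%N in
  let la := m4 - a1 * m1 + a2 * m0 in
  [:: m0; m1; m2; m3; m4; a1 * m2 - a3 * m0 + la * c3; a1 * m3 - a4 * m0 + la * c4;
    a2 * m2 - a3 * m1 - la * b3; a2 * m3 - a4 * m1 - la * b4;
    a3 * m3 - a4 * m2 + la * (b3 * c4 - b4 * c3)].

Lemma ann1_wz q m0 m1 m2 m3 m4 j (x y : 'rV[k]_10) :
  (forall c, (c < 10)%N -> ent x c = nth 0 (ann1 q m0 m1 m2 m3 m4) c) ->
  (forall c, (c < 10)%N -> ent y c = nth 0 (P1row q j) c) -> qv x y = 0.
Proof.
move=> hx hy; apply/colP => i; rewrite qvE [RHS]mxE /Qn /an.
by case: j hy => [|j] hy; case: i => [[|[|[|[|[|//]]]]] ?] /=; rewrite !hx ?hy //=; ring.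
Qed.

(** Coordinates 01 and 02 of y0 and y1 are (1, 0) and (0, 1), so each equation used solves for one
    of the coordinates 13, 14, 23, 24, 34. The annihilator of P thus has dimension 5, with the first
    five coordinates free. *)
Lemma ann1_uniq q (x y0 y1 : 'rV[k]_10) :
  (forall c, (c < 10)%N -> ent y0 c = nth 0 (P1row q 0) c) ->
  (forall c, (c < 10)%N -> ent y1 c = nth 0 (P1row q 1) c) ->
  wz (alt x) (alt y0) -> wz (alt x) (alt y1) ->
  forall c, (c < 10)%N ->
    ent x c = nth 0 (ann1 q (ent x 0) (ent x 1) (ent x 2) (ent x 3) (ent x 4)) c.
Proof.
move=> h0 h1 w0 w1.
have e7 := @wz_Qn _ _ _ 0 1 2 3 w0 isT isT isT isT.
have e5 := @wz_Qn _ _ _ 0 1 2 3 w1 isT isT isT isT.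
have e8 := @wz_Qn _ _ _ 0 1 2 4 w0 isT isT isT isT.
have e6 := @wz_Qn _ _ _ 0 1 2 4 w1 isT isT isT isT.
have e9 := @wz_Qn _ _ _ 0 1 3 4 w0 isT isT isT isT.
rewrite /Qn /an /= !h0 //= in e7 e8 e9; rewrite /Qn /an /= !h1 //= in e5 e6.
have N (a b c : k) : a = 0 -> b - c = - a -> b = c.
  by move=> -> /eqP; rewrite oppr0 subr_eq0 => /eqP.
have D (a b c : k) : a = 0 -> b - c = a -> b = c.
  by move=> -> /eqP; rewrite subr_eq0 => /eqP.
have f5 : ent x 5 = nth 0 (ann1 q (ent x 0) (ent x 1) (ent x 2) (ent x 3) (ent x 4)) 5.
  by apply: N e5 _ => /=; ring.
have f6 : ent x 6 = nth 0 (ann1 q (ent x 0) (ent x 1) (ent x 2) (ent x 3) (ent x 4)) 6.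
  by apply: N e6 _ => /=; ring.
have f7 : ent x 7 = nth 0 (ann1 q (ent x 0) (ent x 1) (ent x 2) (ent x 3) (ent x 4)) 7.
  by apply: D e7 _ => /=; ring.
have f8 : ent x 8 = nth 0 (ann1 q (ent x 0) (ent x 1) (ent x 2) (ent x 3) (ent x 4)) 8.
  by apply: D e8 _ => /=; ring.
have f9 : ent x 9 = nth 0 (ann1 q (ent x 0) (ent x 1) (ent x 2) (ent x 3) (ent x 4)) 9.
  by apply: D e9 _; rewrite f5 f6 /=; ring.
by case=> [|[|[|[|[|[|[|[|[|[|//]]]]]]]]]].
Qed.

Definition P1mx (x : 'rV[k]_14) : 'M[k]_(2, 10) := rows10 2 (P1row (co x)).

Definition Ann1 (x : 'rV[k]_14) : 'M[k]_(5, 10) :=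
  rows10 5 (fun i => ann1 (co x) (i == 0)%:R (i == 1)%:R (i == 2)%:R (i == 3)%:R (i == 4)%:R).

Definition A1row (x : 'rV[k]_14) (i : nat) : seq k :=
  match i with
  | 0 => ann1 (co x) (co x 8) (co x 9) 1 0 0
  | 1 => ann1 (co x) (co x 10) (co x 11) 0 1 0
  | _ => ann1 (co x) (co x 12) (co x 13) 0 0 1
  end.

Definition A1mx (x : 'rV[k]_14) : 'M[k]_(3, 10) := rows10 3 (A1row x).

Lemma A1_wz x : wzm (A1mx x) (P1mx x).
Proof.
apply: wz_rows => i j _ _ u v hu hv.
by case: i hu => [|[|i]] hu; apply: ann1_wz hu hv.
Qed.

Lemma Ann1_wz x : wzm (Ann1 x) (P1mx x).
Proof. by apply: wz_rows => i j _ _ u v hu hv; apply: ann1_wz hu hv. Qed.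

Lemma Ann1_mul m (M : 'M[k]_(m, 5)) x i c : (c < 10)%N ->
  (M *m Ann1 x) i (inord c) =
  nth 0 (ann1 (co x) (M i (inord 0)) (M i (inord 1)) (M i (inord 2)) (M i (inord 3)) (M i
    (inord 4))) c.
Proof.
move=> hc; rewrite mxE.
transitivity (\sum_(j < 5) M i (inord (val j)) * nth 0 (ann1 (co x) (val j == 0)%:R
    (val j == 1)%:R (val j == 2)%:R (val j == 3)%:R (val j == 4)%:R) c).
  by apply: eq_bigr => j _; rewrite rowsE // inord_val.
rewrite !big_ord_recl big_ord0 /= /bump /=.
by case: c hc => [|[|[|[|[|[|[|[|[|[|//]]]]]]]]]] hc /=; ring.
Qed.

Lemma wz_Ann1 m (A : 'M[k]_(m, 10)) x : wzm A (P1mx x) ->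
  A = (\matrix_(i < m, j < 5) A i (inord j)) *m Ann1 x.
Proof.
move=> w; apply/matrixP => i c; rewrite -[c]inord_val Ann1_mul // !mxE !inordK //.
have h0 d : (d < 10)%N -> ent (row 0 (P1mx x)) d = nth 0 (P1row (co x) 0) d by exact: ent_rows.
have h1 d : (d < 10)%N -> ent (row 1 (P1mx x)) d = nth 0 (P1row (co x) 1) d by exact: ent_rows.
by have := ann1_uniq h0 h1 (w i 0) (w i 1) (ltn_ord c); rewrite /ent !mxE inord_val.
Qed.

End Chart1Defs.

Section SelectorSplit.
Variable k : fieldType.

Lemma sel_gram n s : uniq s -> size s = n ->
  (selr k n s)^T *m selr k n s = \matrix_(c, d) ((c == d) && (val c \in s))%:R.
Proof.
move=> us sz; apply/matrixP => c d; rewrite !mxE.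
have [cs|cs] := boolP (val c \in s); last first.
  rewrite andbF big1 // => i _; rewrite !mxE; case: eqP => [e|_]; last by rewrite mul0r.
  by case/negP: cs; rewrite /= -e mem_nth // sz.
have hi : (index (val c) s < n)%N by rewrite -sz index_mem.
rewrite (bigD1 (Ordinal hi)) //= !mxE /= nth_index // eqxx mul1r big1 ?addr0 ?andbT //.
move=> i ni; rewrite !mxE; case: eqP => [e|_]; last by rewrite mul0r.
case/eqP: ni; apply/val_inj => /=; by rewrite -e index_uniq // sz.
Qed.

Lemma sel_gram1 n m s s' : uniq s -> uniq s' -> size s = n -> size s' = m ->
  all (fun c => (c \in s) (+) (c \in s')) (iota 0 10) ->
  (selr k n s)^T *m selr k n s + (selr k m s')^T *m selr k m s' = 1%:M.
Proof.
move=> u u' z z' h; rewrite !sel_gram //; apply/matrixP => c d; rewrite !mxE.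
have := all10P h c => /=; case: (val c \in s); case: (val c \in s');
  rewrite ?andbT ?andbF //= ?addr0 ?add0r //.
Qed.

Lemma sel_orth1 n s : uniq s -> all (fun c => c < 10)%N s -> size s = n ->
  selr k n s *m (selr k n s)^T = 1%:M.
Proof.
move=> us al sz; rewrite sel_orth //; apply/matrixP => i j; rewrite !mxE.
by rewrite nth_uniq ?sz.
Qed.

Lemma sel_orth0 n m s s' : all (fun c => c < 10)%N s' -> size s = n -> size s' = m ->
  all (fun c => c \notin s') s ->
  selr k n s *m (selr k m s')^T = 0.
Proof.
move=> al sz sz' /allP h; rewrite sel_orth //; apply/matrixP => i j; rewrite !mxE.
case: eqP => // e; have := h (nth 0%N s i); rewrite mem_nth ?sz // => /(_ isT).
by rewrite e mem_nth // sz'.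
Qed.

End SelectorSplit.

Lemma pf_co (k : fieldType) n i : polyfun (@aff_gen k n.+1) (fun x => co x i).
Proof. by apply: pf_gen; exists (inord i). Qed.

Ltac poly_tac := repeat first [apply: pf_co | apply: pf_cst | apply: pf_opp | apply: pf_add |
  apply: pf_mul].

Section Chart1.
Variable k : closedFieldType.

Let Sa : 'M[k]_(10, 3) := (selr k 3 [:: 2; 3; 4]%N)^T.
Let Sp : 'M[k]_(10, 2) := (selr k 2 [:: 0; 1]%N)^T.
Let J : 'M[k]_(8, 10) := selr k 8 [:: 2; 3; 4; 5; 6; 7; 8; 9]%N.

Lemma A1_poly : polymx (@aff_gen k 14) (@A1mx k).
Proof.
apply: polymx_rows => i j hi hj.
case: i hi => [|[|[|//]]] _; case: j hj => [|[|[|[|[|[|[|[|[|[|//]]]]]]]]]] _ /=; poly_tac.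
Qed.

Lemma P1_poly : polymx (@aff_gen k 14) (@P1mx k).
Proof.
apply: polymx_rows => i j hi hj.
case: i hi => [|[|//]] _; case: j hj => [|[|[|[|[|[|[|[|[|[|//]]]]]]]]]] _ /=; poly_tac.
Qed.

Lemma A1_Sa x : A1mx x *m Sa = 1%:M :> 'M[k]_3.
Proof.
apply/matrixP => i j; rewrite mul_sel; last by case: j => [[|[|[|//]]] ?].
rewrite rowsE ?mxE; last by case: j => [[|[|[|//]]] ?].
by case: i => [[|[|[|//]]] ?]; case: j => [[|[|[|//]]] ?].
Qed.

Lemma P1_Sp x : P1mx x *m Sp = 1%:M :> 'M[k]_2.
Proof.
apply/matrixP => i j; rewrite mul_sel; last by case: j => [[|[|//]] ?].
rewrite rowsE ?mxE; last by case: j => [[|[|//]] ?].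
by case: i => [[|[|//]] ?]; case: j => [[|[|//]] ?].
Qed.

Definition C1 : Hpoint k -> Prop := chart_set (@A1mx k) (@P1mx k) Sp J.

Lemma JJ1 : J *m J^T = 1%:M. Proof. exact: sel_orth1. Qed.
Lemma JSp1 : J *m Sp = 0. Proof. exact: sel_orth0. Qed.
Lemma SpJ1 : Sp *m Sp^T + J^T *m J = 1%:M.
Proof. by rewrite trmxK; apply: sel_gram1. Qed.

Lemma C1_irreducible : Hirreducible C1.
Proof. exact: (chart_irreducible A1_poly P1_poly A1_Sa P1_Sp JJ1 JSp1 (@A1_wz k)). Qed.

Lemma C1_in p x : rep p (A1mx x) (P1mx x) -> C1 p.
Proof. exact: (chart_in P1_Sp JJ1 JSp1). Qed.

Lemma C1_dim : Hdim C1 14.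
Proof.
apply: (chart_dim A1_poly P1_poly A1_Sa P1_Sp JJ1 JSp1 SpJ1 (@A1_wz k)) => i.
have z (x : 'rV[k]_14) : (forall j : 'I_14, (i < j)%N -> x 0 j = 0) ->
    forall n, (i < n)%N -> (n < 14)%N -> co x n = 0.
  by move=> h n i1 n1; apply: h; rewrite inordK.
have xi (x : 'rV[k]_14) : x 0 i = co x i by rewrite /co inord_val.
pose o3 (n : nat) : 'I_3 := inord n; pose o2 (n : nat) : 'I_2 := inord n.
have P0c x c : (c < 10)%N -> P1mx x (o2 0%N) (inord c) = nth 0 (P1row (co x) 0) c.
  by move=> hc; rewrite rowsE // /o2 inordK.
have P1c x c : (c < 10)%N -> P1mx x (o2 1%N) (inord c) = nth 0 (P1row (co x) 1) c.
  by move=> hc; rewrite rowsE // /o2 inordK.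
have Ac x r c : (r < 3)%N -> (c < 10)%N -> A1mx x (o3 r) (inord c) = nth 0 (A1row x r) c.
  by move=> hr hc; rewrite rowsE // /o3 inordK.
have n1 : -1 != 0 :> k by rewrite oppr_eq0 oner_eq0.
have n0 := oner_neq0 k.
(* Parameters 0 to 7 are read off P and 8 to 13 off V. For a3 and a4 the entry also contains a
   product, which vanishes because c3 and c4 come later. *)
case: i z xi => [[|[|[|[|[|[|[|[|[|[|[|[|[|[|//]]]]]]]]]]]]]] hi] z xi.
- exists 1, (o3 0%N), (inord 4); split=> //; right; exists (o2 1%N) => x hx.
  by rewrite xi P1c //= mul1r.
- exists (-1), (o3 0%N), (inord 4); split=> //; right; exists (o2 0%N) => x hx.
  by rewrite xi P0c //= mulN1r.
- exists (-1), (o3 0%N), (inord 7); split=> //; right; exists (o2 1%N) => x hx.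
  by rewrite xi P1c //= (z x hx 6%N) // mulr0 sub0r mulN1r.
- exists (-1), (o3 0%N), (inord 8); split=> //; right; exists (o2 1%N) => x hx.
  by rewrite xi P1c //= (z x hx 7%N) // mulr0 sub0r mulN1r.
- by exists 1, (o3 0%N), (inord 2); split=> //; right; exists (o2 0%N) => x hx;
  rewrite xi P0c //= mul1r.
- by exists 1, (o3 0%N), (inord 3); split=> //; right; exists (o2 0%N) => x hx;
  rewrite xi P0c //= mul1r.
- by exists 1, (o3 0%N), (inord 2); split=> //; right; exists (o2 1%N) => x hx;
  rewrite xi P1c //= mul1r.
- by exists 1, (o3 0%N), (inord 3); split=> //; right; exists (o2 1%N) => x hx;
  rewrite xi P1c //= mul1r.
- by exists 1, (o3 0%N), (inord 0); split=> //; left => x hx; rewrite xi Ac //= mul1r.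
- by exists 1, (o3 0%N), (inord 1); split=> //; left => x hx; rewrite xi Ac //= mul1r.
- by exists 1, (o3 1%N), (inord 0); split=> //; left => x hx; rewrite xi Ac //= mul1r.
- by exists 1, (o3 1%N), (inord 1); split=> //; left => x hx; rewrite xi Ac //= mul1r.
- by exists 1, (o3 2%N), (inord 0); split=> //; left => x hx; rewrite xi Ac //= mul1r.
- by exists 1, (o3 2%N), (inord 1); split=> //; left => x hx; rewrite xi Ac //= mul1r.
Qed.

(** V is any 3-space in the 5-dimensional annihilator of P; [fill_rep] reduces to the case where
    coordinates 03, 04, 12 form its pivots. *)
Lemma C1_rep_chart p (A : 'M[k]_(3, 10)) x : wzm A (P1mx x) -> rep p A (P1mx x) -> C1 p.
Proof.
move=> w; rewrite (wz_Ann1 w); set M := \matrix_(i, j) _ => rp.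
have fP : row_free (P1mx x) by apply/row_freeP; exists Sp; apply: P1_Sp.
have selE (Y : 'M[k]_(3, 5)) (i j : 'I_3) : (Y *m Ann1 x *m Sa) i j = Y i (inord (j + 2)%N).
  rewrite mul_sel; last by case: j => [[|[|[|//]]] ?].
  rewrite Ann1_mul; last by case: j => [[|[|[|//]]] ?].
  by case: j => [[|[|[|//]]] ?].
apply: (@fill_rep k C1 5 (P1mx x) (Ann1 x) Sa (\matrix_(i < 3,
  j < 5) (j == (i + 2)%N :> nat)%:R) _ _ _ _ _ p M) => //.
- exact: (proj1 C1_irreducible).
- exact: Ann1_wz.
- apply/matrixP => i j; rewrite selE !mxE inordK; first by rewrite eqn_add2r eq_sym.
  by rewrite -[5%N]/(3 + 2)%N ltn_add2r.
move=> Y q hY rq.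
(* P keeps its eight parameters; the six others are the free columns 0 and 1 of Y, two for each
   row. *)
pose y : 'rV[k]_14 := \row_i (if (i < 8)%N then x 0 i else
   Y (inord ((i - 8) %/ 2)%N) (inord ((i - 8) %% 2)%N)).
have cy i : (i < 8)%N -> co y i = co x i.
  by move=> hi; rewrite /co mxE inordK ?hi // (leq_trans hi).
have Py : P1mx y = P1mx x.
  apply/matrixP => i j; rewrite !mxE /P1row !cy //.
have Ay : A1mx y = Y *m Ann1 x.
  have YI (i j : 'I_3) : Y i (inord (j + 2)%N) = (i == j :> nat)%:R.
    by rewrite -selE hY mxE.
  apply/matrixP => i c; rewrite -[c]inord_val Ann1_mul // rowsE //.
  have cY (r e : nat) : (r < 3)%N -> (e < 2)%N ->
    co y (8 + (r * 2 + e))%N = Y (inord r) (inord e).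
    move=> hr he; rewrite /co mxE inordK; last by lia.
    rewrite ltnNge leq_addr /= addKn divnMDl // (divn_small he) addn0.
    by rewrite modnMDl modn_small.
  have annE m0 m1 m2 m3 m4 : ann1 (co y) m0 m1 m2 m3 m4 = ann1 (co x) m0 m1 m2 m3 m4.
    by rewrite /ann1 !cy.
  have := YI i ord0; have := YI i (Ordinal (isT : (1 < 3)%N));
    have := YI i (Ordinal (isT : (2 < 3)%N)).
  rewrite /= => y4 y3 y2; rewrite y2 y3 y4 /A1row.
  have -> : i = inord (val i) by rewrite inord_val.
  case: i {y2 y3 y4} => [[|[|[|//]]] hi] /=.
  - have := cY 0%N 0%N isT isT; have := cY 0%N 1%N isT isT; rewrite /= => <- <-.
    by rewrite inordK //= annE.
  - have := cY 1%N 0%N isT isT; have := cY 1%N 1%N isT isT; rewrite /= => <- <-.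
    by rewrite inordK //= annE.
  - have := cY 2%N 0%N isT isT; have := cY 2%N 1%N isT isT; rewrite /= => <- <-.
    by rewrite inordK //= annE.
by apply: (@C1_in q y); rewrite Py Ay.
Qed.

End Chart1.

Lemma rep_row_free (k : fieldType) (p : Hpoint k) A P : rep p A P -> row_free A /\ row_free P.
Proof.
move=> [B [fP fB _ [[fA _] _]]]; split=> //.
by move: fA; rewrite /row_free mxrankMfree ?E2mx_free.
Qed.

Lemma wzm_eq (k : fieldType) m n m' n' (A : 'M[k]_(m, 10)) (P : 'M[k]_(n, 10))
    (A' : 'M[k]_(m', 10)) (P' : 'M[k]_(n', 10)) :
  (A' <= A)%MS -> (P' <= P)%MS -> wzm A P -> wzm A' P'.
Proof. by move=> /submxP [D ->] /submxP [D' ->]; apply: wzm_mul. Qed.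

Section Frame.
Variable k : closedFieldType.

Lemma alt_P1mx (x : 'rV[k]_14) (a b c : 'rV[k]_5) :
  (forall j, a 0 j = nth 0 [:: 1; co x 0; co x 1; co x 2; co x 3] j) ->
  (forall j, b 0 j = nth 0 [:: 0; 1; 0; co x 4; co x 5] j) ->
  (forall j, c 0 j = nth 0 [:: 0; 0; 1; co x 6; co x 7] j) ->
  alt (row 0 (P1mx x)) = ext2 a b /\ alt (row 1 (P1mx x)) = ext2 a c.
Proof.
move=> ha hb hc.
have h0 d : (d < 10)%N -> ent (row 0 (P1mx x)) d = nth 0 (P1row (co x) 0) d by exact: ent_rows.
have h1 d : (d < 10)%N -> ent (row 1 (P1mx x)) d = nth 0 (P1row (co x) 1) d by exact: ent_rows.
split; apply/matrixP => i j; rewrite alt_ent ext2E ha ?hb ?hc ?ha /an.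
  case: i => [[|[|[|[|[|//]]]]] ?]; case: j => [[|[|[|[|[|//]]]]] ?] /=; rewrite ?h0 //=; ring.
case: i => [[|[|[|[|[|//]]]]] ?]; case: j => [[|[|[|[|[|//]]]]] ?] /=; rewrite ?h1 //=; ring.
Qed.

Definition lead3 (g : 'M[k]_5) : 'M[k]_3 := \matrix_(i, j) g (inord i) (inord j).

(** The moved pencil depends only on the line of row 0 of g and on the span of rows 0, 1, 2. The
    first is scaled to start with 1 and the second put in reduced echelon form. *)
Lemma frame_chart (g : 'M[k]_5) : g \in unitmx -> g (inord 0) (inord 0) != 0 ->
  lead3 g \in unitmx -> exists x, (P0 k *m L2 g :=: P1mx x)%MS.
Proof.
move=> ug g00 uD; set D := lead3 g in uD.
pose R : 'M[k]_(3, 5) := \matrix_(i, j) g (inord i) j.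
pose F := invmx D *m R.
have RDF : R = D *m F by rewrite /F mulKVmx.
have FI i (j : 'I_3) : F i (inord j) = (i == j)%:R.
  have := congr1 (fun M : 'M_3 => M i j) (mulVmx uD); rewrite !mxE => <-.
  by apply: eq_bigr => l _; rewrite !mxE.
(* Only the eight parameters of P are listed; the last six default to 0, as [P1mx] does not read
   them. *)
pose z : 'rV[k]_14 := \row_i nth 0 [:: R 0 (inord 1) / R 0 (inord 0);
  R 0 (inord 2) / R 0 (inord 0);
   R 0 (inord 3) / R 0 (inord 0); R 0 (inord 4) / R 0 (inord 0);
   F 1 (inord 3); F 1 (inord 4); F 2 (inord 3); F 2 (inord 4)] i.
have cz i : (i < 14)%N -> co z i = nth 0 [:: R 0 (inord 1) / R 0 (inord 0);
  R 0 (inord 2) / R 0 (inord 0);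
   R 0 (inord 3) / R 0 (inord 0); R 0 (inord 4) / R 0 (inord 0);
   F 1 (inord 3); F 1 (inord 4); F 2 (inord 3); F 2 (inord 4)] i.
  by move=> hi; rewrite /co mxE inordK.
have r00 : R 0 (inord 0) != 0 by rewrite mxE.
pose a := (R 0 (inord 0))^-1 *: row 0 R.
pose b := row 1 F; pose c := row 2 F.
have F0 (j : 'I_5) (n : nat) : val j = n -> j = inord n by move=> <-; rewrite inord_val.
have o3 i (n : nat) : (n < 3)%N -> F i (inord n) = (i == inord n)%:R.
  by move=> hn; have := FI i (inord n); rewrite inordK.
have in12 : ((1 : 'I_3) == inord 1) * ((2 : 'I_3) == inord 2) *
   ((1 : 'I_3) == inord 0 = false) * ((1 : 'I_3) == inord 2 = false) *
   ((2 : 'I_3) == inord 0 = false) * ((2 : 'I_3) == inord 1 = false).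
  by rewrite -!val_eqE /= !inordK.
have [ab ac] : alt (row 0 (P1mx z)) = ext2 a b /\ alt (row 1 (P1mx z)) = ext2 a c.
  apply: alt_P1mx => j; rewrite /a /b /c mxE.
  - rewrite [X in _ * X]mxE mulrC.
    by case: j => [[|[|[|[|[|//]]]]] hj] /=; rewrite (F0 (Ordinal hj) _ erefl) ?cz //= divff.
  - by case: j => [[|[|[|[|[|//]]]]] hj] /=;
    rewrite (F0 (Ordinal hj) _ erefl) ?cz //= o3 // in12.
  - by case: j => [[|[|[|[|[|//]]]]] hj] /=;
    rewrite (F0 (Ordinal hj) _ erefl) ?cz //= o3 // in12.
have rowR i : row i R = D i 0 *: row 0 F + D i 1 *: b + D i 2 *: c.
  have rD j : row i D 0 j = D i j by rewrite [LHS]mxE.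
  have e1 : lift ord0 ord0 = 1 :> 'I_3 by apply/val_inj.
  have e2 : lift ord0 (lift ord0 ord0) = 2 :> 'I_3 by apply/val_inj.
  by rewrite {1}RDF row_mul mulmx_sum_row !big_ord_recl big_ord0 addr0 addrA !rD e1 e2.
have er_row (i : nat) : (i < 3)%N -> er k i *m g = row (inord i) R.
  by move=> hi; rewrite -rowE; apply/rowP => j; rewrite !mxE inordK.
have extE i : ext2 (row 0 R) (row i R) =
  (R 0 (inord 0) * (D i 1 - D i 0 * a 0 (inord 1))) *: ext2 a b
    + (R 0 (inord 0) * (D i 2 - D i 0 * a 0 (inord 2))) *: ext2 a c.
  have e0 : row 0 R = R 0 (inord 0) *: a by rewrite /a scalerA divff // scale1r.
  have d0 : R 0 (inord 0) = D 0 0 by rewrite !mxE.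
  have a1 : a 0 (inord 1) * D 0 0 = D 0 1 by rewrite !mxE mulrC mulVKf // -?d0 //;
    congr (g _ _).
  have a2 : a 0 (inord 2) * D 0 0 = D 0 2 by rewrite !mxE mulrC mulVKf // -?d0 //;
    congr (g _ _).
  (* a lies in the row space of F, whose leading 3 by 3 block is the identity, and a starts with
     1. *)
  have f0 : row 0 F = a - a 0 (inord 1) *: b - a 0 (inord 2) *: c.
    apply: (@scalerI _ _ (D 0 0)); first by rewrite -d0.
    rewrite !scalerBr (scalerA _ _ b) (scalerA _ _ c) ![D 0 0 * _]mulrC a1 a2 -{2}d0 -e0 rowR;
      apply/eqP.
    by rewrite eq_sym subr_eq subr_eq -addrA [X in _ + X]addrC addrA.
  rewrite e0 rowR f0; clearbody a b c; clear -k;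
    move: (R 0 (inord 0)) (D i 0) (D i 1) (D i 2) (a 0 (inord 1)) (a 0 (inord 2)).
  move=> r d1 d2 d3 u1 u2; apply/matrixP => p q.
  rewrite ext2E [RHS]mxE [X in _ = X + _]mxE [X in _ = _ + X]mxE !ext2E !mxE; ring.
have fP : row_free (P0 k *m L2 g).
  rewrite /row_free mxrankMfree ?row_free_unit ?L2_unit //; apply/row_freeP.
  exists (P0 k)^T; apply/matrixP => i j; rewrite mxE (bigD1 (inord i)) //= !mxE.
  rewrite inordK ?(leq_trans (ltn_ord i)) // eqxx mul1r big1 ?addr0; first by rewrite eq_sym.
  move=> c' hc; rewrite !mxE; case: eqP => [e|_]; last by rewrite mul0r.
  by case/eqP: hc; apply/val_inj; rewrite /= inordK ?(leq_trans (ltn_ord i)).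
have fz : row_free (P1mx z) by apply/row_freeP; exists (selr k 2 [:: 0; 1]%N)^T; apply: P1_Sp.
exists z; have sub : (P0 k *m L2 g <= P1mx z)%MS.
  have rowi (i : nat) (c' : nat) : (i < 3)%N -> alt (dl k c') = ext2 (er k 0) (er k i) ->
      (dl k c' *m L2 g <= P1mx z)%MS.
    move=> hi ha; suff -> : dl k c' *m L2 g =
       (R 0 (inord 0) * (D (inord i) 1 - D (inord i) 0 * a 0 (inord 1))) *: row 0 (P1mx z)
      + (R 0 (inord 0) * (D (inord i) 2 - D (inord i) 0 * a 0 (inord 2))) *: row 1 (P1mx z).
      by rewrite addmx_sub // scalemx_sub // row_sub.
    apply: alt_inj; rewrite altL2 ha ext2_cong !er_row // linearD !linearZ /= ab ac -extE.
    by congr (ext2 (row _ _) _); apply/val_inj; rewrite /= inordK.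
  rewrite P0_L2; apply: col2_sub; [apply: (rowi 1%N) | apply: (rowi 2%N)] => //.
    exact: (@alt_dl k ord0).
  exact: (@alt_dl k (Ordinal (isT : (1 < 10)%N))).
by apply/eqmxP; rewrite -(mxrank_leqif_eq sub) (eqP fP) (eqP fz).
Qed.

End Frame.

Section C1Frame.
Variable k : closedFieldType.

(** The frame moves along the segment from g to the identity and V is carried along by [L2]. The
    chart conditions hold at the identity, hence outside the zeros of a nonzero polynomial. *)
Lemma C1_rep_frame p (A : 'M[k]_(3, 10)) g : g \in unitmx ->
  wzm A (P0 k *m L2 g) -> rep p A (P0 k *m L2 g) -> C1 p.
Proof.
move=> ug w rp; have [fA fP] := rep_row_free rp.
pose G s := g + s *: (1%:M - g).
have pG : polymx (@line_gen k) G.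
  apply: pm_add; first exact: pm_cst.
  by apply: pm_scale; [apply: pf_gen | apply: pm_cst].
have G0 : G 0 = g by rewrite /G scale0r addr0.
have G1 : G 1 = 1%:M by rewrite /G scale1r addrC subrK.
pose d s := \det (G s) * (G s (inord 0) (inord 0) * \det (lead3 (G s))).
have LL : L2 (invmx g) *m L2 g = 1%:M by rewrite -L2M mulVmx // L21.
apply: (@curve_rep k (@C1 k) (fun s => A *m L2 (invmx g) *m L2 (G s)) (fun s => P0 k *m L2 (G
  s)) d 0 1 p).
- exact: (proj1 (@C1_irreducible k)).
- apply: pm_mul; [exact: pm_cst | exact: polyL2].
- apply: pm_mul; [exact: pm_cst | exact: polyL2].
- apply: pf_mul; first exact: pf_det.
  apply: pf_mul; first exact: pG.
  by apply: pf_det => i j; apply: (pf_ext _ (pG (inord i) (inord j))) => s; rewrite [RHS]mxE.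
- rewrite /d G1 det1 mul1r !mxE eqxx mul1r (_ : lead3 1%:M = 1%:M) ?det1 ?oner_eq0 //.
  apply/matrixP => i j; rewrite !mxE -!val_eqE /= !inordK //.
    exact: leq_trans (ltn_ord j) _.
  exact: leq_trans (ltn_ord i) _.
- move=> s; rewrite /d !mulf_eq0 !negb_or => /and3P [dG g00 dD].
  have uG : G s \in unitmx by rewrite unitmxE unitfE.
  have uD : lead3 (G s) \in unitmx by rewrite unitmxE unitfE.
  have fA' : row_free (A *m L2 (invmx g) *m L2 (G s)).
    by rewrite /row_free !mxrankMfree ?row_free_unit ?L2_unit ?unitmx_inv.
  have fP' : row_free (P0 k *m L2 (G s)).
    move: fP; rewrite /row_free !mxrankMfree ?row_free_unit ?L2_unit //.
  have w' : wzm (A *m L2 (invmx g) *m L2 (G s)) (P0 k *m L2 (G s)).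
    apply: wzm_cong; have := wzm_cong (invmx g) w.
    by rewrite -(mulmxA (P0 k)) L2K // mulmx1.
  have [q rq] := rep_exists fA' fP' w'; exists q; split=> //.
  have [x ex] := frame_chart uG g00 uD.
  apply: (@C1_rep_chart k q _ x); last exact: rep_change rq (eqmx_refl _) (eqmx_sym ex).
  by apply: wzm_eq w'; rewrite ?submx_refl // ex.
- by rewrite G0 -mulmxA LL mulmx1.
Qed.

End C1Frame.

Section Chart2Defs.
Variable k : fieldType.

(** * The component of dimension 15 *)

(* the bivector killed by (t0, t1, t2, t3, 1) with the given coordinates on
   e_0, ..., e_3 *)
Definition lift2 (t : nat -> k) (v01 v02 v03 v12 v13 v23 : k) : seq k :=
  [:: v01; v02; v03; - (v01 * t 1%N + v02 * t 2%N + v03 * t 3%N); v12; v13;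
    v01 * t 0%N - v12 * t 2%N - v13 * t 3%N; v23; v02 * t 0%N + v12 * t 1%N - v23 * t 3%N;
    v03 * t 0%N + v13 * t 1%N + v23 * t 2%N].

Definition ell (t : nat -> k) : 'cV[k]_5 := \col_i nth 0 [:: t 0%N; t 1%N; t 2%N; t 3%N; 1] i.

Definition wz4 (v01 v02 v03 v12 v13 v23 w01 w02 w03 w12 w13 w23 : k) :=
  v01 * w23 - v02 * w13 + v03 * w12 + v12 * w03 - v13 * w02 + v23 * w01.

(** Both bivectors lie in /\^2 of a hyperplane, whose /\^4 is a line; so their product is fixed up
    to a factor, which is the wedge pairing on /\^2 of a 4-space. *)
Lemma lift2_wz t v01 v02 v03 v12 v13 v23 w01 w02 w03 w12 w13 w23 (x y : 'rV[k]_10) :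
  (forall c, (c < 10)%N -> ent x c = nth 0 (lift2 t v01 v02 v03 v12 v13 v23) c) ->
  (forall c, (c < 10)%N -> ent y c = nth 0 (lift2 t w01 w02 w03 w12 w13 w23) c) ->
  qv x y = wz4 v01 v02 v03 v12 v13 v23 w01 w02 w03 w12 w13 w23 *: ell t.
Proof.
move=> hx hy; apply/colP => i; rewrite qvE !mxE /Qn /an /wz4.
by case: i => [[|[|[|[|[|//]]]]] ?] /=; rewrite !hx ?hy //=; ring.
Qed.

Lemma killed_lift t (x : 'rV[k]_10) : alt x *m ell t = 0 -> forall c, (c < 10)%N ->
  ent x c = nth 0 (lift2 t (ent x 0) (ent x 1) (ent x 2) (ent x 4) (ent x 5) (ent x 7)) c.
Proof.
move=> h.
have E (i : 'I_5) : \sum_(j < 5) an (ent x) i j * nth 0 [:: t 0%N; t 1%N; t 2%N; t 3%N;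
  1] j = 0.
  have := congr1 (fun M : 'cV_5 => M i 0) h; rewrite alt_mul_col [RHS]mxE => e.
  by rewrite -[RHS]e; apply: eq_bigr => j _; rewrite mxE.
have e0 := E (Ordinal (isT : (0 < 5)%N)); have e1 := E (Ordinal (isT : (1 < 5)%N)).
have e2 := E (Ordinal (isT : (2 < 5)%N)); have e3 := E (Ordinal (isT : (3 < 5)%N)).
rewrite !big_ord_recl big_ord0 /an /= /bump /= in e0 e1 e2 e3.
have D (a b c : k) : a = 0 -> b - c = a -> b = c.
  by move=> -> /eqP; rewrite subr_eq0 => /eqP.
case=> [|[|[|[|[|[|[|[|[|[|//]]]]]]]]]] _ //=.
- by apply: D e0 _; ring.
- by apply: D e1 _; ring.
- by apply: D e2 _; ring.
- by apply: D e3 _; ring.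
Qed.

Lemma lift_killed t v01 v02 v03 v12 v13 v23 (x : 'rV[k]_10) :
  (forall c, (c < 10)%N -> ent x c = nth 0 (lift2 t v01 v02 v03 v12 v13 v23) c) ->
  alt x *m ell t = 0.
Proof.
move=> hx; apply/colP => i; rewrite alt_mul_col [RHS]mxE.
transitivity (\sum_(j < 5) an (ent x) i j * nth 0 [:: t 0%N; t 1%N; t 2%N; t 3%N; 1] j).
  by apply: eq_bigr => j _; rewrite mxE.
rewrite !big_ord_recl big_ord0 /an.
by case: i => [[|[|[|[|[|//]]]]] ?] /=; rewrite /bump /= !hx //=; ring.
Qed.

Definition Lift (t : nat -> k) : 'M[k]_(6, 10) :=
  rows10 6 (fun i => lift2 t (i == 0)%:R (i == 1)%:R (i == 2)%:R (i == 3)%:R (i == 4)%:R (i ==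
    5)%:R).

Lemma Lift_mul m (M : 'M[k]_(m, 6)) t i c : (c < 10)%N ->
  (M *m Lift t) i (inord c) = nth 0 (lift2 t (M i (inord 0)) (M i (inord 1)) (M i (inord 2))
     (M i (inord 3)) (M i (inord 4)) (M i (inord 5))) c.
Proof.
move=> hc; rewrite mxE.
transitivity (\sum_(j < 6) M i (inord (val j)) * nth 0 (lift2 t (val j == 0)%:R
    (val j == 1)%:R (val j == 2)%:R (val j == 3)%:R (val j == 4)%:R (val j == 5)%:R) c).
  by apply: eq_bigr => j _; rewrite rowsE // inord_val.
rewrite !big_ord_recl big_ord0 /= /bump /=.
by case: c hc => [|[|[|[|[|[|[|[|[|[|//]]]]]]]]]] hc /=; ring.
Qed.

(** The pairs inside {0, 1, 2, 3}, on which a bivector killed by [ell t] may be prescribed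
    freely. *)
Definition low6 : seq nat := [:: 0; 1; 2; 4; 5; 7]%N.

Lemma killed_Lift m (A : 'M[k]_(m, 10)) t : (forall i, alt (row i A) *m ell t = 0) ->
  A = (A *m (selr k 6 low6)^T) *m Lift t.
Proof.
move=> h; apply/matrixP => i c; rewrite -[c]inord_val Lift_mul // !mul_sel !inordK //=.
by have := killed_lift (h i) (ltn_ord c); rewrite /ent !mxE.
Qed.

Lemma Lift_killed m (M : 'M[k]_(m, 6)) t i : alt (row i (M *m Lift t)) *m ell t = 0.
Proof.
apply: lift_killed => c hc; rewrite /ent mxE; exact: Lift_mul.
Qed.

Lemma Lift_sel t : Lift t *m (selr k 6 low6)^T = 1%:M.
Proof.
apply/matrixP => i j; rewrite mul_sel; last by case: j => [[|[|[|[|[|[|//]]]]]] ?].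
rewrite rowsE ?mxE -?val_eqE; last by case: j => [[|[|[|[|[|[|//]]]]]] ?].
by case: j => [[|[|[|[|[|[|//]]]]]] ?].
Qed.

(* Gram matrix of the wedge pairing on /\^2 of a 4-space, basis 01, 02, 03, 12, 13, 23 *)
Definition Q6 : 'M[k]_6 := \matrix_(i, j)
  (if (i + j == 5)%N then (if (i == 1%N :> nat) || (i == 4%N :> nat) then -1 else 1) else 0).

Lemma Q6E m n (A : 'M[k]_(m, 6)) (P : 'M[k]_(n, 6)) i j : (A *m Q6 *m P^T) i j =
  wz4 (A i (inord 0)) (A i (inord 1)) (A i (inord 2)) (A i (inord 3)) (A i (inord 4)) (A i
    (inord 5))
   (P j (inord 0)) (P j (inord 1)) (P j (inord 2)) (P j (inord 3)) (P j (inord 4)) (P j (inord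
     5)).
Proof.
rewrite mxE.
transitivity (\sum_(c < 6) (\sum_(d < 6) A i (inord (val d)) * Q6 d c) * P j (inord (val c))).
  apply: eq_bigr => c _; rewrite !mxE inord_val; congr (_ * _); apply: eq_bigr => d _.
  by rewrite inord_val.
rewrite !big_ord_recl !big_ord0 /= !mxE /= /bump /= /wz4; ring.
Qed.

Lemma Q6_sym : Q6^T = Q6.
Proof.
apply/matrixP => i j; rewrite !mxE addnC; case: eqP => // e.
by move: e; case: i => [[|[|[|[|[|[|//]]]]]] ?]; case: j => [[|[|[|[|[|[|//]]]]]] ?].
Qed.

Lemma Q6_unit : Q6 \in unitmx.
Proof.
suff /mulmx1_unit [] : Q6 *m Q6 = 1%:M by [].
apply/matrixP => i j; rewrite !mxE.
case: i => [[|[|[|[|[|[|//]]]]]] ?]; case: j => [[|[|[|[|[|[|//]]]]]] ?];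
 by rewrite !big_ord_recl big_ord0 !mxE /=; ring.
Qed.

Lemma ell_neq0 t : ell t != 0.
Proof.
apply/eqP => /colP /(_ (Ordinal (isT : (4 < 5)%N))) /eqP; rewrite !mxE /=.
by rewrite oner_eq0.
Qed.

Lemma wzm_Lift m n (A : 'M[k]_(m, 6)) (P : 'M[k]_(n, 6)) t :
  wzm (A *m Lift t) (P *m Lift t) <-> A *m Q6 *m P^T = 0.
Proof.
have E i j : qv (row i (A *m Lift t)) (row j (P *m Lift t)) = (A *m Q6 *m P^T) i j *: ell t.
  rewrite Q6E; apply: lift2_wz => c hc; rewrite /ent mxE; exact: Lift_mul.
split=> [h|h i j].
  apply/matrixP => i j; have := proj2 (qv_wz _ _) (h i j); rewrite E => /eqP.
  by rewrite scaler_eq0 (negPf (ell_neq0 t)) orbF => /eqP ->; rewrite mxE.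
by apply/qv_wz; rewrite E h mxE scale0r.
Qed.

(** The pivots 01 and 23 are dual under the wedge pairing, so v /\ P = 0 can be solved without
    denominators. *)
Definition P2row (q : nat -> k) (i : nat) : seq k :=
  if i is 0 then lift2 q 1 (q 4%N) (q 5%N) (q 6%N) (q 7%N) 0
  else lift2 q 0 (q 8%N) (q 9%N) (q 10%N) (q 11%N) 1.

(* coordinates 23 and 01 are solved from v /\ P = 0 *)
Definition ann2 (q : nat -> k) (m1 m2 m3 m4 : k) : seq k :=
  lift2 q (m1 * q 11%N - m2 * q 10%N - m3 * q 9%N + m4 * q 8%N) m1 m2 m3 m4
    (m1 * q 7%N - m2 * q 6%N - m3 * q 5%N + m4 * q 4%N).

Definition P2mx (x : 'rV[k]_15) : 'M[k]_(2, 10) := rows10 2 (P2row (co x)).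

Definition Ann2 (x : 'rV[k]_15) : 'M[k]_(4, 10) :=
  rows10 4 (fun i => ann2 (co x) (i == 0)%:R (i == 1)%:R (i == 2)%:R (i == 3)%:R).

Definition A2row (x : 'rV[k]_15) (i : nat) : seq k :=
  match i with
  | 0 => ann2 (co x) 1 0 0 (co x 12)
  | 1 => ann2 (co x) 0 1 0 (co x 13)
  | _ => ann2 (co x) 0 0 1 (co x 14)
  end.

Definition A2mx (x : 'rV[k]_15) : 'M[k]_(3, 10) := rows10 3 (A2row x).

Lemma ann2_wz q m1 m2 m3 m4 j (x y : 'rV[k]_10) :
  (forall c, (c < 10)%N -> ent x c = nth 0 (ann2 q m1 m2 m3 m4) c) ->
  (forall c, (c < 10)%N -> ent y c = nth 0 (P2row q j) c) -> qv x y = 0.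
Proof.
move=> hx hy; case: j hy => [|j] hy;
  rewrite (lift2_wz hx hy) (_ : wz4 _ _ _ _ _ _ _ _ _ _ _ _ = 0) ?scale0r //;
  by rewrite /wz4; ring.
Qed.

Lemma A2_wz x : wzm (A2mx x) (P2mx x).
Proof.
apply: wz_rows => i j _ _ u v hu hv.
by case: i hu => [|[|i]] hu; apply: ann2_wz hu hv.
Qed.

Lemma Ann2_wz x : wzm (Ann2 x) (P2mx x).
Proof. by apply: wz_rows => i j _ _ u v hu hv; apply: ann2_wz hu hv. Qed.

Lemma Ann2_mul m (M : 'M[k]_(m, 4)) x i c : (c < 10)%N ->
  (M *m Ann2 x) i (inord c) =
  nth 0 (ann2 (co x) (M i (inord 0)) (M i (inord 1)) (M i (inord 2)) (M i (inord 3))) c.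
Proof.
move=> hc; rewrite mxE.
transitivity (\sum_(j < 4) M i (inord (val j)) * nth 0 (ann2 (co x) (val j == 0)%:R
    (val j == 1)%:R (val j == 2)%:R (val j == 3)%:R) c).
  by apply: eq_bigr => j _; rewrite rowsE // inord_val.
rewrite !big_ord_recl big_ord0 /= /bump /=.
by case: c hc => [|[|[|[|[|[|[|[|[|[|//]]]]]]]]]] hc /=; ring.
Qed.

Lemma wz_Ann2 m (A : 'M[k]_(m, 10)) x : (forall i, alt (row i A) *m ell (co x) = 0) ->
  wzm A (P2mx x) ->
  A = (\matrix_(i < m, j < 4) A i (inord (nth 0 [:: 1; 2; 4; 5] j)%N)) *m Ann2 x.
Proof.
move=> kA w; apply/matrixP => i c; rewrite -[c]inord_val Ann2_mul // !mxE !inordK //=.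
have hx := killed_lift (kA i).
have h0 d : (d < 10)%N -> ent (row 0 (P2mx x)) d = nth 0 (P2row (co x) 0) d by exact: ent_rows.
have h1 d : (d < 10)%N -> ent (row 1 (P2mx x)) d = nth 0 (P2row (co x) 1) d by exact: ent_rows.
have e0 := proj2 (qv_wz _ _) (w i 0); have e1 := proj2 (qv_wz _ _) (w i 1).
rewrite (lift2_wz hx h0) in e0; rewrite (lift2_wz hx h1) in e1.
move/eqP: e0; move/eqP: e1; rewrite !scaler_eq0 !(negPf (ell_neq0 _)) !orbF.
move=> /eqP e1 /eqP e0; rewrite /wz4 in e0 e1.
have D (a b e : k) : a = 0 -> b - e = a -> b = e.
  by move=> -> /eqP; rewrite subr_eq0 => /eqP.
set r := row i A in hx e0 e1.
have E d : A i (inord d) = ent r d by rewrite /r /ent mxE.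
have f7 : ent r 7 = ent r 1 * co x 7 - ent r 2 * co x 6 - ent r 4 * co x 5 + ent r 5 * co x 4.
  by apply: D e0 _; ring.
have f0 : ent r 0 = ent r 1 * co x 11 - ent r 2 * co x 10 - ent r 4 * co x 9 + ent r 5 * co x 8.
  by apply: D e1 _; ring.
by rewrite !E /ann2 -f7 -f0; apply: hx.
Qed.

End Chart2Defs.

Section Chart2.
Variable k : closedFieldType.

Let Sa : 'M[k]_(10, 3) := (selr k 3 [:: 1; 2; 4]%N)^T.
Let Sp : 'M[k]_(10, 2) := (selr k 2 [:: 0; 7]%N)^T.
Let J : 'M[k]_(8, 10) := selr k 8 [:: 1; 2; 3; 4; 5; 6; 8; 9]%N.

Lemma A2_poly : polymx (@aff_gen k 15) (@A2mx k).
Proof.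
apply: polymx_rows => i j hi hj.
case: i hi => [|[|[|//]]] _; case: j hj => [|[|[|[|[|[|[|[|[|[|//]]]]]]]]]] _ /=; poly_tac.
Qed.

Lemma P2_poly : polymx (@aff_gen k 15) (@P2mx k).
Proof.
apply: polymx_rows => i j hi hj.
case: i hi => [|[|//]] _; case: j hj => [|[|[|[|[|[|[|[|[|[|//]]]]]]]]]] _ /=; poly_tac.
Qed.

Lemma A2_Sa x : A2mx x *m Sa = 1%:M :> 'M[k]_3.
Proof.
apply/matrixP => i j; rewrite mul_sel; last by case: j => [[|[|[|//]]] ?].
rewrite rowsE ?mxE; last by case: j => [[|[|[|//]]] ?].
by case: i => [[|[|[|//]]] ?]; case: j => [[|[|[|//]]] ?].
Qed.

Lemma P2_Sp x : P2mx x *m Sp = 1%:M :> 'M[k]_2.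
Proof.
apply/matrixP => i j; rewrite mul_sel; last by case: j => [[|[|//]] ?].
rewrite rowsE ?mxE; last by case: j => [[|[|//]] ?].
by case: i => [[|[|//]] ?]; case: j => [[|[|//]] ?].
Qed.

Definition C2 : Hpoint k -> Prop := chart_set (@A2mx k) (@P2mx k) Sp J.

Lemma JJ2 : J *m J^T = 1%:M. Proof. exact: sel_orth1. Qed.
Lemma JSp2 : J *m Sp = 0. Proof. exact: sel_orth0. Qed.
Lemma SpJ2 : Sp *m Sp^T + J^T *m J = 1%:M.
Proof. by rewrite trmxK; apply: sel_gram1. Qed.

Lemma C2_irreducible : Hirreducible C2.
Proof. exact: (chart_irreducible A2_poly P2_poly A2_Sa P2_Sp JJ2 JSp2 (@A2_wz k)). Qed.

Lemma C2_in p x : rep p (A2mx x) (P2mx x) -> C2 p.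
Proof. exact: (chart_in P2_Sp JJ2 JSp2). Qed.

Lemma C2_dim : Hdim C2 15.
Proof.
apply: (chart_dim A2_poly P2_poly A2_Sa P2_Sp JJ2 JSp2 SpJ2 (@A2_wz k)) => i.
have z (x : 'rV[k]_15) : (forall j : 'I_15, (i < j)%N -> x 0 j = 0) ->
    forall n, (i < n)%N -> (n < 15)%N -> co x n = 0.
  by move=> h n i1 n1; apply: h; rewrite inordK.
have xi (x : 'rV[k]_15) : x 0 i = co x i by rewrite /co inord_val.
pose o3 (n : nat) : 'I_3 := inord n; pose o2 (n : nat) : 'I_2 := inord n.
have P0c x c : (c < 10)%N -> P2mx x (o2 0%N) (inord c) = nth 0 (P2row (co x) 0) c.
  by move=> hc; rewrite rowsE // /o2 inordK.
have P1c x c : (c < 10)%N -> P2mx x (o2 1%N) (inord c) = nth 0 (P2row (co x) 1) c.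
  by move=> hc; rewrite rowsE // /o2 inordK.
have Ac x r c : (r < 3)%N -> (c < 10)%N -> A2mx x (o3 r) (inord c) = nth 0 (A2row x r) c.
  by move=> hr hc; rewrite rowsE // /o3 inordK.
have n1 : -1 != 0 :> k by rewrite oppr_eq0 oner_eq0.
have n0 := oner_neq0 k.
(* For t0, ..., t3 the chosen entry has t multiplied by a pivot 1, up to sign; its other terms
   contain coordinates 4 to 11, which vanish at this stage. *)
case: i z xi => [[|[|[|[|[|[|[|[|[|[|[|[|[|[|[|//]]]]]]]]]]]]]]] hi] z xi.
- exists 1, (o3 0%N), (inord 6); split=> //; right; exists (o2 0%N) => x hx.
  by rewrite xi P0c //= (z x hx 6%N) // (z x hx 7%N) //; ring.
- exists (-1), (o3 0%N), (inord 3); split=> //; right; exists (o2 0%N) => x hx.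
  by rewrite xi P0c //= (z x hx 4%N) // (z x hx 5%N) //; ring.
- exists 1, (o3 0%N), (inord 9); split=> //; right; exists (o2 1%N) => x hx.
  by rewrite xi P1c //= (z x hx 9%N) // (z x hx 11%N) //; ring.
- exists (-1), (o3 0%N), (inord 8); split=> //; right; exists (o2 1%N) => x hx.
  by rewrite xi P1c //= (z x hx 8%N) // (z x hx 10%N) //; ring.
- by exists 1, (o3 0%N), (inord 1); split=> //; right; exists (o2 0%N) => x hx;
  rewrite xi P0c //= mul1r.
- by exists 1, (o3 0%N), (inord 2); split=> //; right; exists (o2 0%N) => x hx;
  rewrite xi P0c //= mul1r.
- by exists 1, (o3 0%N), (inord 4); split=> //; right; exists (o2 0%N) => x hx;
  rewrite xi P0c //= mul1r.
- by exists 1, (o3 0%N), (inord 5); split=> //; right; exists (o2 0%N) => x hx;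
  rewrite xi P0c //= mul1r.
- by exists 1, (o3 0%N), (inord 1); split=> //; right; exists (o2 1%N) => x hx;
  rewrite xi P1c //= mul1r.
- by exists 1, (o3 0%N), (inord 2); split=> //; right; exists (o2 1%N) => x hx;
  rewrite xi P1c //= mul1r.
- by exists 1, (o3 0%N), (inord 4); split=> //; right; exists (o2 1%N) => x hx;
  rewrite xi P1c //= mul1r.
- by exists 1, (o3 0%N), (inord 5); split=> //; right; exists (o2 1%N) => x hx;
  rewrite xi P1c //= mul1r.
- by exists 1, (o3 0%N), (inord 5); split=> //; left => x hx; rewrite xi Ac //= mul1r.
- by exists 1, (o3 1%N), (inord 5); split=> //; left => x hx; rewrite xi Ac //= mul1r.
- by exists 1, (o3 2%N), (inord 5); split=> //; left => x hx; rewrite xi Ac //= mul1r.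
Qed.

Lemma C2_rep_chart p (A : 'M[k]_(3, 10)) x : (forall i, alt (row i A) *m ell (co x) = 0) ->
  wzm A (P2mx x) -> rep p A (P2mx x) -> C2 p.
Proof.
move=> kA w; rewrite (wz_Ann2 kA w); set M := \matrix_(i, j) _ => rp.
have fP : row_free (P2mx x) by apply/row_freeP; exists Sp; apply: P2_Sp.
have selE (Y : 'M[k]_(3, 4)) (i j : 'I_3) : (Y *m Ann2 x *m Sa) i j = Y i (inord j).
  rewrite mul_sel; last by case: j => [[|[|[|//]]] ?].
  rewrite Ann2_mul; last by case: j => [[|[|[|//]]] ?].
  by case: j => [[|[|[|//]]] ?].
apply: (@fill_rep k (@C2) 4 (P2mx x) (Ann2 x) Sa (\matrix_(i < 3,
  j < 4) (j == i :> nat)%:R) _ _ _ _ _ p M) => //.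
- exact: (proj1 C2_irreducible).
- exact: Ann2_wz.
- apply/matrixP => i j; rewrite selE !mxE inordK ?(leq_trans (ltn_ord j)) //.
  by rewrite eq_sym.
move=> Y q hY rq.
pose y : 'rV[k]_15 := \row_i (if (i < 12)%N then x 0 i else Y (inord (i - 12)%N) (inord 3)).
have cy i : (i < 12)%N -> co y i = co x i.
  by move=> hi; rewrite /co mxE inordK ?hi // (leq_trans hi).
have Py : P2mx y = P2mx x.
  by apply/matrixP => i j; rewrite !mxE /P2row /lift2 !cy.
have Ay : A2mx y = Y *m Ann2 x.
  have YI (i j : 'I_3) : Y i (inord j) = (i == j :> nat)%:R by rewrite -selE hY mxE.
  apply/matrixP => i c; rewrite -[c]inord_val Ann2_mul // rowsE //.
  have cY (r : nat) : (r < 3)%N -> co y (12 + r)%N = Y (inord r) (inord 3).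
    move=> hr; rewrite /co mxE inordK; last by rewrite -[15%N]/(12 + 3)%N ltn_add2l.
    by rewrite ltnNge leq_addr /= addKn.
  have annE m0 m1 m2 m3 : ann2 (co y) m0 m1 m2 m3 = ann2 (co x) m0 m1 m2 m3.
    by rewrite /ann2 /lift2 !cy.
  have := YI i ord0; have := YI i (Ordinal (isT : (1 < 3)%N));
    have := YI i (Ordinal (isT : (2 < 3)%N)).
  rewrite /= => y4 y3 y2; rewrite y2 y3 y4 /A2row.
  have -> : i = inord (val i) by rewrite inord_val.
  case: i {y2 y3 y4} => [[|[|[|//]]] hi] /=.
  - by have := cY 0%N isT; rewrite /= => <-; rewrite inordK //= annE.
  - by have := cY 1%N isT; rewrite /= => <-; rewrite inordK //= annE.
  - by have := cY 2%N isT; rewrite /= => <-; rewrite inordK //= annE.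
by apply: (@C2_in q y); rewrite Py Ay.
Qed.

Lemma C2_rep_pivot p t (A : 'M[k]_(3, 10)) (P : 'M[k]_(2, 10)) :
  (forall i, alt (row i A) *m ell t = 0) -> (forall i, alt (row i P) *m ell t = 0) ->
  P *m Sp \in unitmx -> wzm A P -> rep p A P -> C2 p.
Proof.
move=> kA kP uP w rp; pose P' := invmx (P *m Sp) *m P.
have eP' : (P' :=: P)%MS by apply: eqmxMfull; rewrite row_full_unit unitmx_inv.
have P'S : P' *m Sp = 1%:M by rewrite -mulmxA mulVmx.
have kP' i : alt (row i P') *m ell t = 0.
  rewrite row_mul mulmx_sum_row linear_sum mulmx_suml big1 // => j _.
  by rewrite linearZ -scalemxAl /= kP scaler0.
clearbody P'.
pose x : 'rV[k]_15 := \row_i nth 0 [:: t 0%N; t 1%N; t 2%N; t 3%N;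
   P' 0 (inord 1); P' 0 (inord 2); P' 0 (inord 4); P' 0 (inord 5);
   P' 1 (inord 1); P' 1 (inord 2); P' 1 (inord 4); P' 1 (inord 5)] i.
have cx i : (i < 15)%N -> co x i = nth 0 [:: t 0%N; t 1%N; t 2%N; t 3%N;
   P' 0 (inord 1); P' 0 (inord 2); P' 0 (inord 4); P' 0 (inord 5);
   P' 1 (inord 1); P' 1 (inord 2); P' 1 (inord 4); P' 1 (inord 5)] i.
  by move=> hi; rewrite /co mxE inordK.
have ellE : ell (co x) = ell t.
  by apply/colP => i; rewrite !mxE !cx.
have S0 (i : 'I_2) : P' i (inord 0) = (i == 0)%:R.
  by have := congr1 (fun M : 'M_2 => M i 0) P'S; rewrite mul_sel //= => ->; rewrite mxE.
have S7 (i : 'I_2) : P' i (inord 7) = (i == 1)%:R.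
  by have := congr1 (fun M : 'M_2 => M i 1) P'S; rewrite mul_sel //= => ->; rewrite mxE.
have Px : P2mx x = P'.
  apply/matrixP => i c; rewrite -[c]inord_val rowsE //.
  have -> : P' i (inord c) = ent (row i P') c by rewrite /ent mxE.
  rewrite (killed_lift (kP' i) (ltn_ord c)) /ent !mxE S0 S7 /P2row /lift2 !cx //=.
  have -> : i = inord (val i) by rewrite inord_val.
  case: i => [[|[|//]] hi] /=.
    by rewrite (_ : inord 0 = 0) //; apply/val_inj; rewrite /= inordK.
  by rewrite (_ : inord 1 = 1) //; apply/val_inj; rewrite /= inordK.
apply: (@C2_rep_chart p A x); rewrite ?ellE // Px.
  by apply: wzm_eq w; rewrite ?submx_refl ?eP'.
exact: rep_change rp (eqmx_refl _) eP'.
Qed.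

(** P moves inside /\^2 of the hyperplane to the pencil of the two pivots. V follows: it is
    orthogonal to P for [Q6], and [polymx_perp] carries this along the segment. d1 controls the
    pivot minor of P and d2 the rank of V. *)
Lemma C2_rep_ell p t (A : 'M[k]_(3, 10)) (P : 'M[k]_(2, 10)) :
  (forall i, alt (row i A) *m ell t = 0) -> (forall i, alt (row i P) *m ell t = 0) ->
  wzm A P -> rep p A P -> C2 p.
Proof.
move=> kA kP w rp; have [fA fP] := rep_row_free rp.
have eA := killed_Lift kA; have eP := killed_Lift kP.
set A6 := A *m _ in eA; set P6 := P *m _ in eP.
have fL : row_free (Lift t) by apply/row_freeP; exists (selr k 6 low6)^T; apply: Lift_sel.
have fA6 : row_free A6 by move: fA; rewrite {1}eA /row_free mxrankMfree.
have fP6 : row_free P6 by move: fP; rewrite {1}eP /row_free mxrankMfree.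
(* Positions 0 and 5 of the six coordinates are the pairs 01 and 23. *)
pose P1 : 'M[k]_(2, 6) := \matrix_(i, j) (j == (i * 5)%N :> nat)%:R.
pose Ps s := P6 + s *: (P1 - P6).
have pPs : polymx (@line_gen k) Ps.
  apply: pm_add; first exact: pm_cst.
  by apply: pm_scale; [apply: pf_gen | apply: pm_cst].
have Ps0 : Ps 0 = P6 by rewrite /Ps scale0r addr0.
have Ps1 : Ps 1 = P1 by rewrite /Ps scale1r addrC subrK.
have pa : polymx (@line_gen k) (fun s => Ps s *m Q6 k) by apply: pm_mul => //; apply: pm_cst.
have f0 : row_free (Ps 0 *m Q6 k) by rewrite Ps0 /row_free mxrankMfree ?row_free_unit ?Q6_unit.
have K0 : A6 *m (Ps 0 *m Q6 k)^T = 0.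
  by rewrite Ps0 trmx_mul Q6_sym mulmxA; apply/(wzm_Lift _ _ t); rewrite -eA -eP.
have [K [pK KE KP]] := polymx_perp pa f0 K0.
pose d1 s := \det (Ps s *m Lift t *m Sp).
pose d2 s := \det (K s *m pinvmx A6).
have pd1 : polyfun (@line_gen k) d1.
  by apply: pf_det; apply: pm_mul; [apply: pm_mul => //; exact: pm_cst | exact: pm_cst].
have pd2 : polyfun (@line_gen k) d2 by apply: pf_det; apply: pm_mul => //; exact: pm_cst.
have d11 : d1 1 != 0.
  rewrite /d1 Ps1 (_ : _ *m _ = 1%:M) ?det1 ?oner_eq0 //.
  apply/matrixP => i j; rewrite mul_sel; last by case: j => [[|[|//]] ?].
  rewrite Lift_mul; last by case: j => [[|[|//]] ?].
  rewrite !mxE !inordK //.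
  by case: i => [[|[|//]] ?]; case: j => [[|[|//]] ?].
have d20 : d2 0 != 0 by rewrite /d2 KE mulmxVp // det1 oner_eq0.
have [s1 ds1] := line_mul_neq0 pd1 pd2 d11 d20.
apply: (@curve_rep k C2 (fun s => K s *m Lift t) (fun s => Ps s *m Lift t)
   (fun s => d1 s * d2 s) 0 s1 p) => //.
- exact: (proj1 C2_irreducible).
- by apply: pm_mul => //; exact: pm_cst.
- by apply: pm_mul => //; exact: pm_cst.
- exact: pf_mul.
- move=> s; rewrite mulf_eq0 negb_or => /andP [n1 n2].
  have u1 : Ps s *m Lift t *m Sp \in unitmx by rewrite unitmxE unitfE.
  have u2 : K s *m pinvmx A6 \in unitmx by rewrite unitmxE unitfE.
  have fPs : row_free (Ps s *m Lift t).
    by apply/row_freeP; exists (Sp *m invmx (Ps s *m Lift t *m Sp)); rewrite mulmxA mulmxV.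
  have fK : row_free (K s).
    by apply/row_freeP; exists (pinvmx A6 *m invmx (K s *m pinvmx A6)); rewrite mulmxA mulmxV.
  have fA' : row_free (K s *m Lift t) by rewrite /row_free mxrankMfree.
  have w' : wzm (K s *m Lift t) (Ps s *m Lift t).
    by apply/wzm_Lift; rewrite -(KP s) trmx_mul Q6_sym mulmxA.
  have [q rq] := rep_exists fA' fPs w'; exists q; split=> //.
  by apply: (@C2_rep_pivot q t _ _ _ _ u1 w' rq) => i; apply: Lift_killed.
- by rewrite KE Ps0 -eA -eP.
Qed.

(** If the last coordinate of l is nonzero, l is rescaled to some [ell t]. Otherwise the shear 1 + s
    E_4m, with l_m nonzero, replaces l by a vector with last coordinate - s l_m. *)
Lemma C2_rep_killed p (l : 'cV[k]_5) (A : 'M[k]_(3, 10)) (P : 'M[k]_(2, 10)) : l != 0 ->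
  (forall i, alt (row i A) *m l = 0) -> (forall i, alt (row i P) *m l = 0) ->
  wzm A P -> rep p A P -> C2 p.
Proof.
pose o4 : 'I_5 := inord 4.
have main q (l' : 'cV[k]_5) A' P' : l' o4 0 != 0 ->
    (forall i, alt (row i A') *m l' = 0) -> (forall i, alt (row i P') *m l' = 0) ->
    wzm A' P' -> rep q A' P' -> C2 q.
  move=> n4 kA kP; pose t i := l' (inord i) 0 / l' o4 0.
  have e : ell t = (l' o4 0)^-1 *: l'.
    apply/colP => i; rewrite !mxE.
    have -> : l' i 0 = l' (inord (val i)) 0 by rewrite inord_val.
    case: i => [[|[|[|[|[|//]]]]] hi] /=; rewrite /t 1?mulrC //.
    by rewrite divff.
  by apply: (@C2_rep_ell q t A' P') => i; rewrite e -scalemxAr ?kA ?kP scaler0.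
move=> l0 kA kP w rp; have [l4|n4] := eqVneq (l o4 0) 0; last exact: main n4 kA kP w rp.
have [m lm] : exists m, l m 0 != 0.
  apply: NNPP => hN; case/eqP: l0; apply/colP => i; rewrite [RHS]mxE.
  by apply: NNPP => /eqP h; apply: hN; exists i.
have m4 : m != o4 by apply: contraNneq lm => ->; rewrite l4.
have [fA fP] := rep_row_free rp.
pose N : 'M[k]_5 := delta_mx o4 m.
have NN : N *m N = 0 by rewrite mul_delta_mx_0.
pose g s : 'M[k]_5 := 1%:M + s *: N.
have gK s : g s *m (1%:M - s *: N) = 1%:M.
  rewrite mulmxBr mulmx1 mulmxDl mul1mx -scalemxAl -scalemxAr NN !scaler0 addr0.
  by rewrite addrK.
have ug s : g s \in unitmx by have := mulmx1_unit (gK s); case.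
have pg : polymx (@line_gen k) g.
  apply: pm_add; first exact: pm_cst.
  by apply: pm_scale; [apply: pf_gen | apply: pm_cst].
apply: (@curve_rep k C2 (fun s => A *m L2 (g s)) (fun s => P *m L2 (g s)) id 0 1 p) => //.
- exact: (proj1 C2_irreducible).
- apply: pm_mul; [exact: pm_cst | exact: polyL2].
- apply: pm_mul; [exact: pm_cst | exact: polyL2].
- exact: pf_gen.
- exact: oner_neq0.
- move=> s s0; have fA' : row_free (A *m L2 (g s)).
    by rewrite /row_free mxrankMfree ?row_free_unit ?L2_unit.
  have fP' : row_free (P *m L2 (g s)).
    by rewrite /row_free mxrankMfree ?row_free_unit ?L2_unit.
  have w' := wzm_cong (g s) w.
  have [q rq] := rep_exists fA' fP' w'; exists q; split=> //.
  pose l' := (1%:M - s *: N) *m l.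
  have k' n (X : 'M[k]_(n, 10)) i : alt (row i X) *m l = 0 ->
    alt (row i (X *m L2 (g s))) *m l' = 0.
    move=> h; rewrite row_mul altL2 /l' -!mulmxA (mulmxA (g s)) gK mul1mx.
    by rewrite h mulmx0.
  apply: (main q l') w' rq => [|i|i]; [|exact: k' | exact: k'].
  have Nl : (N *m l) o4 0 = l m 0.
    rewrite mxE (bigD1 m) //= big1 ?addr0 => [|c cm]; first by rewrite mxE !eqxx mul1r.
    by rewrite mxE (negPf cm) andbF mul0r.
  have -> : l' o4 0 = - (s * l m 0).
    have E (X Y : 'cV[k]_5) : (X - s *: Y) o4 0 = X o4 0 - s * Y o4 0 by rewrite !mxE.
    by rewrite /l' mulmxBl mul1mx -scalemxAl E Nl l4 sub0r.
  by rewrite oppr_eq0 mulf_neq0.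
- have g0 : g 0 = 1%:M by rewrite /g scale0r addr0.
  by rewrite g0 L21 !mulmx1.
Qed.

End Chart2.

(** * The lexicographic point *)

Section Lex.
Variable k : fieldType.

Lemma lex_gensE : lex_gens k = [:: emon k (bs (pbit 0)); emon k (bs (pbit 1));
  emon k (bs (pbit 2));
  emon k (bs (bneg (pbit 3))); emon k (bs (bneg (pbit 2)))].
Proof.
rewrite /lex_gens /i5; congr [:: emon k _; emon k _; emon k _; emon k _; emon k _];
  apply/setP => i;
  rewrite !inE -!val_eqE /= !inordK //; by case: i => [[|[|[|[|[|//]]]]] ?].
Qed.

Lemma ideal_emon (J : 'M[k]_nE) (G S : {set 'I_5}) : is_ideal J -> G \subset S ->
  (emon k G <= J)%MS -> (emon k S <= J)%MS.
Proof.
move=> idJ GS GJ; have [+ _] := idJ _ (emon k (S :\: G)) GJ.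
have eS : G :|: S :\: G = S by rewrite -{1}(setIidPr GS) setID.
have dS : [disjoint G & S :\: G].
  by rewrite -setI_eq0; apply/eqP/setP => i; rewrite !inE; case: (i \in G).
rewrite wedge_emons eS /wsign dS => h.
rewrite -[emon k S]scale1r -[1](sqrr_sign _ (#|[set p : 'I_5 * 'I_5 | (p.1 \in G) && (p.2 \in
  S :\: G) && (p.2 < p.1)%N]|)).
by rewrite expr2 -scalerA scalemx_sub.
Qed.

Definition lex_bits : seq (seq bool) := [:: pbit 0; pbit 1; pbit 2; bneg (pbit 3);
  bneg (pbit 2)].

Lemma lex_gen_sub (J : 'M[k]_nE) b : is_ideal J -> (forall g,
  g \in lex_gens k -> (g <= J)%MS) ->
  has (fun g => all (fun i => nth false g i ==> nth false b i) (iota 0 5)) lex_bits ->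
  (emon k (bs b) <= J)%MS.
Proof.
move=> idJ gJ /hasP [g hg /allP hb]; apply: (ideal_emon (G := bs g)) => //.
  by apply/subsetP => i; rewrite !inE; apply/implyP/hb; rewrite mem_iota add0n /=.
apply: gJ; rewrite lex_gensE; apply: (map_f (fun b => emon k (bs b)) hg).
Qed.

Lemma lex_big (S : {set 'I_5}) : (3 < #|S|)%N ->
  has (fun g => all (fun i => nth false g i ==> nth false (bits S) i) (iota 0 5)) lex_bits.
Proof.
rewrite -{1}(bsK S) card_bs; have : size (bits S) = 5%N by rewrite size_map size_enum_ord.
by case: (bits S) => [|[] [|[] [|[] [|[] [|[] [|? ?]]]]]].
Qed.

(** V = e_0 /\ <e_1, e_2, e_3>, with [P0] as its P: I_3 contains every cubic monomial except the
    complements of 01 and 02. *)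
Definition Alex : 'M[k]_(3, 10) := selr k 3 [:: 0; 1; 2]%N.
Definition Blex : 'M[k]_(8, 10) := selr k 8 [:: 2; 3; 4; 5; 6; 7; 8; 9]%N.

Lemma row_selr n s (i : 'I_n) m (M : 'M[k]_(10, m)) : (nth 0%N s i < 10)%N ->
  row i (selr k n s *m M) = row (inord (nth 0%N s i)) M.
Proof.
move=> hi; rewrite row_mul [RHS]rowE; congr (_ *m _); apply/rowP => c; rewrite !mxE eqxx /=.
by rewrite -val_eqE /= inordK // eq_sym.
Qed.

Lemma ptmx_lex : is_ideal (ptmx Alex Blex) -> is_lex_ideal (<<ptmx Alex Blex>>%MS : 'M[k]_nE).
Proof.
move=> idI; split; first by move=> x y; rewrite !genmxE; apply: idI.
split=> [g|J idJ gJ].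
  have hA (c : nat) : (c < 3)%N -> (emon k (bs (pbit c)) <= ptmx Alex Blex)%MS.
    move=> hc; apply: submx_trans (ptmx_A _ _).
    have -> : emon k (bs (pbit c)) = row (inord c) (Alex *m E2mx k).
      rewrite row_selr inordK //; last by case: c hc => [|[|[|//]]].
      by rewrite row_E2mx; case: c hc => [|[|[|//]]] _ /=; rewrite inordK.
    exact: row_sub.
  have hB (c : nat) : (c < 8)%N -> (emon k (bs (bneg (pbit (c + 2)))) <= ptmx Alex Blex)%MS.
    move=> hc; apply: submx_trans (ptmx_B _ _).
    have -> : emon k (bs (bneg (pbit (c + 2)))) =
      sg3 k (c + 2) *: row (inord c) (Blex *m E3mx k).
      rewrite row_selr inordK //; last by case: c hc => [|[|[|[|[|[|[|[|//]]]]]]]].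
      rewrite row_E3mx (_ : nat_of_ord (inord _) = (c + 2)%N); last first.
        by case: c hc => [|[|[|[|[|[|[|[|//]]]]]]]] _ /=; rewrite inordK.
      by rewrite scalerA sg3_sqr scale1r.
    by apply: scalemx_sub; exact: row_sub.
  rewrite lex_gensE genmxE !inE => /or4P [/eqP ->|/eqP ->|/eqP ->|/orP [/eqP ->|/eqP ->]];
    by [apply: hA | exact: (hB 1%N) | exact: (hB 0%N)].
rewrite genmxE /ptmx !addsmx_sub -andbA; apply/and4P; split.
- apply/row_subP => i; rewrite row_selr; last by case: i => [[|[|[|//]]] ?].
  rewrite row_E2mx; apply: lex_gen_sub => //.
  by case: i => [[|[|[|//]]] ?] /=; rewrite inordK.
- apply/row_subP => i; rewrite row_selr; last by case: i => [[|[|[|[|[|[|[|[|//]]]]]]]] ?].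
  rewrite row_E3mx; apply: scalemx_sub; apply: lex_gen_sub => //.
  by case: i => [[|[|[|[|[|[|[|[|//]]]]]]]] ?] /=; rewrite inordK.
- rewrite -[Edeg k 4]mulmx1; apply: mul_big_sub => // S hS; rewrite mulmx1 -(bsK S).
  by apply: lex_gen_sub => //; apply: lex_big; rewrite hS.
- rewrite -[Edeg k 5]mulmx1; apply: mul_big_sub => // S hS; rewrite mulmx1 -(bsK S).
  by apply: lex_gen_sub => //; apply: lex_big; rewrite hS.
Qed.

Lemma wzm_unit_rows n s m s' : size s = n -> size s' = m ->
  (forall c d, c \in s -> d \in s' -> forall x y : 'rV[k]_10, (forall e,
    (e < 10)%N -> ent x e = (c == e)%:R) ->
     (forall e, (e < 10)%N -> ent y e = (d == e)%:R) -> qv x y = 0) ->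
  wzm (selr k n s) (selr k m s').
Proof.
move=> sz sz' h i j; apply/qv_wz; apply: (h (nth 0%N s i) (nth 0%N s' j)).
- by rewrite mem_nth // sz.
- by rewrite mem_nth // sz'.
- by move=> e he; rewrite /ent !mxE inordK.
- by move=> e he; rewrite /ent !mxE inordK.
Qed.

Lemma P0E : P0 k = selr k 2 [:: 0; 1]%N.
Proof. by apply/matrixP => i j; rewrite !mxE; case: i => [[|[|//]] ?]. Qed.

Lemma wz_lex : wzm Alex (P0 k).
Proof.
rewrite P0E; apply: wzm_unit_rows => // c d; rewrite !inE.
move=> hc hd x y hx hy; apply/colP => i; rewrite qvE [RHS]mxE /Qn /an.
case: i => [[|[|[|[|[|//]]]]] ?] /=; rewrite !hx ?hy //;
  case/or3P: hc => /eqP ->; case/orP: hd => /eqP -> /=; ring.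
Qed.

Lemma wz_gen1 : wzm (selr k 3 [:: 2; 3; 4]%N) (P0 k).
Proof.
rewrite P0E; apply: wzm_unit_rows => // c d; rewrite !inE.
move=> hc hd x y hx hy; apply/colP => i; rewrite qvE [RHS]mxE /Qn /an.
case: i => [[|[|[|[|[|//]]]]] ?] /=; rewrite !hx ?hy //;
  case/or3P: hc => /eqP ->; case/orP: hd => /eqP -> /=; ring.
Qed.

Lemma selr_free n s : uniq s -> all (fun c => c < 10)%N s -> size s = n ->
  row_free (selr k n s).
Proof. by move=> u al sz; apply/row_freeP; exists (selr k n s)^T; apply: sel_orth1. Qed.

End Lex.

(** * The 14-dimensional component is not inside the other *)

Section Separation.
Variable k : closedFieldType.

(* Five rows of the matrices of V: dependent on C2, where they all kill [ell], but a
   signed permutation matrix for V = <e_0 /\ e_3, e_0 /\ e_4, e_1 /\ e_2>. *)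
Definition sepmx (A : 'M[k]_(3, 10)) : 'M[k]_5 :=
  \matrix_(i, j) alt (row (inord (nth 0 [:: 0; 0; 1; 2; 2] i)%N) A)
    (inord (nth 0 [:: 0; 3; 0; 1; 2] i)%N) j.

Lemma C1_not_sub_C2 : ~ subs (@C1 k) (@C2 k).
Proof.
move=> sub; pose A : 'M[k]_(3, 10) := selr k 3 [:: 2; 3; 4]%N.
have fA : row_free A by exact: selr_free.
have fP : row_free (P0 k) by rewrite P0E; exact: selr_free.
have [p rp] := rep_exists fA fP (@wz_gen1 k).
have C1p : C1 p.
  by apply: (@C1_rep_frame k p A 1%:M); rewrite ?unitmx1 // L21 mulmx1 //; exact: wz_gen1.
have AS : A *m A^T = 1%:M by exact: sel_orth1.
have kA x i : alt (row i (A2mx x)) *m ell (co x) = 0.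
  have h c : (c < 10)%N -> ent (row i (A2mx x)) c = nth 0 (A2row x i) c by exact: ent_rows.
  by case: i h => [[|[|[|//]]] hi] /= h; exact: (lift_killed h).
have pg : polyfun (fun f => exists i j, f = fun A : 'M[k]_(3,
  10) => A i j) (fun A => \det (sepmx A)).
  apply: pf_det => i j; pose r : 'I_3 := inord (nth 0%N [:: 0; 0; 1; 2; 2]%N i).
  pose l : 'I_5 := inord (nth 0%N [:: 0; 3; 0; 1; 2]%N i).
  apply: (@pf_ext _ _ _ (fun A : 'M[k]_(3, 10) => if (l < j)%N then A r (inord (pidx l j))
    else if (j < l)%N then - A r (inord (pidx j l)) else 0)) => [M|].
    by rewrite [RHS]mxE alt_ent /an /ent !mxE.
  case: (l < j)%N; first by apply: pf_gen; exists r, (inord (pidx l j)).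
  case: (j < l)%N; last exact: pf_cst.
  by apply: pf_opp; apply: pf_gen; exists r, (inord (pidx j l)).
have hg x u : u *m A2mx x *m A^T = 1%:M -> \det (sepmx (u *m A2mx x)) = 0.
  move=> _; apply/eqP; rewrite -[_ == 0]negbK -unitfE -unitmxE; apply/negP => us.
  have e0 : sepmx (u *m A2mx x) *m ell (co x) = 0.
    apply/colP => i; rewrite [RHS]mxE.
    pose r : 'I_3 := inord (nth 0%N [:: 0; 0; 1; 2; 2]%N i).
    pose l : 'I_5 := inord (nth 0%N [:: 0; 3; 0; 1; 2]%N i).
    have <- : (alt (row r (u *m A2mx x)) *m ell (co x)) l 0 = 0.
      rewrite row_mul mulmx_sum_row linear_sum mulmx_suml big1 ?mxE // => c _.
      by rewrite linearZ -scalemxAl /= kA scaler0.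
    by rewrite !mxE; apply: eq_bigr => c _; rewrite [X in X * _ = _]mxE.
  by have := ell_neq0 (co x); rewrite -[ell _](mulKmx us) e0 mulmx0 eqxx.
have := chart_vanish pg hg (sub p C1p) rp AS.
have eA (r c : nat) : (r < 3)%N -> (c < 10)%N -> ent (row (inord r) A) c = (c == (r + 2)%N)%:R.
  move=> hr hc; rewrite /ent !mxE !inordK // eq_sym.
  by case: r hr => [|[|[|//]]].
(* The rows are distinct unit vectors up to sign, so the determinant has square 1. *)
have RR : sepmx A *m (sepmx A)^T = 1%:M.
  have sE (i j : 'I_5) : sepmx A i j = an (fun c => (c == (nth 0 [:: 0; 0; 1; 2;
    2] i + 2))%N%:R)
      (nth 0%N [:: 0; 3; 0; 1; 2]%N i) j.
    have li : (nth 0%N [:: 0; 3; 0; 1; 2]%N i < 5)%N by case: i => [[|[|[|[|[|//]]]]] ?].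
    have ri : (nth 0%N [:: 0; 0; 1; 2; 2]%N i < 3)%N by case: i {li} => [[|[|[|[|[|//]]]]] ?].
    have px (a b : 'I_5) : (a < b)%N -> (pidx a b < 10)%N.
      by move=> ab; have := all5P (all5P pidxP2 a) b; rewrite ab => /and3P [].
    rewrite mxE alt_ent inordK // /an; case: ifP => [lt|_].
      by rewrite eA // -[nth _ _ _]/(val (Ordinal li)); apply: px.
    case: ifP => [lt|//]; rewrite eA // -[nth _ _ _]/(val (Ordinal li)); exact: px.
  apply/matrixP => i j; rewrite mxE; under eq_bigr => c _ do rewrite sE [X in _ * X]mxE sE.
  rewrite !big_ord_recl big_ord0 mxE.
  by case: i => [[|[|[|[|[|//]]]]] ?]; case: j => [[|[|[|[|[|//]]]]] ?]; rewrite /an /=; ring.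
move=> d0; have := congr1 determinant RR; rewrite det_mulmx d0 mul0r det1 => /eqP.
by rewrite eq_sym oner_eq0.
Qed.

End Separation.

Theorem theorem5p9 (k : closedFieldType) (hchar : ~~ (2%N \in [pchar k])) :
  exists C1 C2 : Hpoint k -> Prop,
    Hcomponent C1 /\ Hcomponent C2 /\
    (forall p, C1 p \/ C2 p) /\
    (forall C, Hcomponent C -> (forall p, C p <-> C1 p) \/ (forall p, C p <-> C2 p)) /\
    Hdim C1 14 /\ Hdim C2 15 /\
    exists p : Hpoint k, is_lex_ideal (proj1_sig p) /\ C1 p /\ C2 p.
Proof.
have two : (2 : k) != 0 by apply: contraNneq hchar => e; rewrite inE /= e eqxx.
have irr1 := @C1_irreducible k; have irr2 := @C2_irreducible k.
have dim1 := @C1_dim k; have dim2 := @C2_dim k.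
have n12 := @C1_not_sub_C2 k.
(* Otherwise the chain of length 15 inside C2 would lie in C1, which has dimension 14. *)
have n21 : ~ subs (@C2 k) (@C1 k).
  move=> sub; case: dim1 => _; apply; case: dim2 => -[c [irr [step top]]] _.
  by exists c; split=> //; split=> // p /top /sub.
have cover (p : Hpoint k) : C1 p \/ C2 p.
  have [A [P [fA w rp]]] := has_rep p; have [_ fP] := rep_row_free rp.
  case: (classification two fA fP w) => [[l [l0 lA lP]]|[g ug eP]].
    by right; apply: C2_rep_killed l0 lA lP w rp.
  left; apply: (C1_rep_frame ug) (rep_change rp (eqmx_refl _) eP).
  by apply: wzm_eq w; rewrite ?submx_refl ?eP.
have above W : Hirreducible W -> subs W (@C1 k) \/ subs W (@C2 k).
  move=> [_ [_ iW]]; apply: iW; [exact: (proj1 irr1) | exact: (proj1 irr2) |].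
  by move=> p _; apply: cover.
exists (@C1 k), (@C2 k); split; [|split; [|split; [|split; [|split; [|split]]]]] => //.
- split=> // W irrW s1; case: (above W irrW) => // s2.
  by case: n12 => p /s1 /s2.
- split=> // W irrW s2; case: (above W irrW) => // s1.
  by case: n21 => p /s2 /s1.
- move=> C [irrC maxC]; case: (above C irrC) => s; [left | right] => p; split; try exact: s.
    exact: (maxC _ irr1 s).
  exact: (maxC _ irr2 s).
have fA : row_free (Alex k) by exact: selr_free.
have fB : row_free (Blex k) by exact: selr_free.
have fP : row_free (P0 k) by rewrite P0E; exact: selr_free.
have BP : Blex k *m (P0 k)^T = 0 by rewrite P0E; exact: sel_orth0.
have hAB (m : 'I_5) : (Alex k *m capm k m <= Blex k)%MS.
  exact: perp_perp fP fB erefl BP (proj1 (wzm_cap _ _) (@wz_lex k) m).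
pose p := pt_of fA fB hAB.
have rp : rep p (Alex k) (P0 k) by exists (Blex k); split=> //; exact: pt_of_bases.
exists p; split; first exact/ptmx_lex/ptmx_ideal.
split.
  by apply: (@C1_rep_frame k p (Alex k) 1%:M); rewrite ?unitmx1 // L21 mulmx1 //; exact: wz_lex.
(* V and P involve only e_0, ..., e_3, so (0, 0, 0, 0, 1) kills both. *)
have l0 := ell_neq0 (fun=> 0 : k).
apply: (@C2_rep_killed k p _ _ _ l0 _ _ (@wz_lex k) rp) => i.
  apply: (@lift_killed k (fun=> 0) (i == 0%N :> nat)%:R (i == 1%N :> nat)%:R (i == 2%N :>
    nat)%:R 0 0 0) => c hc.
  rewrite /ent !mxE inordK //.
  by case: i => [[|[|[|//]]] ?]; case: c hc => [|[|[|[|[|[|[|[|[|[|//]]]]]]]]]] _ /=;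
    rewrite ?mulr0 ?addr0 ?subr0 ?oppr0.
apply: (@lift_killed k (fun=> 0) (i == 0%N :> nat)%:R (i == 1%N :> nat)%:R 0 0 0 0) => c hc.
rewrite /ent !mxE inordK //.
by case: i => [[|[|//]] ?]; case: c hc => [|[|[|[|[|[|[|[|[|[|//]]]]]]]]]] _ /=;
  rewrite ?mulr0 ?addr0 ?subr0 ?oppr0.
Qed.
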